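(* Let $G=(V,E)$ be a series-parallel digraph with a multiflow instance given by commodities $i\in[k]$ with source-sink pairs $(s_i,t_i)$ and demands $d_i$, and let $d_{\max}=\max_{i\in[k]}d_i$. For any multiflow $X$ in $G$, its total arc flows $(x_e)_{e\in E}$ can be expressed as a convex combination of total arc flows $(y_e)_{e\in E}$ of unsplittable multiflows each satisfying $$x_e-2d_{\max}<y_e<x_e+2d_{\max}\qquad\text{for every arc } e\in E.$$ Moreover, the unsplittable multiflows and the coefficients of the convex combination can be computed efficiently (in polynomial time).
   Context: Digraphs may have parallel arcs. A digraph $G=(V,E)$ is series-parallel if it has a designated start node $u_0$ and end node $v_0$ such that one of the following (recursively) holds: (1) $G$ consists of a single arc from $u_0$ to $v_0$; (2) (series composition) there are series-parallel digraphs $G_1=(V_1,E_1)$, $G_2=(V_2,E_2)$ with start/end nodes $u_1,v_1$ and $u_2,v_2$ such that $V=V_1\cup V_2$, $E$ is the disjoint union of $E_1$ and $E_2$, $u_0=u_1$, $v_1=u_2$, $v_0=v_2$, $V_1\cap V_2=\{v_1\}$; (3) (parallel composition) there are such $G_1,G_2$ with $V=V_1\cup V_2$, $E$ the disjoint union of $E_1$ and $E_2$, $u_0=u_1=u_2$, $v_0=v_1=v_2$, $V_1\cap V_2=\{u_0,v_0\}$. A multiflow instance on $G$ consists of $k\ge1$ commodities $i\in[k]=\{1,\dots,k\}$ with source-sink pairs $(s_i,t_i)\in V\times V$ and real demands $d_i>0$, where $s_i\ne t_i$ and $G$ contains an $s_i$–$t_i$ path for each $i$. A multiflow $X=(X_{e,i})_{e\in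 E,i\in[k]}$ consists of values $X_{e,i}\ge0$ such that for all $v\in V$, $i\in[k]$, $\sum_{e\in\delta^+(v)}X_{e,i}-\sum_{e\in\delta^-(v)}X_{e,i}$ equals $d_i$ if $v=s_i$, $-d_i$ if $v=t_i$, and $0$ otherwise ($\delta^+(v),\delta^-(v)$ are the sets of arcs leaving and entering $v$). Its total arc flow is $x=(x_e)_{e\in E}$ with $x_e=\sum_{i\in[k]}X_{e,i}$. A multiflow is unsplittable if $X_{e,i}\in\{0,d_i\}$ for all $e,i$ and, for each $i$, the arcs $e$ with $X_{e,i}=d_i$ form an $s_i$–$t_i$ path. *)

(* Defs.v *)
From HB Require Import structures.
From mathcomp Require Import all_boot all_order all_algebra.
From mathcomp Require Import reals.

Set Implicit Arguments.
Unset Strict Implicit.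
Unset Printing Implicit Defensive.

Import Order.TTheory GRing.Theory Num.Theory.
Local Open Scope ring_scope.

Record digraph (V E : finType) := Digraph { tail : E -> V; head : E -> V }.

(* [sp_part G W F u v]: the subgraph with node set W and arc set F is
   series-parallel with start node u and end node v.  The single arc is not a
   loop, so start and end node are always distinct. *)
Inductive sp_part (V E : finType) (G : digraph V E) :
    {set V} -> {set E} -> V -> V -> Prop :=
| SPArc (e : E) :
    tail G e != head G e ->
    sp_part G [set tail G e; head G e] [set e] (tail G e) (head G e)
| SPSeries (V1 V2 : {set V}) (E1 E2 : {set E}) (u w v : V) :
    sp_part G V1 E1 u w -> sp_part G V2 E2 w v ->
    [disjoint E1 & E2] -> V1 :&: V2 = [set w] ->
    sp_part G (V1 :|: V2) (E1 :|: E2) u v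
| SPParallel (V1 V2 : {set V}) (E1 E2 : {set E}) (u v : V) :
    sp_part G V1 E1 u v -> sp_part G V2 E2 u v ->
    [disjoint E1 & E2] -> V1 :&: V2 = [set u; v] ->
    sp_part G (V1 :|: V2) (E1 :|: E2) u v.

Definition series_parallel (V E : finType) (G : digraph V E) : Prop :=
  exists u0 v0 : V, sp_part G [set: V] [set: E] u0 v0.

Fixpoint walk (V E : finType) (G : digraph V E) (s : V) (p : seq E) (t : V) :
    bool :=
  if p is e :: p' then (tail G e == s) && walk G (head G e) p' t else s == t.

Definition dipath (V E : finType) (G : digraph V E) (s : V) (p : seq E) (t : V) :
    bool :=
  walk G s p t && uniq (s :: [seq head G e | e <- p]).

Record commodities (V : finType) (R : realFieldType) (k : nat) := Commodities {
  source : 'I_k -> V;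
  sink : 'I_k -> V;
  demand : 'I_k -> R }.

Definition multiflow_instance (V E : finType) (R : realFieldType) (k : nat)
    (G : digraph V E) (C : commodities V R k) : Prop :=
  (0 < k)%N /\
  forall i : 'I_k, [/\ 0 < demand C i, source C i != sink C i
    & exists p : seq E, dipath G (source C i) p (sink C i)].

(* Demands are positive and k > 0, so the neutral value 0 is harmless. *)
Definition dmax (V : finType) (R : realFieldType) (k : nat)
    (C : commodities V R k) : R :=
  \big[Num.max/0]_(i < k) demand C i.

Definition multiflow (V E : finType) (R : realFieldType) (k : nat)
    (G : digraph V E) (C : commodities V R k) (X : E -> 'I_k -> R) : Prop :=
  (forall e i, 0 <= X e i) /\
  forall (v : V) (i : 'I_k),
    \sum_(e | tail G e == v) X e i - \sum_(e | head G e == v) X e i =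
    if v == source C i then demand C i
    else if v == sink C i then - demand C i else 0.

Definition total_flow (E : finType) (R : realFieldType) (k : nat)
    (X : E -> 'I_k -> R) (e : E) : R :=
  \sum_(i < k) X e i.

Definition unsplittable (V E : finType) (R : realFieldType) (k : nat)
    (G : digraph V E) (C : commodities V R k) (X : E -> 'I_k -> R) : Prop :=
  [/\ multiflow G C X,
      forall e i, X e i = 0 \/ X e i = demand C i
    & forall i, exists2 p : seq E, dipath G (source C i) p (sink C i)
        & forall e, (X e i == demand C i) = (e \in p)].

Definition unsplittable_combination (V E : finType) (R : realFieldType)
    (k : nat) (G : digraph V E) (C : commodities V R k) (X : E -> 'I_k -> R)
    (N : nat) (lam : 'I_N -> R) (Y : 'I_N -> E -> 'I_k -> R) : Prop :=
  [/\ (forall j, 0 <= lam j) /\ \sum_(j < N) lam j = 1,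
      forall e, total_flow X e = \sum_(j < N) lam j * total_flow (Y j) e,
      forall j, unsplittable G C (Y j)
    & forall j e, total_flow X e - 2 * dmax C < total_flow (Y j) e
                  < total_flow X e + 2 * dmax C].

(* A uniform model of computation: while-programs acting on finite binary trees
   whose leaves carry rational numbers, with bit-size (logarithmic) cost. *)
Inductive data := Num (q : rat) | Pair (a b : data).

Definition bits (n : nat) : nat := (trunc_log 2 n).+1.

Fixpoint dsize (a : data) : nat :=
  match a with
  | Num q => (bits `|numq q| + bits `|denq q|).+1
  | Pair b c => (dsize b + dsize c).+1
  end.

Inductive prim :=
  Id | Const (q : rat) | Fst | Snd | IsPair | Add | Opp | Mul | Inv | Floor | Le.

Definition num_of_bool (b : bool) : data := Num (if b then 1 else 0).

(* Each primitive is computable in time polynomial in [dsize]; ill-typed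
   applications are the identity. *)
Definition prim_eval (f : prim) (a : data) : data :=
  match f, a with
  | Const q, _ => Num q
  | Fst, Pair b _ => b
  | Snd, Pair _ c => c
  | IsPair, Pair _ _ => num_of_bool true
  | IsPair, Num _ => num_of_bool false
  | Add, Pair (Num x) (Num y) => Num (x + y)
  | Opp, Num x => Num (- x)
  | Mul, Pair (Num x) (Num y) => Num (x * y)
  | Inv, Num x => Num x^-1
  | Floor, Num x => Num (Num.floor x)%:~R
  | Le, Pair (Num x) (Num y) => num_of_bool (x <= y)
  | _, _ => a
  end.

Definition truthy (a : data) : bool := if a is Num q then q != 0 else true.

Inductive prog :=
| Prim (f : prim)
| Seq (p q : prog)
| Fork (p q : prog)
| If (c p q : prog)
| While (c p : prog).

(* [runs p a t b]: on input a, the program p halts with output b in time t.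
   A primitive is charged for reading its whole input and writing its whole
   output, so t always bounds the sizes of a, b and of all intermediate values. *)
Inductive runs : prog -> data -> nat -> data -> Prop :=
| RunPrim f a :
    runs (Prim f) a (dsize a + dsize (prim_eval f a)) (prim_eval f a)
| RunSeq p q a b c t u :
    runs p a t b -> runs q b u c -> runs (Seq p q) a (t + u).+1 c
| RunFork p q a b c t u :
    runs p a t b -> runs q a u c -> runs (Fork p q) a (t + u).+1 (Pair b c)
| RunIfTrue c p q a b r t u :
    runs c a t b -> truthy b -> runs p a u r -> runs (If c p q) a (t + u).+1 r
| RunIfFalse c p q a b r t u :
    runs c a t b -> ~~ truthy b -> runs q a u r ->
    runs (If c p q) a (t + u).+1 r
| RunWhileStop c p a b t :
    runs c a t b -> ~~ truthy b -> runs (While c p) a t.+1 a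
| RunWhileStep c p a b a' r t u w :
    runs c a t b -> truthy b -> runs p a u a' -> runs (While c p) a' w r ->
    runs (While c p) a (t + u + w).+1 r.

Definition enc_nat (n : nat) : data := Num n%:R.

Definition enc_list (s : seq data) : data := foldr Pair (Num 0) s.

Definition enc_fun (n : nat) (f : 'I_n -> data) : data :=
  enc_list [seq f i | i <- enum 'I_n].

Definition enc_digraph (n m : nat) (G : digraph 'I_n 'I_m) : data :=
  Pair (enc_nat n)
       (enc_fun (fun e => Pair (enc_nat (tail G e)) (enc_nat (head G e)))).

Definition enc_commodities (n k : nat) (C : commodities 'I_n rat k) : data :=
  enc_fun (fun i => Pair (enc_nat (source C i))
                         (Pair (enc_nat (sink C i)) (Num (demand C i)))).

Definition enc_flow (m k : nat) (X : 'I_m -> 'I_k -> rat) : data :=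
  enc_fun (fun e => enc_fun (fun i => Num (X e i))).

Definition enc_input (n m k : nat) (G : digraph 'I_n 'I_m)
    (C : commodities 'I_n rat k) (X : 'I_m -> 'I_k -> rat) : data :=
  Pair (enc_digraph G) (Pair (enc_commodities C) (enc_flow X)).

Definition enc_combination (m k N : nat) (lam : 'I_N -> rat)
    (Y : 'I_N -> 'I_m -> 'I_k -> rat) : data :=
  enc_fun (fun j => Pair (Num (lam j)) (enc_flow (Y j))).

(* Main.v *)
From HB Require Import structures.
From mathcomp Require Import all_boot all_order all_algebra.
From mathcomp Require Import reals.
From mathcomp Require Import zify ring lra.
Require Import Defs.

(** A series-parallel digraph has a decomposition tree, and each commodity splits into
    pieces that cross whole parts of this tree.  Route the commodities top-down: a part
    receives a list of commodities, the amounts being intervals [lo, hi) of [0, d i); a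
    series node passes its list to both parts, inserting behind the first item the
    commodities that only cross this part; a parallel node cuts its list into two
    consecutive lists of the prescribed amounts.  Only the first and the last item of a
    list are ever fractional, so on every arc at most two commodities are fractional.
    Routing commodity [i] along the arcs whose interval contains [theta * d i], with one
    threshold [theta] common to all commodities, gives an unsplittable multiflow that on
    every arc differs from the given flow in at most two commodities, each by less than its
    demand; averaging over [theta] in [0, 1) returns the given total flow.  This map is
    constant on the pieces cut out by the interval ends, which are polynomially many.

    The tree is found by repeated series and parallel reductions, which preserve
    series-parallelity.  All numbers stay small because they share the product of
    the denominators of the input as a denominator. *)

Set Implicit Arguments.
Unset Strict Implicit.
Unset Printing Implicit Defensive.

Import Order.TTheory GRing.Theory Num.Theory.

Local Open Scope ring_scope.

(** * Series-parallel arc lists are closed under reductions *)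

(** Rounding part after part would let errors add up along the tree. So a node decides nothing: a
    part only learns which subset of [[0, d i)] each commodity receives, and all decisions are
    deferred to the single number theta. Cutting an interval in two sends each threshold to exactly
    one side, so conservation holds for every theta without repair.

    The obstacle is a commodity with an endpoint inside a series part, since it enters or leaves the
    lists halfway. It is harmless because an acyclic flow never returns to a part it has left: a
    commodity that crosses one child of a series node and has an endpoint at the middle node or
    inside the other child crosses with its whole demand. Its interval is all of [[0, d i)], covered
    by every theta, so the items inserted at series nodes are never fractional and can be hidden
    between the two ends of the list.

    Strictness of the bounds comes from the half-open intervals: a covered item has positive length,
    and an uncovered one is not all of [[0, d i)]. *)

Section SeriesParallelLists.
Variable V : eqType.
Implicit Types (A B C : seq (V * V)) (u v w x y z : V).

Definition touches x (a : V * V) := (a.1 == x) || (a.2 == x).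
Notation on x A := (has (touches x) A).

(** Arc names are dropped and only endpoint pairs are kept, as a list up to permutation: a part
    contracted by the parser is then just one more arc, and parallel arcs keep their
    multiplicity. *)
Inductive sp : seq (V * V) -> V -> V -> Prop :=
| SpArc u v : u != v -> sp [:: (u, v)] u v
| SpSer A B C u w v :
    sp A u w -> sp B w v -> (forall x, on x A -> on x B -> x = w) ->
    perm_eq C (A ++ B) -> sp C u v
| SpPar A B C u v :
    sp A u v -> sp B u v -> (forall x, on x A -> on x B -> x = u \/ x = v) ->
    perm_eq C (A ++ B) -> sp C u v.

Lemma on_perm x A B : perm_eq A B -> on x A = on x B.
Proof. by move/perm_mem/eq_has_r. Qed.

Lemma on_mem x A a : a \in A -> touches x a -> on x A.
Proof. by move=> aA xa; apply/hasP; exists a. Qed.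

Lemma sp_perm A B u v : sp A u v -> perm_eq A B -> sp B u v.
Proof.
case=> [{}u {}v uv | A1 A2 C {}u w {}v s1 s2 h p | A1 A2 C {}u {}v s1 s2 h p] q.
- by rewrite perm_sym in q; rewrite (perm_small_eq _ q) //; apply: SpArc.
- by apply: (SpSer s1 s2 h); rewrite -(permPl q).
- by apply: (SpPar s1 s2 h); rewrite -(permPl q).
Qed.

Lemma sp_on A u v : sp A u v -> on u A /\ on v A.
Proof.
elim=> {A u v} [u v uv | A B C u w v _ [uA _] _ [_ vB] _ p | A B C u v _ [uA vA] _ _ _ p].
- by rewrite /= /touches /= !eqxx orbT.
- by rewrite !(on_perm _ p) !has_cat uA vB orbT.
- by rewrite !(on_perm _ p) !has_cat uA vA.
Qed.

Lemma sp_neq A u v : sp A u v -> u != v.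
Proof.
elim=> {A u v} // A B C u w v sA uw sB wv h _.
apply/eqP=> uv; subst v; case/eqP: uw; apply: h.
  by case: (sp_on sA).
by case: (sp_on sB).
Qed.

(** In a series node an arc of [A] leaving [v] would make [v] a shared node, hence equal to [w], and
    by induction no arc of [A] leaves [w]; arcs of [B] entering [u] are excluded in the same way. *)
Lemma sp_arcs A u v a : sp A u v -> a \in A -> [/\ a.1 != a.2, a.2 != u & a.1 != v].
Proof.
move=> sA; elim: sA a => {A u v} [u v uv | A B C u w v sA IA sB IB h p | A B C u v sA IA sB IB h p] a.
- by rewrite inE => /eqP-> /=; rewrite uv eq_sym uv.
- rewrite (perm_mem p) mem_cat => /orP[] aA.
    have [? ? aw] := IA _ aA; split=> //; apply/eqP=> e.
    have e' : v = w.
      by apply: h; [apply: (on_mem aA); rewrite /touches e eqxx | case: (sp_on sB)].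
    by rewrite -e' e eqxx in aw.
  have [? aw ?] := IB _ aA; split=> //; apply/eqP=> e.
  have e' : u = w.
    by apply: h; [case: (sp_on sA) | apply: (on_mem aA); rewrite /touches e eqxx orbT].
  by rewrite -e' e eqxx in aw.
- by rewrite (perm_mem p) mem_cat => /orP[/IA|/IB].
Qed.

Lemma perm_insert (T : eqType) (a : T) s s1 s2 :
  perm_eq s (s1 ++ s2) -> perm_eq (a :: s) (s1 ++ a :: s2).
Proof. by move=> p; rewrite -(cat1s a s2) perm_sym perm_catCA perm_cons perm_sym. Qed.

Lemma perm_cons_cat (T : eqType) (e : T) s s1 s2 : perm_eq (s1 ++ s2) (e :: s) ->
  (exists2 s', perm_eq s1 (e :: s') & perm_eq s (s' ++ s2)) \/
  (exists2 s', perm_eq s2 (e :: s') & perm_eq s (s1 ++ s')).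
Proof.
move=> p; have : e \in s1 ++ s2 by rewrite (perm_mem p) mem_head.
rewrite mem_cat => /orP[] es; [left; exists (rem e s1) | right; exists (rem e s2)];
  rewrite ?perm_to_rem //; rewrite -(perm_cons e) -(permPl p).
  by rewrite -cat_cons perm_cat2r perm_to_rem.
by rewrite perm_sym (permPl (perm_insert e (perm_refl _))) perm_cat2l perm_sym perm_to_rem.
Qed.

(** Locates the two arcs of a reduction in a composition. The two mixed cases are kept apart because
    a series reduction orders its arcs. *)
Lemma perm_cons2_cat (T : eqType) (e f : T) s s1 s2 :
  perm_eq (s1 ++ s2) [:: e, f & s] ->
  [\/ exists2 s', perm_eq s1 [:: e, f & s'] & perm_eq s (s' ++ s2),
      exists2 s', perm_eq s2 [:: e, f & s'] & perm_eq s (s1 ++ s'),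
      (exists t1 t2, [/\ perm_eq s1 (e :: t1), perm_eq s2 (f :: t2)
        & perm_eq s (t1 ++ t2)]) |
      (exists t1 t2, [/\ perm_eq s1 (f :: t1), perm_eq s2 (e :: t2)
        & perm_eq s (t1 ++ t2)])].
Proof.
case/perm_cons_cat=> -[s' p q]; rewrite perm_sym in q; case/perm_cons_cat: q => -[s'' p' q].
- apply: Or41; exists s'' => //; apply: perm_trans p _; by rewrite perm_cons.
- by apply: Or43; exists s', s''.
- by apply: Or44; exists s'', s'.
- apply: Or42; exists s'' => //; apply: perm_trans p _; by rewrite perm_cons.
Qed.

Lemma on_cons x a A : on x (a :: A) = touches x a || on x A. Proof. by []. Qed.

(** Serves the case where two equal arcs lie in different branches of a parallel node. In a series
    node such an arc cannot occur: inside [A] it would make [v] a shared node, inside [B] it would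
    make [u] one, and the only shared node is [w]. *)
Lemma sp_remove_arc A A' u v : sp A u v -> perm_eq A ((u, v) :: A') ->
  A' = [::] \/ sp A' u v.
Proof.
move=> sA; elim: sA A' => {A u v} [u v uv | A B C u w v sA IA sB IB h p | A B C u v sA IA sB IB h p] A' q.
- left; by have := perm_size q; case: A' {q}.
- have := mem_head (u, v) A'; rewrite -(perm_mem q) (perm_mem p) mem_cat => /orP[] aA.
    have e : v = w.
      by apply: h; [apply: (on_mem aA); rewrite /touches eqxx orbT | case: (sp_on sB)].
    by have := sp_neq sB; rewrite e eqxx.
  have e : u = w.
    by apply: h; [case: (sp_on sA) | apply: (on_mem aA); rewrite /touches eqxx].
  by have := sp_neq sA; rewrite e eqxx.
- right; rewrite (permPl p) in q; case/perm_cons_cat: q => -[s' q r].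
    case: (IA _ q) => [e | sA']; first by apply: sp_perm sB _; rewrite perm_sym; move: r; rewrite e.
    apply: (SpPar sA' sB) r => x xA xB; apply: h => //.
    by rewrite (on_perm _ q) on_cons xA orbT.
  case: (IB _ q) => [e | sB'].
    by apply: sp_perm sA _; rewrite perm_sym; move: r; rewrite e cats0.
  apply: (SpPar sA sB') r => x xA xB; apply: h => //.
  by rewrite (on_perm _ q) on_cons xB orbT.
Qed.

(** The reduction may ignore the decomposition that witnesses [sp C u v], which is what allows
    greedy parsing. Only copies in different components need an argument: in a series node both of
    their ends would be [w], a loop. *)
Lemma sp_merge_par C C' u v x y :
  sp C u v -> perm_eq C [:: (x, y), (x, y) & C'] -> sp ((x, y) :: C') u v.
Proof.
move=> sC; elim: sC C' => {C u v} [u v uv | A B C u w v sA IA sB IB h p | A B C u v sA IA sB IB h p] C' q.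
- by have := perm_size q.
- rewrite (permPl p) in q; case/perm_cons2_cat: q => [[s' q r]|[s' q r]|[s1 [s2 [q1 q2 _]]]|[s1 [s2 [q1 q2 _]]]].
  + apply: (SpSer (IA _ q) sB); last by rewrite cat_cons perm_cons.
    by move=> z zA; apply: h; move: zA; rewrite (on_perm _ q) !on_cons orbA orbb.
  + apply: (SpSer sA (IB _ q)).
      by move=> z zA zB; apply: h => //; move: zB; rewrite (on_perm _ q) !on_cons orbA orbb.
    exact: perm_insert.
  + have e1 : x = w by apply: h; rewrite (on_perm _ q1, on_perm _ q2) on_cons /touches /= eqxx.
    have e2 : y = w by apply: h; rewrite (on_perm _ q1, on_perm _ q2) on_cons /touches /= eqxx orbT.
    have xyA : (x, y) \in A by rewrite (perm_mem q1) mem_head.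
    by have [] := sp_arcs sA xyA; rewrite /= e1 e2 eqxx.
  + have e1 : x = w by apply: h; rewrite (on_perm _ q1, on_perm _ q2) on_cons /touches /= eqxx.
    have e2 : y = w by apply: h; rewrite (on_perm _ q1, on_perm _ q2) on_cons /touches /= eqxx orbT.
    have xyA : (x, y) \in A by rewrite (perm_mem q1) mem_head.
    by have [] := sp_arcs sA xyA; rewrite /= e1 e2 eqxx.
- rewrite (permPl p) in q.
  (* Copies in different branches have shared endpoints, so they run from [u] to [v]; each is
     removed from its branch, and one copy comes back as a branch of its own. *)
  have cross s1 s2 : perm_eq A ((x, y) :: s1) -> perm_eq B ((x, y) :: s2) ->
      perm_eq C' (s1 ++ s2) -> sp ((x, y) :: C') u v.
    move=> q1 q2 r.
    have xyA : (x, y) \in A by rewrite (perm_mem q1) mem_head.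
    have xyB : (x, y) \in B by rewrite (perm_mem q2) mem_head.
    have [xy yu xv] := sp_arcs sA xyA.
    have e1 : x = u.
      case: (h x) => //; [by apply: on_mem xyA _; rewrite /touches eqxx
        | by apply: on_mem xyB _; rewrite /touches eqxx |].
      by move=> e; rewrite /= e eqxx in xv.
    have e2 : y = v.
      case: (h y) => //; [by apply: on_mem xyA _; rewrite /touches eqxx orbT
        | by apply: on_mem xyB _; rewrite /touches eqxx orbT |].
      by move=> e; rewrite /= e eqxx in yu.
    subst x y.
    have s0 : sp [:: (u, v)] u v by exact: SpArc (sp_neq sA).
    have on0 D z : on z [:: (u, v)] -> on z D -> z = u \/ z = v.
      by rewrite /= orbF /touches => /orP[]/eqP <-; [left|right].
    case: (sp_remove_arc sA q1) => [z1 | t1]; case: (sp_remove_arc sB q2) => [z2 | t2].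
    - by apply: sp_perm s0 _; rewrite perm_cons perm_sym; move: r; rewrite z1 z2.
    - apply: (SpPar s0 t2) => [z|]; first exact: on0.
      by rewrite cat1s perm_cons; move: r; rewrite z1.
    - apply: (SpPar s0 t1) => [z|]; first exact: on0.
      by rewrite cat1s perm_cons; move: r; rewrite z2 cats0.
    - have t12 : sp C' u v.
        apply: (SpPar t1 t2) r => z z1 z2.
        by apply: h; rewrite (on_perm _ q1, on_perm _ q2) on_cons (z1, z2) orbT.
      by apply: (SpPar s0 t12) => // z; apply: on0.
  case/perm_cons2_cat: q => [[s' q r]|[s' q r]|[s1 [s2 [q1 q2 r]]]|[s1 [s2 [q1 q2 r]]]].
  + apply: (SpPar (IA _ q) sB); last by rewrite cat_cons perm_cons.
    by move=> z zA; apply: h; move: zA; rewrite (on_perm _ q) !on_cons orbA orbb.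
  + apply: (SpPar sA (IB _ q)).
      by move=> z zA zB; apply: h => //; move: zB; rewrite (on_perm _ q) !on_cons orbA orbb.
    exact: perm_insert.
  + exact: cross q1 q2 r.
  + exact: cross q1 q2 r.
Qed.

(** A parallel node cannot occur, since its other branch also touches [v]; so the arc is peeled off
    along the second components of series nodes. This and its mirror image make room at the middle
    node in [sp_merge_ser]. *)
Lemma sp_last_arc A A' u v x : sp A u v -> perm_eq A ((x, v) :: A') -> ~~ on v A' ->
  (A' = [::] /\ u = x) \/ sp A' u x.
Proof.
move=> sA; elim: sA A' => {A u v} [u v uv | A B C u w v sA IA sB IB h p | A B C u v sA IA sB IB h p] A' q nv.
- left; have := perm_size q; case: A' {nv} q => // q _; split=> //.
  by have [] := perm_small_eq (isT : size [:: _] <= 1)%N q.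
- rewrite (permPl p) in q; case/perm_cons_cat: q => -[s' q r].
    have e : v = w.
      apply: h; [by rewrite (on_perm _ q) on_cons /touches /= eqxx orbT | by case: (sp_on sB)].
    by have := sp_neq sB; rewrite e eqxx.
  right; have nv' : ~~ on v s' by move: nv; rewrite (on_perm _ r) has_cat => /norP[].
  case: (IB _ q nv') => [[e <-] | sB'].
    by apply: sp_perm sA _; rewrite perm_sym; move: r; rewrite e cats0.
  apply: (SpSer sA sB') r => z zA zB; apply: h => //.
  by rewrite (on_perm _ q) on_cons zB orbT.
- rewrite (permPl p) in q; case/perm_cons_cat: q => -[s' q r];
    move: nv; rewrite (on_perm _ r) has_cat => /norP[].
    by move=> _; case: (sp_on sB) => _ ->.
  by case: (sp_on sA) => _ ->.
Qed.

Lemma sp_first_arc A A' u v y : sp A u v -> perm_eq A ((u, y) :: A') -> ~~ on u A' ->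
  (A' = [::] /\ y = v) \/ sp A' y v.
Proof.
move=> sA; elim: sA A' => {A u v} [u v uv | A B C u w v sA IA sB IB h p | A B C u v sA IA sB IB h p] A' q nu.
- left; have := perm_size q; case: A' {nu} q => // q _; split=> //.
  by have [] := perm_small_eq (isT : size [:: _] <= 1)%N q.
- rewrite (permPl p) in q; case/perm_cons_cat: q => -[s' q r]; last first.
    have e : u = w.
      apply: h; [by case: (sp_on sA) | by rewrite (on_perm _ q) on_cons /touches /= eqxx].
    by have := sp_neq sA; rewrite e eqxx.
  right; have nu' : ~~ on u s' by move: nu; rewrite (on_perm _ r) has_cat => /norP[].
  case: (IA _ q nu') => [[e ->] | sA'].
    by apply: sp_perm sB _; rewrite perm_sym; move: r; rewrite e.
  apply: (SpSer sA' sB) r => z zA zB; apply: h => //.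
  by rewrite (on_perm _ q) on_cons zA orbT.
- rewrite (permPl p) in q; case/perm_cons_cat: q => -[s' q r];
    move: nu; rewrite (on_perm _ r) has_cat => /norP[].
    by move=> _; case: (sp_on sB) => ->.
  by case: (sp_on sA) => ->.
Qed.

(** The delicate case has the two arcs on opposite sides of a series node: then [w] is its middle
    node, the last arc of [A] and the first arc of [B] are peeled off, and the new arc is composed
    between the remainders. *)
Lemma sp_merge_ser C C' u v x w y :
  sp C u v -> perm_eq C [:: (x, w), (w, y) & C'] -> ~~ on w C' ->
  sp ((x, y) :: C') u v.
Proof.
have sub D z : on z ((x, y) :: D) -> on z [:: (x, w), (w, y) & D].
  by rewrite !on_cons /touches /=; case: (x == z); case: (y == z); case: (w == z).
move=> sC; elim: sC C' => {C u v} [u v uv | A B C u m v sA IA sB IB h p | A B C u v sA IA sB IB h p] C' q nw.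
- by have := perm_size q.
- rewrite (permPl p) in q; case/perm_cons2_cat: q => [[s' q r]|[s' q r]|[s1 [s2 [q1 q2 r]]]|[s1 [s2 [q1 q2 r]]]];
    move: nw; rewrite (on_perm _ r) has_cat => /norP[nw1 nw2].
  + apply: (SpSer (IA _ q nw1) sB); last by rewrite cat_cons perm_cons.
    by move=> z zA; apply: h; rewrite (on_perm _ q); apply: sub.
  + apply: (SpSer sA (IB _ q nw2)).
      by move=> z zA zB; apply: h => //; rewrite (on_perm _ q); apply: sub.
    exact: perm_insert.
  + have e : w = m by apply: h; rewrite (on_perm _ q1, on_perm _ q2) on_cons /touches /= eqxx ?orbT.
    subst m.
    have aA : (x, w) \in A by rewrite (perm_mem q1) mem_head.
    have aB : (w, y) \in B by rewrite (perm_mem q2) mem_head.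
    have [xw _ _] := sp_arcs sA aA; have [wy _ _] := sp_arcs sB aB; rewrite /= in xw wy.
    have xA : on x A by apply: on_mem aA _; rewrite /touches eqxx.
    have yB : on y B by apply: on_mem aB _; rewrite /touches eqxx orbT.
    have sub1 z : on z s1 -> on z A by rewrite (on_perm _ q1) on_cons => ->; rewrite orbT.
    have sub2 z : on z s2 -> on z B by rewrite (on_perm _ q2) on_cons => ->; rewrite orbT.
    (* The new arc is no loop: if [x = y], this node would be shared, hence equal to [w], and
       [(x, w)] would be a loop. *)
    have s0 : sp [:: (x, y)] x y.
      apply: SpArc; apply/eqP=> xy; case/eqP: xw; apply: h => //; by rewrite xy.
    have left_part : sp (rcons s1 (x, y)) u y.
      case: (sp_last_arc sA q1 nw1) => [[-> ->] // | t1].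
      apply: (SpSer t1 s0) => [z z1|]; last by rewrite cats1.
      rewrite /= orbF /touches /= => /orP[]/eqP // e.
      case/negP: nw1; rewrite -(h y) ?e //; first exact: sub1.
      by rewrite -e.
    have C'E : perm_eq ((x, y) :: C') (rcons s1 (x, y) ++ s2).
      by rewrite cat_rcons; apply: perm_insert.
    case: (sp_first_arc sB q2 nw2) => [[e2 <-] | t2].
      by apply: sp_perm left_part _; rewrite perm_sym; move: C'E; rewrite e2 cats0.
    apply: (SpSer left_part t2) C'E => z z1 z2.
    move: z1; rewrite has_rcons => /orP[|/sub1 z1]; last first.
      by move: z2 (nw2) => /[dup] /sub2 z2; rewrite (h z z1 z2) => ->.
    rewrite /touches /= => /orP[]/eqP // e.
    by subst z; move: z2 (nw2) => /[dup] /sub2 z2; rewrite (h x xA z2) => ->.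
  (* The opposite order is impossible: [(w, y)] would be an arc of [A] leaving the end node of
     [A]. *)
  + have e : w = m by apply: h; rewrite (on_perm _ q1, on_perm _ q2) on_cons /touches /= eqxx ?orbT.
    have aA : (w, y) \in A by rewrite (perm_mem q1) mem_head.
    by have [_ _] := sp_arcs sA aA; rewrite e eqxx.
- rewrite (permPl p) in q.
  (* With one arc in each branch, [w] would be shared, hence [u] or [v]; but no arc enters [u] and
     none leaves [v]. *)
  have cross s1 s2 a b : perm_eq A (a :: s1) -> perm_eq B (b :: s2) ->
      touches w a -> touches w b -> (x, w) \in A ++ B -> (w, y) \in A ++ B -> False.
    move=> q1 q2 wa wb; rewrite -!(perm_mem p) => i1 i2.
    have [_ /= wu _] := sp_arcs (SpPar sA sB h p) i1.
    have [_ _ /= wv] := sp_arcs (SpPar sA sB h p) i2.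
    case: (h w).
    - by rewrite (on_perm _ q1) on_cons wa.
    - by rewrite (on_perm _ q2) on_cons wb.
    - by apply/eqP.
    - by apply/eqP.
  have i1 : (x, w) \in A ++ B by rewrite (perm_mem q) mem_head.
  have i2 : (w, y) \in A ++ B by rewrite (perm_mem q) !inE eqxx orbT.
  case/perm_cons2_cat: q => [[s' q r]|[s' q r]|[s1 [s2 [q1 q2 r]]]|[s1 [s2 [q1 q2 r]]]];
    move: nw; rewrite (on_perm _ r) has_cat => /norP[nw1 nw2].
  + apply: (SpPar (IA _ q nw1) sB); last by rewrite cat_cons perm_cons.
    by move=> z zA; apply: h; rewrite (on_perm _ q); apply: sub.
  + apply: (SpPar sA (IB _ q nw2)).
      by move=> z zA zB; apply: h => //; rewrite (on_perm _ q); apply: sub.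
    exact: perm_insert.
  + by case: (cross _ _ _ _ q1 q2); rewrite /touches /= ?eqxx ?orbT.
  + by case: (cross _ _ _ _ q1 q2); rewrite /touches /= ?eqxx ?orbT.
Qed.

Definition reducible C :=
  (exists x y C', perm_eq C [:: (x, y), (x, y) & C']) \/
  (exists x w y C', perm_eq C [:: (x, w), (w, y) & C'] /\ ~~ on w C').

Lemma reducible_perm C D : perm_eq C D -> reducible C -> reducible D.
Proof.
move=> p [[x [y [C' q]]] | [x [w [y [C' [q nw]]]]]].
  by left; exists x, y, C'; rewrite -(permPl p).
by right; exists x, w, y, C'; rewrite -(permPl p).
Qed.

Lemma sp_size A u v : sp A u v -> (0 < size A)%N.
Proof. by elim=> // {A u v} [A B C u w v|A B C u v] _ ? _ ? _ /perm_size ->; rewrite size_cat addn_gt0; apply/orP; left. Qed.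

Lemma reducible_catl A B :
  (forall x w y, (x, w) \in A -> (w, y) \in A -> ~~ on w B) -> reducible A -> reducible (A ++ B).
Proof.
move=> nB [[x [y [C' q]]] | [x [w [y [C' [q nw]]]]]].
  by left; exists x, y, (C' ++ B); rewrite -!cat_cons perm_cat2r.
right; exists x, w, y, (C' ++ B); split; first by rewrite -!cat_cons perm_cat2r.
rewrite has_cat (negPf nw) /=; apply: (nB x w y); rewrite (perm_mem q) ?mem_head //.
by rewrite !inE eqxx orbT.
Qed.

(** If both components are single arcs, the composition itself is a reduction. Otherwise a reduction
    inside a component survives: the middle node of a series reduction has an arc entering and an
    arc leaving it there, whereas shared nodes are terminals of the component and lack one of the
    two. *)
Lemma sp_reducible A u v : sp A u v -> A = [:: (u, v)] \/ reducible A.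
Proof.
have step A1 A2 C B : perm_eq C (A1 ++ A2) -> B = A1 ++ A2 -> reducible B -> reducible C.
  by move=> p -> r; apply: reducible_perm r; rewrite perm_sym.
elim=> {A u v} [u v uv|A B C u w v sA IA sB IB h p|A B C u v sA IA sB IB h p]; first by left.
- right; apply: step p erefl _; case: IA => [eA | redA]; last first.
    apply: reducible_catl redA => x z y _ zyA; apply/negP => zB.
    have zA : on z A by apply: on_mem zyA _; rewrite /touches eqxx.
    by have [_ _] := sp_arcs sA zyA; rewrite (h z zA zB) eqxx.
  case: IB => [eB | redB]; first by right; exists u, w, v, [::]; rewrite eA eB.
  apply: reducible_perm (_ : perm_eq (B ++ A) _) _; first by rewrite perm_catC.
  apply: reducible_catl redB => x z y xzB _; apply/negP => zA.
  have zB : on z B by apply: on_mem xzB _; rewrite /touches eqxx orbT.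
  by have [_] := sp_arcs sB xzB; rewrite (h z zA zB) eqxx.
- have cross D E x z y : sp D u v -> (x, z) \in D -> (z, y) \in D ->
      (on z D -> on z E -> z = u \/ z = v) -> ~~ on z E.
    move=> sD xzD zyD hz; apply/negP => zE.
    have [_ /= /eqP nu _] := sp_arcs sD xzD; have [_ _ /= /eqP nv] := sp_arcs sD zyD.
    by case: (hz _ zE) => //; apply: on_mem zyD _; rewrite /touches eqxx.
  right; apply: step p erefl _; case: IA => [eA | redA]; last first.
    by apply: reducible_catl redA => x z y h1 h2; apply: cross sA h1 h2 (h z).
  case: IB => [eB | redB]; first by left; exists u, v, [::]; rewrite eA eB.
  apply: reducible_perm (_ : perm_eq (B ++ A) _) _; first by rewrite perm_catC.
  by apply: reducible_catl redB => x z y h1 h2; apply: cross sB h1 h2 (fun zB zA => h z zA zB).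
Qed.

(* Series parts are rescaled to [0, 1/2] and [1/2, 1]; parallel parts already agree at 0 and 1. *)
Lemma sp_potential A u v : sp A u v -> exists pi : V -> rat,
  [/\ pi u = 0, pi v = 1 & forall a, a \in A -> [/\ 0 <= pi a.1, pi a.1 < pi a.2 & pi a.2 <= 1]].
Proof.
have onE D (a : V * V) : a \in D -> on a.1 D /\ on a.2 D.
  by move=> aD; split; apply: on_mem aD _; rewrite /touches eqxx ?orbT.
elim=> {A u v} [u v uv|A B C u w v sA [f [fu fw fA]] sB [g [gw gv gB]] h p|
    A B C u v sA [f [fu fv fA]] sB [g [gu gv gB]] h p].
- exists (fun x => if x == v then 1 else 0); rewrite (negPf uv) eqxx; split=> // a.
  by rewrite inE => /eqP -> /=; rewrite (negPf uv) eqxx.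
- have [uA wA] := sp_on sA; have [wB vB] := sp_on sB.
  exists (fun x => if on x A then f x / 2 else (1 + g x) / 2).
  have fE x : on x B -> (if on x A then f x / 2 else (1 + g x) / 2) = (1 + g x) / 2.
    by move=> xB; case: ifP => // xA; rewrite (h x xA xB) fw gw addr0.
  split; rewrite ?uA ?fu ?mul0r // ?fE ?gv //.
  move=> a; rewrite (perm_mem p) mem_cat => /orP[] aA; have [h1 h2] := onE _ _ aA.
    by rewrite h1 h2; have [] := fA _ aA; split; lra.
  by rewrite !fE //; have [] := gB _ aA; split; lra.
- have [uA vA] := sp_on sA; have [uB vB] := sp_on sB.
  exists (fun x => if on x A then f x else g x).
  have fE x : on x B -> (if on x A then f x else g x) = g x.
    by move=> xB; case: ifP => // xA; case: (h x xA xB) => ->; congruence.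
  split; rewrite ?uA ?vA //.
  move=> a; rewrite (perm_mem p) mem_cat => /orP[] aA; have [h1 h2] := onE _ _ aA.
    by rewrite h1 h2; apply: fA.
  by rewrite !fE //; apply: gB.
Qed.

End SeriesParallelLists.

Definition ends (V E : finType) (G : digraph V E) (e : E) : V * V := (tail G e, head G e).

(** The node sets survive only in the second conjunct, which turns the equations on [V1 :&: V2] into
    the conditions on shared nodes. *)
Lemma sp_of_part (V E : finType) (G : digraph V E) (W : {set V}) (F : {set E}) u v :
  sp_part G W F u v ->
  sp [seq ends G e | e <- enum F] u v /\
  (forall x, has (touches x) [seq ends G e | e <- enum F] -> x \in W).
Proof.
have enumU (E1 E2 : {set E}) : [disjoint E1 & E2] ->
    perm_eq [seq ends G e | e <- enum (E1 :|: E2)]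
            ([seq ends G e | e <- enum E1] ++ [seq ends G e | e <- enum E2]).
  move=> d; rewrite -map_cat; apply: perm_map; apply: uniq_perm.
  - exact: enum_uniq.
  - rewrite cat_uniq !enum_uniq andbT; apply/hasPn => e.
    by rewrite !mem_enum => e2; rewrite (disjointFl d e2).
  - by move=> e; rewrite mem_cat !mem_enum inE.
elim=> {W F u v} [e loop|V1 V2 E1 E2 u w v _ [s1 h1] _ [s2 h2] d W|V1 V2 E1 E2 u v _ [s1 h1] _ [s2 h2] d W].
- rewrite enum_set1 /=; split; first exact: SpArc.
  by move=> x; rewrite orbF /touches !inE ![x == _]eq_sym.
- split.
    apply: (SpSer s1 s2) (enumU _ _ d) => x /h1 x1 /h2 x2.
    by apply/set1P; rewrite -W inE x1 x2.
  move=> x; rewrite (on_perm _ (enumU _ _ d)) has_cat inE.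
  by case/orP => [/h1 -> | /h2 ->]; rewrite ?orbT.
- split.
    apply: (SpPar s1 s2) (enumU _ _ d) => x /h1 x1 /h2 x2.
    by apply/set2P; rewrite -W inE x1 x2.
  move=> x; rewrite (on_perm _ (enumU _ _ d)) has_cat inE.
  by case/orP => [/h1 -> | /h2 ->]; rewrite ?orbT.
Qed.

(** * Flows in acyclic digraphs *)

Inductive tree (E : Type) := Leaf (e : E) | Ser (a b : tree E) | Par (a b : tree E).

Fixpoint arcs (E : Type) (T : tree E) : seq E :=
  match T with
  | Leaf e => [:: e]
  | Ser a b | Par a b => arcs a ++ arcs b
  end.

Section AcyclicFlows.
Variables (V E : finType) (G : digraph V E) (pi : V -> rat).
Hypothesis pi_lt : forall e, pi (tail G e) < pi (head G e).

Section Flow.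
Variables (R : realFieldType) (f : E -> R) (s t : V) (d : R).
Hypotheses (f_ge0 : forall e, 0 <= f e) (d_ge0 : 0 <= d).
Hypothesis f_div : forall v,
  \sum_(e | tail G e == v) f e - \sum_(e | head G e == v) f e =
  d * ((v == s)%:R - (v == t)%:R).

Lemma sum_indicator (I : finType) (P : pred I) (x : I) :
  \sum_(v | P v) (v == x)%:R = (P x)%:R :> R.
Proof.
case: (boolP (P x)) => Px; last first.
  by apply: big1 => v Pv; case: eqP => // e; rewrite -e Pv in Px.
by rewrite (bigD1 x) //= eqxx big1 ?addr0 // => v /andP[_ /negPf->].
Qed.

(** Conservation is summed over all nodes of potential at most [c]. Arcs inside this set cancel, and
    none enters it because [pi] increases along arcs. *)
Lemma cut_flow (c : rat) :
  \sum_(e | (pi (tail G e) <= c) && (c < pi (head G e))) f e =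
  d * ((pi s <= c)%R%:R - (pi t <= c)%R%:R).
Proof.
have part (h : E -> V) : \sum_(v | pi v <= c) \sum_(e | h e == v) f e =
    \sum_(e | pi (h e) <= c) f e.
  rewrite [RHS](partition_big h (fun v => pi v <= c)) //=.
  apply: eq_bigr => v vc; apply: eq_bigl => e.
  by case: eqP => [->|]; rewrite ?vc ?andbF.
rewrite -!(sum_indicator (fun v => pi v <= c)) -sumrB mulr_sumr.
under [RHS]eq_bigr => v _ do rewrite -f_div.
rewrite sumrB !part [X in _ = X - _](bigID (fun e => pi (head G e) <= c)) /=.
set a := \sum_(e | _) _; set b := \sum_(e | _) _; set b' := \sum_(e | _) f e; set a' := \sum_(e | _) f e.
have -> : b = a' .
  apply: eq_bigl => e; case: (leP (pi (head G e)) c) => h; rewrite ?andbF // andbT.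
  by rewrite (ltW (lt_le_trans (pi_lt e) h)).
have -> : a = b' by apply: eq_bigl => e; rewrite ltNge.
by rewrite addrAC subrr add0r.
Qed.

Lemma cut_flow_ge e c : pi (tail G e) <= c -> c < pi (head G e) ->
  f e <= d * ((pi s <= c)%R%:R - (pi t <= c)%R%:R).
Proof.
move=> h1 h2; rewrite -cut_flow (bigD1 e) ?h1 //= lerDl.
by apply: sumr_ge0.
Qed.

(** The net supply of a level set is at most zero if it misses [s] or contains [t], while an arc
    with positive flow leaving the set makes it positive. *)
Lemma flow_support e : 0 < f e -> pi s <= pi (tail G e) /\ pi (head G e) <= pi t.
Proof.
move=> fe; split; rewrite leNgt; apply/negP => lt.
  have := cut_flow_ge (lexx _) (pi_lt e); rewrite (leNgt (pi s)) lt /=.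
  case: (pi t <= _)%R => /=; have := d_ge0; lra.
(* The level has to be crossed by [e] and to contain [t], hence the maximum. *)
have h : Num.max (pi (tail G e)) (pi t) < pi (head G e) by rewrite gt_max lt pi_lt.
have := cut_flow_ge _ h; rewrite !le_max !lexx !orbT /= => /(_ isT).
by case: (_ || _) => /=; have := d_ge0; lra.
Qed.

(** Every arc leaving [v] crosses the level [pi v], and the flow across a level is at most [d]. *)
Lemma flow_cap v : \sum_(e | tail G e == v) f e <= d.
Proof.
have := cut_flow (pi v).
rewrite (bigID (fun e => tail G e == v)) /=.
set a := \sum_(e | _) _; set b := \sum_(e | _) _ => ab.
have -> : \sum_(e | tail G e == v) f e = a.
  by apply: eq_bigl => e; case: eqP => [<-|]; rewrite ?lexx ?pi_lt ?andbF.
have : 0 <= b by apply: sumr_ge0.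
by move: ab; case: (pi s <= _)%R; case: (pi t <= _)%R => /=; have := d_ge0; lra.
Qed.

Lemma flow_out0 v e : tail G e = v -> (pi v < pi s) || (pi t <= pi v) -> f e = 0.
Proof.
move=> <- h; apply/eqP; case: (ltgtP 0 (f e)) (f_ge0 e) => // fe _.
have [h1 h2] := flow_support fe; have h3 := pi_lt e; move: h.
by rewrite ltNge h1 leNgt (lt_le_trans h3 h2).
Qed.

Lemma flow_in0 v e : head G e = v -> (pi v <= pi s) || (pi t < pi v) -> f e = 0.
Proof.
move=> <- h; apply/eqP; case: (ltgtP 0 (f e)) (f_ge0 e) => // fe _.
have [h1 h2] := flow_support fe; have h3 := pi_lt e; move: h.
by rewrite leNgt (le_lt_trans h1 h3) ltNge h2.
Qed.
End Flow.

(** Follow an arc of [A] out of [s], delete it and continue at its head, by induction on [#|A|]. At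
    [s = t] nothing is left, since a flow without supply vanishes in an acyclic digraph; so the walk
    uses up all of [A]. *)
Lemma unit_flow_walk (A : {set E}) s t :
  (forall v, \sum_(e | tail G e == v) (e \in A)%:R -
     \sum_(e | head G e == v) (e \in A)%:R = (v == s)%:R - (v == t)%:R :> rat) ->
  exists2 p, walk G s p t & forall e, (e \in p) = (e \in A).
Proof.
have [n] := ubnP #|A|; elim: n => // n IH in A s *; rewrite ltnS => An div.
have div' v : \sum_(e | tail G e == v) (e \in A)%:R -
     \sum_(e | head G e == v) (e \in A)%:R = 1 * ((v == s)%:R - (v == t)%:R) :> rat.
  by rewrite mul1r.
have ge0 e : 0 <= (e \in A)%:R :> rat by [].
have [st|st] := eqVneq s t.
  exists [::]; first by rewrite /= st.
  move=> e; apply/esym/negbTE/negP => eA.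
  have [] := flow_support (e := e) ge0 ler01 div'; first by rewrite eA.
  by have := pi_lt e; rewrite st; lra.
have [e es eA] : exists2 e, tail G e = s & e \in A.
  have := div s; rewrite eqxx (negPf st) subr0.
  have h : 0 <= \sum_(e | head G e == s) (e \in A)%:R :> rat by apply: sumr_ge0.
  case: (pickP (fun e => (tail G e == s) && (e \in A))) => [e /andP[/eqP]|no]; first by exists e.
  rewrite big1 ?sub0r => [h'|e /eqP es]; last first.
    by have := no e; rewrite es eqxx /= => ->.
  by rewrite /= in h'; exfalso; lra.
have AE e' : (e' \in A :\ e)%:R = (e' \in A)%:R - (e' == e)%:R :> rat.
  by rewrite !inE; case: eqP => [->|]; rewrite ?eA ?subrr ?subr0.
have [|v|p wp pA] := IH (A :\ e) (head G e).
- by move: An; rewrite [X in (X <= _)%N](cardsD1 e) eA.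
- under eq_bigr do rewrite AE; under [X in _ - X]eq_bigr do rewrite AE.
  rewrite !sumrB !(sum_indicator _ (fun e' => _ e' == v)) es.
  rewrite ![_ == v]eq_sym; have := div v; lra.
exists (e :: p); first by rewrite /= es eqxx.
by move=> e'; rewrite inE pA !inE; case: eqP => //= ->; rewrite eA.
Qed.

Lemma walk_gt s p t : walk G s p t -> forall x, x \in [seq head G e | e <- p] -> pi s < pi x.
Proof.
elim: p s => //= e p IH s /andP[/eqP <- wp] x; rewrite inE => /orP[/eqP -> //|xp].
by apply: lt_trans (pi_lt e) (IH _ wp _ xp).
Qed.

Lemma walk_dipath s p t : walk G s p t -> dipath G s p t.
Proof.
move=> w; rewrite /dipath w /=; elim: p s w => //= e p IH s /andP[/eqP es wp].
rewrite -es in IH * => /=; rewrite IH // andbT; apply/negP => m.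
have := @walk_gt s (e :: p) t; rewrite /= es eqxx wp => /(_ isT s).
by rewrite -es m ltxx => /(_ isT).
Qed.

End AcyclicFlows.

(** * Decomposition trees *)

Section Decomposition.
Variables (V E : finType) (G : digraph V E).

Fixpoint tsrc (T : tree E) : V :=
  match T with Leaf e => tail G e | Ser a _ | Par a _ => tsrc a end.

Fixpoint tdst (T : tree E) : V :=
  match T with Leaf e => head G e | Ser _ b => tdst b | Par a _ => tdst a end.

Fixpoint inner (T : tree E) : seq V :=
  match T with
  | Leaf _ => [::]
  | Ser a b => inner a ++ tsrc b :: inner b
  | Par a b => inner a ++ inner b
  end.

(** The last clause for [Ser] confines every arc at the middle node to the part, so that
    conservation there can be evaluated inside it. *)
Fixpoint wf (T : tree E) : Prop :=
  match T with
  | Leaf _ => True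
  | Ser a b => [/\ wf a, wf b, tdst a = tsrc b &
      forall e, touches (tsrc b) (ends G e) -> e \in arcs a ++ arcs b]
  | Par a b => [/\ wf a, wf b, tsrc a = tsrc b & tdst a = tdst b]
  end.

Lemma wf_closed T x e :
  wf T -> x \in inner T -> touches x (ends G e) -> e \in arcs T.
Proof.
elim: T => //= a IHa b IHb [wa wb h1 h2]; rewrite !mem_cat.
  rewrite inE => /or3P[xa|/eqP ->|xb] t.
  - by rewrite IHa.
  - by have := h2 _ t; rewrite mem_cat.
  - by rewrite IHb ?orbT.
by move=> /orP[/(IHa wa) h|/(IHb wb) h] t; rewrite h ?orbT.
Qed.

Lemma tdst_arc T : wf T -> exists2 e, e \in arcs T & head G e = tdst T.
Proof.
elim: T => [e|a IHa b IHb|a IHa b IHb] /=; first by exists e; rewrite ?mem_head.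
  by case=> _ /IHb[e eb <-] _ _; exists e; rewrite ?mem_cat ?eb ?orbT.
by case=> /IHa[e ea <-] _ _ _; exists e; rewrite ?mem_cat ?ea.
Qed.

Lemma arc_ends T e x : wf T -> e \in arcs T -> touches x (ends G e) ->
  [|| x == tsrc T, x == tdst T | x \in inner T].
Proof.
elim: T => [f|a IHa b IHb|a IHa b IHb] /=.
- by move=> _; rewrite inE => /eqP -> /orP[]/eqP <-; rewrite eqxx ?orbT.
- case=> wa wb ab _; rewrite !mem_cat inE => /orP[/IHa h|/IHb h] t.
    by have /or3P[->|/eqP ->|->] := h wa t; rewrite ?ab ?eqxx ?orbT.
  by have /or3P[/eqP->|->|->] := h wb t; rewrite ?eqxx ?orbT.
- case=> wa wb e1 e2; rewrite !mem_cat => /orP[/IHa h|/IHb h] t.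
    by have /or3P[->|->|->] := h wa t; rewrite ?orbT.
  by have /or3P[/eqP ->|/eqP ->|->] := h wb t; rewrite ?e1 ?e2 ?eqxx ?orbT.
Qed.

Variable pi : V -> rat.
Hypothesis pi_lt : forall e, pi (tail G e) < pi (head G e).

Lemma tsrc_lt_tdst T : wf T -> pi (tsrc T) < pi (tdst T).
Proof.
elim: T => //= a IHa b IHb [/IHa wa /IHb wb ab _] //.
by apply: lt_trans wa _; rewrite ab.
Qed.

Lemma arcs_between T e : wf T -> e \in arcs T ->
  pi (tsrc T) <= pi (tail G e) /\ pi (head G e) <= pi (tdst T).
Proof.
elim: T => [f|a IHa b IHb|a IHa b IHb] /=.
- by move=> _; rewrite inE => /eqP ->.
- case=> wa wb ab _; have := tsrc_lt_tdst wa; have := tsrc_lt_tdst wb; rewrite ab.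
  by move=> l1 l2; rewrite mem_cat => /orP[/(IHa wa)|/(IHb wb)] []; rewrite ?ab => h1 h2;
    split=> //; lra.
- by case=> wa wb e1 e2; rewrite mem_cat => /orP[/(IHa wa)|/(IHb wb)]; rewrite ?e1 ?e2.
Qed.

Lemma inner_between T x : wf T -> x \in inner T -> pi (tsrc T) < pi x < pi (tdst T).
Proof.
elim: T => //= a IHa b IHb.
  case=> wa wb ab _; have := tsrc_lt_tdst wa; have := tsrc_lt_tdst wb; rewrite ab.
  move=> l1 l2; rewrite mem_cat inE => /or3P[/(IHa wa)|/eqP ->|/(IHb wb)] //.
  - by rewrite ab => /andP[h1 h2]; rewrite h1; lra.
  - by rewrite l1 l2.
  - by move=> /andP[h1 h2]; rewrite h2 andbT; lra.
by case=> wa wb e1 e2; rewrite mem_cat => /orP[/(IHa wa)|/(IHb wb)]; rewrite ?e1 ?e2.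
Qed.

Section Flows.
Variables (R : realFieldType) (k : nat) (C : commodities V R k) (X : E -> 'I_k -> R).
Hypothesis inst : multiflow_instance G C.
Hypothesis flowX : multiflow G C X.

Notation s := (source C).
Notation t := (sink C).
Notation d := (demand C).

Definition excess i v : R := d i * ((v == s i)%:R - (v == t i)%:R).

Lemma d_gt0 i : 0 < d i. Proof. by case: inst => _ /(_ i)[]. Qed.
Lemma d_ge0 i : 0 <= d i. Proof. exact: ltW (d_gt0 i). Qed.
Lemma X_ge0 e i : 0 <= X e i. Proof. by case: flowX. Qed.

Lemma excessE i v : excess i v = if v == s i then d i else if v == t i then - d i else 0.
Proof.
have [_ /(_ i)[_ st _]] := inst; rewrite /excess.
case: eqP => [->|_]; first by rewrite (negPf st) /= subr0 mulr1.
by case: eqP => _ /=; rewrite sub0r ?mulrN1 ?oppr0 ?mulr0.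
Qed.

Lemma X_div i v : \sum_(e | tail G e == v) X e i - \sum_(e | head G e == v) X e i =
  d i * ((v == s i)%:R - (v == t i)%:R).
Proof. by rewrite -[RHS]/(excess i v) excessE; case: flowX. Qed.

Let out0 i v e := @flow_out0 V E G pi pi_lt R (X^~ i) (s i) (t i) (d i)
  (X_ge0^~ i) (d_ge0 i) (X_div i) v e.
Let in0 i v e := @flow_in0 V E G pi pi_lt R (X^~ i) (s i) (t i) (d i)
  (X_ge0^~ i) (d_ge0 i) (X_div i) v e.

Definition outflow (r : seq E) v i := \sum_(e <- r | tail G e == v) X e i.
Definition inflow (r : seq E) v i := \sum_(e <- r | head G e == v) X e i.

Lemma sum_restrict (r : seq E) (P : pred E) (F : E -> R) :
  uniq r -> (forall e, P e -> e \in r) -> \sum_(e | P e) F e = \sum_(e <- r | P e) F e.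
Proof.
move=> ur h; rewrite -big_filter -[RHS]big_filter; apply: perm_big.
apply: uniq_perm; rewrite ?filter_uniq ?index_enum_uniq //.
by move=> e; rewrite !mem_filter mem_index_enum andbT; case: (boolP (P e)) => //= /h ->.
Qed.

(** Conservation at the middle node: by [wf] all arcs there lie in the part, and by the potential
    those of [a] only enter it and those of [b] only leave it. *)
Lemma ser_balance a b i : wf (Ser a b) -> uniq (arcs (Ser a b)) ->
  outflow (arcs b) (tsrc b) i = inflow (arcs a) (tsrc b) i + excess i (tsrc b).
Proof.
move=> [wa wb ab cl] u; rewrite /excess -X_div.
have uab : uniq (arcs a ++ arcs b) by [].
rewrite (sum_restrict _ uab); last by move=> e h; apply: cl; rewrite /touches h.
rewrite [X in _ - X](sum_restrict _ uab); last by move=> e h; apply: cl; rewrite /touches h orbT.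
rewrite !big_cat /= [X in _ = _ + (X + _ - _)]big1_seq; last first.
  move=> e /andP[/eqP h ea]; have [_] := arcs_between wa ea.
  by rewrite ab -h leNgt pi_lt.
rewrite [X in _ = _ + (_ - (_ + X))]big1_seq ?addr0 ?add0r; first by rewrite addrC subrK.
move=> e /andP[/eqP h eb]; have [+ _] := arcs_between wb eb.
by rewrite -h leNgt pi_lt.
Qed.

Lemma ser_outflow a b i : wf (Ser a b) ->
  outflow (arcs (Ser a b)) (tsrc a) i = outflow (arcs a) (tsrc a) i.
Proof.
move=> [wa wb ab _]; rewrite /outflow /= big_cat /= [X in _ + X]big1_seq ?addr0 // => e.
case/andP => /eqP h eb; have [+ _] := arcs_between wb eb.
by rewrite -ab h leNgt tsrc_lt_tdst.
Qed.

Lemma ser_inflow a b i : wf (Ser a b) ->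
  inflow (arcs (Ser a b)) (tdst b) i = inflow (arcs b) (tdst b) i.
Proof.
move=> [wa wb ab _]; rewrite /inflow /= big_cat /= [X in X + _]big1_seq ?add0r // => e.
case/andP => /eqP h ea; have [_] := arcs_between wa ea.
by rewrite ab h leNgt tsrc_lt_tdst.
Qed.

(** [ser_balance] passes from one child to the next and adds the supply of the middle node. Nodes of
    [inner] count with multiplicity, which [multiple_eq] resolves later. *)
Lemma tree_balance T i : wf T -> uniq (arcs T) ->
  inflow (arcs T) (tdst T) i = outflow (arcs T) (tsrc T) i + \sum_(v <- inner T) excess i v.
Proof.
elim: T => [e|a IHa b IHb|a IHa b IHb] w u.
- by rewrite /inflow /outflow /= !big_cons !big_nil !eqxx /= !addr0.
- have [wa wb ab _] := w.
  have := u; rewrite /= cat_uniq => /and3P[ua _ ub].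
  rewrite ser_inflow // ser_outflow // IHb // (ser_balance i w u) /= big_cat big_cons.
  by rewrite -ab IHa //= ab !addrA.
- have [wa wb e1 e2] := w.
  have := u; rewrite /= cat_uniq => /and3P[ua _ ub].
  rewrite /inflow /outflow big_cat [in RHS]big_cat big_cat /=.
  have := IHa wa ua; have := IHb wb ub; rewrite /inflow /outflow -e1 -e2 => -> ->.
  by rewrite addrACA.
Qed.

Definition blocked T i := (s i \in inner T) || (t i \in inner T).

Lemma inner_excess T i : \sum_(v <- inner T) excess i v =
  d i * ((count_mem (s i) (inner T))%:R - (count_mem (t i) (inner T))%:R).
Proof.
rewrite -mulr_sumr sumrB; congr (_ * (_ - _)).
  by elim: (inner T) => [|x r IH]; rewrite ?big_nil // big_cons IH /= natrD.
by elim: (inner T) => [|x r IH]; rewrite ?big_nil // big_cons IH /= natrD.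
Qed.

(* The amount of commodity [i] crossing the whole part: it is the same in both parts of a series
   node unless [i] starts or ends inside, in which case it vanishes in one of them. *)
Fixpoint thru (T : tree E) (i : 'I_k) : R :=
  match T with
  | Leaf e => X e i
  | Ser a b => if thru a i <= thru b i then thru a i else thru b i
  | Par a b => thru a i + thru b i
  end.

Lemma thru_ge0 T i : 0 <= thru T i.
Proof.
elim: T => [e|a IHa b IHb|a IHa b IHb] /=; first exact: X_ge0.
  by case: ifP.
exact: addr_ge0.
Qed.

Lemma blocked_ser a b i :
  blocked (Ser a b) i = [|| blocked a i, blocked b i, tsrc b == s i | tsrc b == t i].
Proof.
rewrite /blocked /= !mem_cat !inE ![s i == _]eq_sym ![t i == _]eq_sym.
by do !case: (_ \in _) => //=; do !case: (_ == _).
Qed.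

Lemma blocked_par a b i : blocked (Par a b) i = blocked a i || blocked b i.
Proof. by rewrite /blocked /= !mem_cat orbACA. Qed.

Lemma balance_unblocked T i : wf T -> uniq (arcs T) -> ~~ blocked T i ->
  inflow (arcs T) (tdst T) i = outflow (arcs T) (tsrc T) i.
Proof.
move=> w u /norP[ns nt]; rewrite tree_balance // inner_excess.
by rewrite (count_memPn ns) (count_memPn nt) subrr mulr0 addr0.
Qed.

(** Justifies the minimum in [thru]: without an endpoint inside, the crossings of both children
    agree, and the value is the actual flow of [i] through the part. *)
Lemma thru_unblocked T i : wf T -> uniq (arcs T) -> ~~ blocked T i ->
  thru T i = outflow (arcs T) (tsrc T) i.
Proof.
elim: T => [e|a IHa b IHb|a IHa b IHb] w u.
- by rewrite /outflow /= big_cons big_nil eqxx addr0.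
- have [wa wb ab _] := w; rewrite blocked_ser => /norP[na /norP[nb /norP[ns nt]]].
  have := u; rewrite /= cat_uniq => /and3P[ua _ ub].
  have e : thru b i = thru a i.
    rewrite IHb // (ser_balance i w u) /excess (negPf ns) (negPf nt) subrr mulr0 addr0.
    by rewrite -ab balance_unblocked ?IHa.
  by rewrite e lexx IHa // (ser_outflow i w).
- have [wa wb e1 e2] := w; rewrite blocked_par => /norP[na nb].
  have := u; rewrite /= cat_uniq => /and3P[ua _ ub].
  by rewrite IHa // IHb // /outflow big_cat /= e1.
Qed.

Lemma thru_inflow T i : wf T -> uniq (arcs T) -> ~~ blocked T i ->
  thru T i = inflow (arcs T) (tdst T) i.
Proof. by move=> w u n; rewrite balance_unblocked ?thru_unblocked. Qed.

Lemma outflow0 r v i : (pi v < pi (s i)) || (pi (t i) <= pi v) -> outflow r v i = 0.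
Proof. by move=> h; rewrite /outflow big1 // => e /eqP ev; apply: out0 ev h. Qed.

Lemma inflow0 r v i : (pi v <= pi (s i)) || (pi (t i) < pi v) -> inflow r v i = 0.
Proof. by move=> h; rewrite /inflow big1 // => e /eqP ev; apply: in0 ev h. Qed.

(* A commodity starting or ending strictly inside a part never crosses the whole part,
   as no path leaves the part and comes back. *)
Lemma thru_blocked T i : wf T -> uniq (arcs T) -> blocked T i -> thru T i = 0.
Proof.
elim: T => [e|a IHa b IHb|a IHa b IHb] w u //.
- have [wa wb ab _] := w; rewrite blocked_ser => bl.
  have := u; rewrite /= cat_uniq => /and3P[ua _ ub].
  have ha : thru a i = 0 -> (if thru a i <= thru b i then thru a i else thru b i) = 0.
    by move=> ->; rewrite thru_ge0.
  have hb : thru b i = 0 -> (if thru a i <= thru b i then thru a i else thru b i) = 0.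
    move=> ->; case: (leP (thru a i) 0) => // h.
    by apply/eqP; rewrite eq_le h thru_ge0.
  case: (boolP (blocked a i)) bl => [/(IHa wa ua)/ha //|na].
  case: (boolP (blocked b i)) => [/(IHb wb ub)/hb //|nb] /= /orP[]/eqP e.
    by apply: ha; rewrite thru_inflow // ab inflow0 // e lexx.
  by apply: hb; rewrite thru_unblocked // outflow0 // e lexx orbT.
- have [wa wb e1 e2] := w; rewrite blocked_par => bl.
  have := u; rewrite /= cat_uniq => /and3P[ua _ ub].
  (* Parallel parts share their terminals. An endpoint of [i] strictly between them in [c] puts the
     start node before [s i] or the end node after [t i], and there [i] has no flow. *)
  have aux c c' : wf c -> wf c' -> uniq (arcs c') -> tsrc c = tsrc c' -> tdst c = tdst c' ->
      ~~ blocked c' i -> blocked c i -> thru c' i = 0.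
    move=> wc wc' u' ec1 ec2 n /orP[] /(inner_between wc)/andP[].
      by rewrite ec1 => lt _; rewrite thru_unblocked // outflow0 // lt.
    by rewrite ec2 => _ lt; rewrite thru_inflow // inflow0 // lt orbT.
  case: (boolP (blocked a i)) bl => [ba|na] /= bl.
    rewrite (IHa wa ua ba) add0r.
    case: (boolP (blocked b i)) => [/(IHb wb ub) //|nb].
    exact: aux wa wb ub e1 e2 nb ba.
  by rewrite (IHb wb ub bl) addr0; apply: (aux b a).
Qed.

Lemma thru_ser_eq a b i : wf (Ser a b) -> uniq (arcs (Ser a b)) -> ~~ blocked (Ser a b) i ->
  thru a i = thru b i.
Proof.
move=> w u; have [wa wb ab _] := w; rewrite blocked_ser => /norP[na /norP[nb /norP[ns nt]]].
have := u; rewrite /= cat_uniq => /and3P[ua _ ub].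
rewrite [RHS]thru_unblocked // (ser_balance i w u) /excess (negPf ns) (negPf nt) subrr mulr0 addr0.
by rewrite -ab thru_inflow.
Qed.

Lemma outflow_cap r v i : uniq r -> outflow r v i <= d i.
Proof.
move=> ur; apply: le_trans (flow_cap pi_lt (X_ge0^~ i) (d_ge0 i) (X_div i) v).
rewrite /outflow -big_filter big_uniq ?filter_uniq //=.
rewrite [X in _ <= X](bigID (mem r)) /=.
have -> : \sum_(e in [seq e <- r | tail G e == v]) X e i =
          \sum_(e | (tail G e == v) && (e \in r)) X e i.
  by apply: eq_bigl => e; rewrite mem_filter.
by rewrite lerDl; apply: sumr_ge0 => e _; apply: X_ge0.
Qed.

(** [tree_balance] yields a crossing as a multiple of [d i], the factor being a multiplicity in
    [inner]. A positive crossing of at most [d i] leaves only the factor one. *)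
Lemma multiple_eq i (n : nat) (x : R) : 0 < x -> x <= d i -> x = d i * n%:R -> x = d i.
Proof.
move=> x0 xd e; have d0 := d_gt0 i.
have n1 : n = 1%N.
  have h1 : (0 < n%:R :> R) by rewrite -(pmulr_rgt0 _ d0) -e.
  have h2 : (n%:R <= 1 :> R) by rewrite -(ler_pM2l d0) -e mulr1.
  by move: h1 h2; rewrite ltr0n lern1; lia.
by rewrite e n1 mulr1.
Qed.

(** Flow of [i] crossing [a] reaches the middle node, so in potential [s i] lies before that node
    and [t i] does not. As [i] is blocked, its sink is the middle node or lies inside [b]; nothing
    gets past the sink, so what crosses [a] is all that arrives there. *)
Lemma thru_local_first a b i : wf (Ser a b) -> uniq (arcs (Ser a b)) ->
  blocked (Ser a b) i -> 0 < thru a i -> thru a i = d i.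
Proof.
move=> w u bl pos; have [wa wb ab _] := w.
have := u; rewrite /= cat_uniq => /and3P[ua _ ub].
have na : ~~ blocked a i by apply/negP => /(thru_blocked wa ua) e; rewrite e ltxx in pos.
have bal := ser_balance i w u.
have eI : thru a i = inflow (arcs a) (tsrc b) i by rewrite thru_inflow // ab.
have /norP[ns nt] : ~~ ((pi (tsrc b) <= pi (s i)) || (pi (t i) < pi (tsrc b))).
  by apply/negP => /inflow0 h; rewrite eI h ltxx in pos.
rewrite -ltNge in ns; rewrite -leNgt in nt.
have nws : tsrc b != s i by apply: contraL ns => /eqP ->; rewrite ltxx.
rewrite /excess (negPf nws) /= sub0r in bal.
case: (eqVneq (tsrc b) (t i)) bal => [wt|nwt] bal.
  rewrite outflow0 in bal; last by rewrite wt lexx orbT.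
  by rewrite eI; move: bal => /=; lra.
move: bl; rewrite blocked_ser (negPf na) (negPf nws) (negPf nwt) !orbF /= => bb.
have nsb : s i \notin inner b.
  by apply/negP => /(inner_between wb)/andP[h _]; move: (lt_trans h ns); rewrite ltxx.
have tb : t i \in inner b by move: bb; rewrite /blocked (negPf nsb).
have /andP[_ lt] := inner_between wb tb.
have balb := tree_balance i wb ub.
rewrite inflow0 ?lt ?orbT // inner_excess (count_memPn nsb) in balb.
have eO : thru a i = outflow (arcs b) (tsrc b) i by rewrite eI; move: bal => /=; lra.
apply: (@multiple_eq i (count_mem (t i) (inner b))) => //; first by rewrite eO outflow_cap.
by rewrite eO; move: balb; rewrite /= sub0r mulrN; lra.
Qed.

Lemma thru_local_second a b i : wf (Ser a b) -> uniq (arcs (Ser a b)) ->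
  blocked (Ser a b) i -> 0 < thru b i -> thru b i = d i.
Proof.
move=> w u bl pos; have [wa wb ab _] := w.
have := u; rewrite /= cat_uniq => /and3P[ua _ ub].
have nb : ~~ blocked b i by apply/negP => /(thru_blocked wb ub) e; rewrite e ltxx in pos.
have bal := ser_balance i w u.
have eO : thru b i = outflow (arcs b) (tsrc b) i by rewrite thru_unblocked.
have /norP[ns nt] : ~~ ((pi (tsrc b) < pi (s i)) || (pi (t i) <= pi (tsrc b))).
  by apply/negP => /outflow0 h; rewrite eO h ltxx in pos.
rewrite -leNgt in ns; rewrite -ltNge in nt.
have nwt : tsrc b != t i by apply: contraL nt => /eqP ->; rewrite ltxx.
rewrite /excess (negPf nwt) /= subr0 in bal.
case: (eqVneq (tsrc b) (s i)) bal => [wt|nws] bal.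
  rewrite inflow0 in bal; last by rewrite wt lexx.
  by rewrite eO; move: bal => /=; lra.
move: bl; rewrite blocked_ser (negPf nb) (negPf nws) (negPf nwt) !orbF /= => ba.
have nta : t i \notin inner a.
  apply/negP => /(inner_between wa)/andP[_ h]; rewrite ab in h.
  by move: (lt_trans h nt); rewrite ltxx.
have sa : s i \in inner a by move: ba; rewrite /blocked (negPf nta) orbF.
have /andP[lt _] := inner_between wa sa.
have bala := tree_balance i wa ua.
rewrite ab outflow0 ?lt // inner_excess (count_memPn nta) subr0 add0r in bala.
have eI : thru b i = inflow (arcs a) (tsrc b) i by rewrite eO; move: bal => /=; lra.
apply: (@multiple_eq i (count_mem (s i) (inner a))) => //; first by rewrite eO outflow_cap.
by rewrite eI.
Qed.

End Flows.
End Decomposition.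

(** * Routing lists of commodities through a tree *)

Section Pieces.
Variable R : realFieldType.
Implicit Types (ps acc : seq (R * R)) (p : R * R) (b c x : R).

Definition refine_step b acc p :=
  if (p.1 < b) && (b < p.2) then [:: (p.1, b), (b, p.2) & acc] else p :: acc.

Definition refine_at b ps := foldl (refine_step b) [::] ps.

Lemma mem_refine b ps p : p \in refine_at b ps ->
  exists2 p0, p0 \in ps & (p = p0 /\ ~~ ((p0.1 < b) && (b < p0.2))) \/
    ((p0.1 < b) && (b < p0.2) /\ (p = (p0.1, b) \/ p = (b, p0.2))).
Proof.
suff aux acc : p \in foldl (refine_step b) acc ps -> p \in acc \/
    exists2 p0, p0 \in ps & (p = p0 /\ ~~ ((p0.1 < b) && (b < p0.2))) \/
    ((p0.1 < b) && (b < p0.2) /\ (p = (p0.1, b) \/ p = (b, p0.2))).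
  by case/aux.
elim: ps acc => /= [|q ps IH] acc; first by left.
case/IH => [|[p0 p0s h]]; last by right; exists p0; rewrite // inE p0s orbT.
rewrite /refine_step; case: ifP => hq; rewrite !inE.
  case/or3P => [/eqP e|/eqP e|h]; last by left.
    by right; exists q; rewrite ?mem_head //; right; split=> //; left.
  by right; exists q; rewrite ?mem_head //; right; split=> //; right.
case/orP => [/eqP e|h]; last by left.
by right; exists q; rewrite ?mem_head //; left; rewrite hq.
Qed.

(** Splitting an interval telescopes. The function [g] is left general because the sum is later
    taken over the truncations [Num.min x c]. *)
Lemma sum_refine (g : R -> R) b ps :
  \sum_(p <- refine_at b ps) (g p.2 - g p.1) = \sum_(p <- ps) (g p.2 - g p.1).
Proof.
suff aux acc : \sum_(p <- foldl (refine_step b) acc ps) (g p.2 - g p.1) =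
    \sum_(p <- acc) (g p.2 - g p.1) + \sum_(p <- ps) (g p.2 - g p.1).
  by rewrite /refine_at aux big_nil add0r.
elim: ps acc => /= [|q ps IH] acc; first by rewrite big_nil addr0.
rewrite IH big_cons /refine_step; case: ifP => _; rewrite !big_cons /=; ring.
Qed.

(** The list is not sorted, so tiling is expressed by measure: [Num.min p.2 c - Num.min p.1 c] is
    the length of the part of [p] below [c], and these lengths must add up to [c]. *)
Definition subdivides (bs : seq R) ps :=
  [/\ forall p, p \in ps -> [/\ 0 <= p.1, p.1 < p.2 & p.2 <= 1],
      forall c, 0 <= c -> c <= 1 -> \sum_(p <- ps) (Num.min p.2 c - Num.min p.1 c) = c
    & forall b p, b \in bs -> p \in ps -> (b <= p.1) || (p.2 <= b)].

Lemma subdivides_unit : subdivides [::] [:: (0, 1)].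
Proof.
split=> // [p|c c0 c1]; first by rewrite inE => /eqP -> /=.
by rewrite big_cons big_nil /= (min_r c1) (min_l c0) subr0 addr0.
Qed.

Lemma subdivides_refine b bs ps : subdivides bs ps -> subdivides (b :: bs) (refine_at b ps).
Proof.
case=> h1 h2 h3; split.
- move=> p /mem_refine[p0 /h1[a1 a2 a3]] [[-> _] //|[/andP[l1 l2]] [] ->] /=; split=> //.
  + by apply: le_trans (ltW l2) a3.
  + by apply: le_trans a1 (ltW l1).
- by move=> c c0 c1; rewrite (sum_refine (fun x => Num.min x c)) h2.
- move=> b' p; rewrite inE => /orP[/eqP ->|b's] /mem_refine[p0 p0s].
    case=> [[-> ]|[_ [] -> /=]]; rewrite ?lexx ?orbT //.
    by rewrite negb_and -!leNgt.
  have := h3 _ _ b's p0s; case=> h.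
  case=> [[-> _] //|[/andP[l1 l2] [] -> /=]].
    by case/orP: h => h; rewrite ?h // (le_trans (ltW l2) h) orbT.
  by case/orP: h => h; rewrite ?h ?orbT // (le_trans h (ltW l1)).
Qed.

(** A piece lies on one side of the breakpoint [b], so its length truncated at [b] is its full
    length or zero. *)
Lemma subdivides_measure bs ps b : subdivides bs ps -> b \in bs -> 0 <= b -> b <= 1 ->
  \sum_(p <- ps) (p.2 - p.1) * (p.1 < b)%R%:R = b.
Proof.
case=> h1 h2 h3 bb b0 b1; rewrite -[RHS](h2 b) // !big_seq; apply: eq_bigr => p pp.
have [_ lt _] := h1 p pp; have /orP[h|h] := h3 _ _ bb pp.
  by rewrite ltNge h /= mulr0 (min_r h) (min_r (le_trans h (ltW lt))) subrr.
by rewrite (lt_le_trans lt h) mulr1 (min_l h) (min_l (le_trans (ltW lt) h)).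
Qed.

Lemma subdivides_total bs ps : subdivides bs ps -> \sum_(p <- ps) (p.2 - p.1) = 1.
Proof.
case=> h1 h2 _; rewrite -[RHS](h2 1) // !big_seq; apply: eq_bigr => p /h1[_ lt le].
by rewrite (min_l le) (min_l (ltW (lt_le_trans lt le))).
Qed.

End Pieces.

(** * The routing of intervals and its invariants *)

Section Routing.
Variables (V E : finType) (G : digraph V E) (pi : V -> rat).
Hypothesis pi_lt : forall e, pi (tail G e) < pi (head G e).
Variables (R : realFieldType) (k : nat) (C : commodities V R k) (X : E -> 'I_k -> R).
Hypothesis inst : multiflow_instance G C.
Hypothesis flowX : multiflow G C X.

Notation s := (source C).
Notation t := (sink C).
Notation d := (demand C).
Notation thru := (thru X).
Notation wf := (wf G).
Notation blocked := (blocked G C).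

(* [(i, (lo, hi))] records that the share of commodity [i] using a part is [hi - lo], realised
   by the thresholds [theta] with [lo <= theta * d i < hi]. *)
Notation item := ('I_k * (R * R))%type.

Implicit Types (T a b : tree E) (l : seq item) (x it : item) (i : 'I_k).

Definition full_item i : item := (i, (0, d i)).

(* The commodities that cross [a] but not [b] do so with their full demand. *)
Definition locals a b : seq item :=
  [seq full_item i | i <- enum 'I_k & (thru b i <= 0) && ~~ (thru a i <= 0)].

(** Placed behind the first item, the full items of [L] keep the fractional ones at the ends. Their
    order is irrelevant, so one pass of [catrev] suffices. *)
Definition insert l L : seq item := if l is x :: l' then x :: catrev L l' else L.

(** The state holds the amount still to be dealt out and the two halves built so far, in reverse
    order. The split item leaves its lower interval on the left and its upper interval on the right,
    so a threshold covering it covers exactly one of the two. *)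
Definition cut_step (st : R * (seq item * seq item)) it :=
  if st.1 <= 0 then (st.1, (st.2.1, it :: st.2.2))
  else if it.2.2 - it.2.1 <= st.1 then (st.1 - (it.2.2 - it.2.1), (it :: st.2.1, st.2.2))
  else (0, ((it.1, (it.2.1, it.2.1 + st.1)) :: st.2.1,
            (it.1, (it.2.1 + st.1, it.2.2)) :: st.2.2)).

Definition cut (z : R) l := (foldl cut_step (z, ([::], [::])) l).2.

Definition flow_through T : R := \sum_(i < k) thru T i.

Fixpoint routes T l : seq (E * seq item) :=
  match T with
  | Leaf e => [:: (e, l)]
  | Ser a b => routes a (insert l (locals a b)) ++ routes b (insert l (locals b a))
  | Par a b => routes a (cut (flow_through a) l).1 ++ routes b (cut (flow_through a) l).2
  end.

Definition amount l := \sum_(it <- l) (it.2.2 - it.2.1).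

Definition item_ok it := [/\ 0 <= it.2.1, it.2.1 < it.2.2 & it.2.2 <= d it.1].

(* Only the first and the last item may be fractional. *)
Definition trim l := forall x0 j, (0 < j)%N -> (j.+1 < size l)%N ->
  nth x0 l j = full_item (nth x0 l j).1.

(** The clause on [blocked] makes the commodities of the list cross both children of a series node
    alike, so the list can be handed on unchanged. At a leaf the last clause says that the shares
    add up to the total flow of the arc. *)
Definition good T l := [/\ uniq (unzip1 l), forall it, it \in l -> item_ok it, trim l,
  forall it, it \in l -> ~~ blocked T it.1 & amount l = flow_through T].

Let dpos i : 0 < d i := d_gt0 inst i.

Lemma map_fst_routes T l : unzip1 (routes T l) = arcs T.
Proof. by elim: T l => //= a IHa b IHb l; rewrite /unzip1 map_cat -!/(unzip1 _) IHa IHb. Qed.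

Lemma trim_rev l : trim l -> trim (rev l).
Proof.
move=> h x0 j j0; rewrite size_rev => js; rewrite nth_rev; last by lia.
by apply: h; lia.
Qed.

Lemma trim_prefix l1 l2 : trim (l1 ++ l2) -> trim l1.
Proof.
move=> h x0 j j0 js; have := h x0 j j0; rewrite nth_cat size_cat (ltnW js).
by apply; rewrite ltn_addr.
Qed.

Lemma trim_suffix l1 l2 : trim (l1 ++ l2) -> trim l2.
Proof.
move=> h x0 j j0 js; have := h x0 (size l1 + j)%N; rewrite nth_cat size_cat.
have -> : (size l1 + j < size l1)%N = false by lia.
by rewrite addKn; apply; lia.
Qed.

Lemma trim_last l x y : trim (rcons l x) -> trim (rcons l y).
Proof.
move=> h x0 j j0; rewrite size_rcons ltnS => js; have := h x0 j j0; rewrite size_rcons !nth_rcons js.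
by apply.
Qed.

Lemma trim_head l x y : trim (x :: l) -> trim (y :: l).
Proof. by move=> h x0 [//|j] j0 js; apply: (h x0 j.+1). Qed.

Lemma trim_full l : (forall x, x \in l -> x = full_item x.1) -> trim l.
Proof. by move=> h x0 j j0 js; apply: h; apply: mem_nth; apply: ltnW. Qed.

Lemma trim_insert l L : trim l -> (forall x, x \in L -> x = full_item x.1) ->
  trim (insert l L).
Proof.
case: l => [|y l] h hL /=; first exact: trim_full.
move=> x0 [//|j] _ /=; rewrite catrevE size_cat size_rev => js.
rewrite nth_cat size_rev; case: ltnP => jL; first by apply: hL; rewrite -mem_rev mem_nth ?size_rev.
have := h x0 (j - size L).+1; apply => //=; lia.
Qed.

Lemma cut_step0 l z (u v : seq item) : z <= 0 ->
  foldl cut_step (z, (u, v)) l = (z, (u, catrev l v)).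
Proof. by move=> z0; elim: l v => //= x l IH v; rewrite {2}/cut_step /= z0 IH. Qed.

Lemma cutP l z : (forall it, it \in l -> it.2.1 < it.2.2) -> 0 <= z -> z <= amount l ->
  (exists l1 l2, [/\ l = l1 ++ l2, amount l1 = z & cut z l = (rev l1, rev l2)]) \/
  (exists l1 i lo m hi l2, [/\ l = l1 ++ (i, (lo, hi)) :: l2, lo < m, m < hi,
     amount l1 + (m - lo) = z &
     cut z l = (rev (rcons l1 (i, (lo, m))), rev ((i, (m, hi)) :: l2))]).
Proof.
rewrite /cut => pos z0 zl.
suff aux u v : (exists l1 l2, [/\ l = l1 ++ l2, amount l1 = z &
      (foldl cut_step (z, (u, v)) l).2 = (catrev l1 u, catrev l2 v)]) \/
    (exists l1 i lo m hi l2, [/\ l = l1 ++ (i, (lo, hi)) :: l2, lo < m, m < hi,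
     amount l1 + (m - lo) = z & (foldl cut_step (z, (u, v)) l).2 =
       (catrev (rcons l1 (i, (lo, m))) u, catrev ((i, (m, hi)) :: l2) v)]).
  exact: aux.
elim: l z z0 zl pos u v => [|[i [lo hi]] l IH] z z0 zl pos u v.
  left; exists [::], [::]; split=> //; apply/eqP.
  by rewrite eq_le {1}/amount big_nil z0 zl.
have lt : lo < hi := pos _ (mem_head _ _).
have [zle|zgt] := leP z 0.
  left; exists [::], ((i, (lo, hi)) :: l); split=> //; last by rewrite cut_step0.
  by apply/eqP; rewrite /amount big_nil eq_le zle z0.
rewrite [foldl _ _ _]/= {2 4}/cut_step /= leNgt zgt /=.
case: (leP (hi - lo) z) => hz.
  have aE l1 : amount ((i, (lo, hi)) :: l1) = (hi - lo) + amount l1 by rewrite /amount big_cons.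
  have [| | |[l1 [l2 [e1 e2 ->]]]|[l1 [i' [lo' [m [hi' [l2 [e1 e2 e3 e4 ->]]]]]]]] :=
    IH (z - (hi - lo)) _ _ _ ((i, (lo, hi)) :: u) v.
  - by rewrite subr_ge0.
  - by rewrite lerBlDl -aE.
  - by move=> it itl; apply: pos; rewrite inE itl orbT.
  - left; exists ((i, (lo, hi)) :: l1), l2; split=> //; first by rewrite e1.
    by rewrite aE e2 addrC subrK.
  - right; exists ((i, (lo, hi)) :: l1), i', lo', m, hi', l2; split=> //; first by rewrite e1.
    by rewrite aE -addrA e4 addrC subrK.
right; exists [::], i, lo, (lo + z), hi, l; split=> //.
- by rewrite ltrDl.
- by rewrite addrC -ltrBrDr.
- by rewrite /amount big_nil add0r addrC addKr.
- by rewrite cut_step0 //= lexx.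
Qed.

Lemma amount_cat l1 l2 : amount (l1 ++ l2) = amount l1 + amount l2.
Proof. exact: big_cat. Qed.

Lemma amount_cons it l : amount (it :: l) = (it.2.2 - it.2.1) + amount l.
Proof. exact: big_cons. Qed.

Lemma amount_rev l : amount (rev l) = amount l.
Proof. by apply: perm_big; rewrite perm_rev. Qed.

Lemma flow_through_ge0 T : 0 <= flow_through T.
Proof. by apply: sumr_ge0 => i _; apply: thru_ge0 flowX _ _. Qed.

Lemma flow_through_par a b : flow_through (Par a b) = flow_through a + flow_through b.
Proof. exact: big_split. Qed.

(** The split item becomes an end of either half, and the former ends stay ends, so neither half has
    a fractional item strictly inside. *)
Lemma good_cut a b l : good (Par a b) l ->
  good a (cut (flow_through a) l).1 /\ good b (cut (flow_through a) l).2.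
Proof.
case=> ul ok tr nb tot.
have nba it : it \in l -> ~~ blocked a it.1 /\ ~~ blocked b it.1.
  by move=> /nb; rewrite blocked_par => /norP.
have [| | |[l1 [l2 [e1 e2 ->]]]|[l1 [i [lo [m [hi [l2 [e1 m1 m2 e2 ->]]]]]]]] := @cutP l (flow_through a).
- by move=> it /ok[].
- exact: flow_through_ge0.
- by rewrite tot flow_through_par lerDl flow_through_ge0.
- move: tot ul tr; rewrite e1 flow_through_par amount_cat e2 => /addrI tot2.
  rewrite /unzip1 map_cat cat_uniq => /and3P[u1 _ u2] tr.
  split; split=> /=; rewrite ?amount_rev ?e2 //.
  + by rewrite /unzip1 map_rev rev_uniq.
  + by move=> it; rewrite mem_rev => h; apply: ok; rewrite e1 mem_cat h.
  + by apply: trim_rev; apply: trim_prefix tr.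
  + by move=> it; rewrite mem_rev => h; apply: (nba it _).1; rewrite e1 mem_cat h.
  + by rewrite /unzip1 map_rev rev_uniq.
  + by move=> it; rewrite mem_rev => h; apply: ok; rewrite e1 mem_cat h orbT.
  + by apply: trim_rev; apply: trim_suffix tr.
  + by move=> it; rewrite mem_rev => h; apply: (nba it _).2; rewrite e1 mem_cat h orbT.
- have xl : (i, (lo, hi)) \in l by rewrite e1 mem_cat mem_head orbT.
  have [/= ok1 ok2 ok3] := ok _ xl.
  have sub1 it : it \in l1 -> it \in l by rewrite e1 mem_cat => ->.
  have sub2 it : it \in l2 -> it \in l by rewrite e1 mem_cat inE => ->; rewrite !orbT.
  move: tot ul; rewrite e1 flow_through_par amount_cat amount_cons /= => tot.
  rewrite /unzip1 map_cat /= => ul.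
  split; split=> /=; rewrite ?amount_rev.
  + rewrite /unzip1 map_rev rev_uniq map_rcons; move: ul.
    by rewrite -cat_rcons cat_uniq => /and3P[].
  + move=> it; rewrite mem_rev mem_rcons inE => /orP[/eqP ->|/sub1/ok //].
    by split=> //=; apply: le_trans (ltW m2) ok3.
  + apply: trim_rev; apply: (@trim_last _ (i, (lo, hi))).
    by apply: (@trim_prefix _ l2); rewrite cat_rcons -e1.
  + move=> it; rewrite mem_rev mem_rcons inE => /orP[/eqP ->|/sub1/nba[] //] /=.
    by have [] := nba _ xl.
  + by rewrite -cats1 amount_cat amount_cons /= {2}/amount big_nil addr0.
  + by rewrite /unzip1 map_rev rev_uniq; move: ul; rewrite cat_uniq => /and3P[].
  + move=> it; rewrite mem_rev inE => /orP[/eqP ->|/sub2/ok //].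
    by split=> //=; apply: le_trans ok1 (ltW m1).
  + apply: trim_rev; apply: (@trim_head _ (i, (lo, hi))).
    by apply: (@trim_suffix l1); rewrite -e1.
  + move=> it; rewrite mem_rev inE => /orP[/eqP ->|/sub2/nba[] //] /=.
    by have [] := nba _ xl.
  + rewrite amount_cons /=; move: tot; lra.
Qed.

Lemma mem_locals a b it : it \in locals a b ->
  [/\ it = full_item it.1, thru b it.1 <= 0 & 0 < thru a it.1].
Proof.
by case/mapP => i; rewrite mem_filter -ltNge => /andP[/andP[? ?] _] ->.
Qed.

Lemma uniq_locals a b : uniq (unzip1 (locals a b)).
Proof.
rewrite /unzip1 -map_comp map_inj_in_uniq; last by move=> i j _ _.
exact/filter_uniq/enum_uniq.
Qed.

Lemma perm_insert_items l L : perm_eq (insert l L) (L ++ l).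
Proof.
case: l => [|x l] /=; first by rewrite cats0.
by rewrite catrevE perm_insert // perm_cat2r perm_rev.
Qed.

(** The crossing of [c] is added up separately over the commodities blocked in the series node and
    the others. The others cross both children alike and are accounted for by [l]. For a blocked one
    the smaller of the two crossings is zero, so it crosses [c] only as a local item, with full
    demand. The pair [c], [c'] treats both children at once. *)
Lemma good_insert a b l :
  wf (Ser a b) -> uniq (arcs (Ser a b)) -> good (Ser a b) l ->
  forall c c', (c = a /\ c' = b \/ c = b /\ c' = a) -> good c (insert l (locals c c')).
Proof.
move=> w u [ul ok tr nb tot] c c' cc.
have [wa wb e cl] := w.
have := u; rewrite /= cat_uniq => /and3P[ua _ ub].
have [wc uc] : wf c /\ uniq (arcs c) by case: cc => [] [-> _].
have eqT i : ~~ blocked (Ser a b) i -> thru c i = thru c' i.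
  by move=> h; have := thru_ser_eq pi_lt inst flowX w u h; case: cc => [] [-> ->].
have localfull i : blocked (Ser a b) i -> 0 < thru c i -> thru c i = d i.
  move=> h1 h2; case: cc h2 => [] [-> _] h2.
    exact (thru_local_first pi_lt inst flowX w u h1 h2).
  exact (thru_local_second pi_lt inst flowX w u h1 h2).
have nbc i : blocked c i -> blocked (Ser a b) i.
  by rewrite blocked_ser; case: cc => [] [-> _] ->; rewrite ?orbT.
have locb it : it \in locals c c' -> blocked (Ser a b) it.1.
  case/mem_locals => _ h1 h2; apply/negP => /negP /eqT e'.
  by rewrite e' ltNge h1 in h2.
have thruT i : thru (Ser a b) i = if blocked (Ser a b) i then 0 else thru c i.
  case: ifP => h; first exact (thru_blocked pi_lt inst flowX w u h).
  have := thru_ser_eq pi_lt inst flowX w u (negbT h).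
  by rewrite /=; case: cc => [] [-> _] ->; rewrite lexx.
have pm := perm_insert_items l (locals c c').
split.
- rewrite (perm_uniq (perm_map _ pm)) map_cat cat_uniq uniq_locals ul andbT /=.
  apply/hasPn => i /mapP[it itl ->]; apply/negP => /mapP[it' /locb h e'].
  by have := nb _ itl; rewrite e' h.
- move=> it; rewrite (perm_mem pm) mem_cat => /orP[/mem_locals[-> _ _]|/ok //].
  by split=> //=.
- by apply: trim_insert => // x /mem_locals[].
- move=> it; rewrite (perm_mem pm) mem_cat => /orP[/mem_locals[_ _ h]|/nb h]; apply/negP.
    by move=> /(thru_blocked pi_lt inst flowX wc uc) e'; rewrite e' ltxx in h.
  by move/nbc; rewrite (negPf h).
- rewrite /amount (perm_big _ pm) big_cat /= -!/(amount _) tot.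
  have -> : flow_through (Ser a b) = \sum_(i | ~~ blocked (Ser a b) i) thru c i.
    by rewrite [RHS]big_mkcond; apply: eq_bigr => i _; rewrite thruT; case: ifP.
  rewrite [flow_through c](bigID (blocked (Ser a b))) /=; congr (_ + _).
  rewrite /amount big_map big_filter /= enumT.
  rewrite [RHS](bigID (fun i => (thru c' i <= 0) && ~~ (thru c i <= 0))) /=.
  rewrite [X in _ = _ + X]big1 ?addr0.
    rewrite [RHS]big_mkcond [LHS]big_mkcond /=; apply: eq_bigr => i _.
    case: (boolP (_ && _)) => h; rewrite ?andbF // andbT subr0.
    have hl : full_item i \in locals c c' by rewrite map_f // mem_filter h mem_enum.
    rewrite (locb _ hl) localfull //; first exact: locb hl.
    by have [_ _] := mem_locals hl.
  move=> i /andP[h1]; rewrite negb_and negbK => h2.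
  have c0 := thru_ge0 flowX c i; have c0' := thru_ge0 flowX c' i.
  apply/eqP; rewrite eq_le c0 andbT; case/orP: h2 => // h2.
  have := thru_blocked pi_lt inst flowX w u h1; rewrite /=.
  rewrite -ltNge in h2; case: cc c0 c0' h2 => [] [-> ->] c0 c0' h2.
    by case: leP => [_ ->|h3 h4]; rewrite ?lexx //; rewrite h4 ltxx in h2.
  by case: leP => [h3 h4|_ ->]; rewrite ?lexx //; rewrite h4 ltxx in h2.
Qed.

Lemma good_routes T l : wf T -> uniq (arcs T) -> good T l ->
  forall q, q \in routes T l -> good (Leaf q.1) q.2.
Proof.
elim: T l => [e|a IHa b IHb|a IHa b IHb] l w u g q /=.
- by rewrite inE => /eqP ->.
- have := u; rewrite /= cat_uniq => /and3P[ua _ ub]; have [wa wb _ _] := w.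
  rewrite mem_cat => /orP[/IHa|/IHb]; apply=> //.
    by apply: (good_insert w u g); left.
  by apply: (good_insert w u g); right.
- have := u; rewrite /= cat_uniq => /and3P[ua _ ub]; have [wa wb _ _] := w.
  by have [ga gb] := good_cut g; rewrite mem_cat => /orP[/IHa|/IHb]; apply.
Qed.

Definition covers (theta : R) it := (it.2.1 <= theta * d it.1) && (theta * d it.1 < it.2.2).

Definition selected theta l i := has (fun it => (it.1 == i) && covers theta it) l.

Lemma selected_perm theta l1 l2 i : perm_eq l1 l2 -> selected theta l1 i = selected theta l2 i.
Proof. by move/perm_mem/eq_has_r => h; rewrite /selected h. Qed.

Lemma selected_notin theta l i : i \notin unzip1 l -> selected theta l i = false.
Proof.
move=> h; apply/hasPn => it itl; apply: contra h => /andP[/eqP <- _].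
exact: map_f.
Qed.

(** Half-open intervals share no threshold at the cut point, and a commodity other than the split
    one occurs in at most one half because the list is duplicate free. *)
Lemma selected_cut theta a b l i (z := flow_through a) : good (Par a b) l ->
  (selected theta (cut z l).1 i)%:R + (selected theta (cut z l).2 i)%:R =
  (selected theta l i)%:R :> R.
Proof.
move=> g; have [ul ok tr nb tot] := g.
have selR l' : selected theta (rev l') i = selected theta l' i.
  by apply: selected_perm; rewrite perm_rev.
have selC l1 l2 : selected theta (l1 ++ l2) i = selected theta l1 i || selected theta l2 i.
  exact: has_cat.
have [| | |[l1 [l2 [e1 e2 ->]]]|[l1 [j [lo [m [hi [l2 [e1 m1 m2 e2 ->]]]]]]]] := @cutP l (flow_through a).
- by move=> it /ok[].
- exact: flow_through_ge0.
- by rewrite tot flow_through_par lerDl flow_through_ge0.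
- rewrite /= !selR e1 selC; move: ul; rewrite e1 /unzip1 map_cat cat_uniq => /and3P[_ /hasPn d12 _].
  case: (boolP (i \in unzip1 l2)) => i2; last by rewrite (selected_notin _ i2) orbF addr0.
  by rewrite (selected_notin _ (d12 _ i2)) add0r.
- rewrite /= !selR e1 -cats1 !selC /selected /= !orbF; move: ul.
  rewrite e1 /unzip1 map_cat /= cat_uniq /= => /and4P[_ /norP[j1 /hasPn d12] j2 _].
  rewrite -/(selected theta l1 i) -/(selected theta l2 i) /covers /=.
  case: (eqVneq j i) => [<-|ji] /=.
    rewrite (selected_notin _ j1) (selected_notin _ j2) /= !orbF.
    case: (leP lo); case: (leP m); case: (ltP _ hi) => /=; case: (ltP _ m) => /=;
      rewrite ?addr0 ?add0r // => *; lra.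
  case: (boolP (i \in unzip1 l2)) => i2; last by rewrite (selected_notin _ i2) !orbF addr0.
  by rewrite (selected_notin _ (d12 _ i2)) add0r.
Qed.

(** Both children of a series node receive the same surplus, [d i] times the selection minus [thru],
    so it cancels at the middle node; in a parallel node the surpluses add up by [selected_cut].
    Zero surplus at the root will give conservation. *)
Lemma routes_div theta T l v i : 0 <= theta -> theta < 1 ->
  wf T -> uniq (arcs T) -> good T l ->
  \sum_(q <- routes T l | tail G q.1 == v) d i * (selected theta q.2 i)%:R -
  \sum_(q <- routes T l | head G q.1 == v) d i * (selected theta q.2 i)%:R -
  (\sum_(e <- arcs T | tail G e == v) X e i - \sum_(e <- arcs T | head G e == v) X e i) =
  (d i * (selected theta l i)%:R - thru T i) * ((v == tsrc G T)%:R - (v == tdst G T)%:R).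
Proof.
move=> th0 th1; elim: T l => [e|a IHa b IHb|a IHa b IHb] l w u g.
- rewrite /= !big_cons !big_nil /= ![_ == v]eq_sym.
  by case: eqP => _; case: eqP => _ /=; ring.
- have := u; rewrite /= cat_uniq => /and3P[ua _ ub]; have [wa wb ab _] := w.
  have ga : good a (insert l (locals a b)) by apply: (good_insert w u g); left.
  have gb : good b (insert l (locals b a)) by apply: (good_insert w u g); right.
  have := IHa _ wa ua ga; have := IHb _ wb ub gb; rewrite !big_cat /= -ab => hb ha.
  (* For a blocked commodity both sides vanish: it is not in [l], and if it crosses [c], then it is
     a local item with full demand, selected by every threshold. For any other commodity neither the
     selection nor the crossing changes. *)
  have key c c' : (c = a /\ c' = b \/ c = b /\ c' = a) ->
      d i * (selected theta (insert l (locals c c')) i)%:R - thru c i =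
      d i * (selected theta l i)%:R - thru (Ser a b) i.
    move=> cc; have [_ _ _ nb _] := g.
    rewrite (selected_perm _ _ (perm_insert_items _ _)) {1}/selected has_cat -!/(selected _ _ _).
    case: (boolP (blocked (Ser a b) i)) => bl.
      have il : i \notin unzip1 l.
        by apply/negP => /mapP[it /nb h e]; rewrite -e bl in h.
      rewrite (selected_notin _ il) orbF (thru_blocked pi_lt inst flowX w u bl) mulr0 subr0.
      have tc0 := thru_ge0 flowX c i.
      case: (boolP (thru c i <= 0)) => [h|pos].
        rewrite selected_notin; first by rewrite mulr0 sub0r; apply/eqP; rewrite oppr_eq0 eq_le h tc0.
        by apply/negP => /mapP[it /mem_locals[_ _ h2] e]; rewrite -e ltNge h in h2.
      have hd : thru c i = d i.
        rewrite -ltNge in pos; case: cc pos => [] [-> _] pos.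
          exact (thru_local_first pi_lt inst flowX w u bl pos).
        exact (thru_local_second pi_lt inst flowX w u bl pos).
      have hc' : thru c' i <= 0.
        have := thru_blocked pi_lt inst flowX w u bl; rewrite /=.
        rewrite -ltNge in pos; case: cc pos => [] [-> ->] pos.
          by case: leP => [_ h4|h3 ->]; rewrite ?lexx //; rewrite h4 ltxx in pos.
        by case: leP => [h3 ->|_ h4]; rewrite ?lexx //; rewrite h4 ltxx in pos.
      suff -> : selected theta (locals c c') i by rewrite mulr1 hd subrr.
      apply/hasP; exists (full_item i).
        by rewrite map_f // mem_filter hc' pos mem_enum.
      by rewrite /covers /= eqxx mulr_ge0 ?(ltW (dpos i)) //= gtr_pMl.
    have il : i \notin unzip1 (locals c c').
      apply/negP => /mapP[it /mem_locals[_ h1 h2] e].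
      have := thru_ser_eq pi_lt inst flowX w u bl; rewrite e => h3.
      by move: h1 h2; case: cc => [] [-> ->]; rewrite h3; lra.
    rewrite (selected_notin _ il) /=; congr (_ - _).
    have := thru_ser_eq pi_lt inst flowX w u bl.
    by case: cc => [] [-> _] ->; rewrite lexx.
  rewrite (key a b) in ha; last by left.
  rewrite (key b a) in hb; last by right.
  set r := (X in X * _); rewrite -/r in ha hb.
  have -> : r * ((v == tsrc G a)%:R - (v == tdst G b)%:R) =
    r * ((v == tsrc G a)%:R - (v == tdst G a)%:R) + r * ((v == tdst G a)%:R - (v == tdst G b)%:R).
    by ring.
  by rewrite -ha -hb; ring.
- have := u; rewrite /= cat_uniq => /and3P[ua _ ub]; have [wa wb e1 e2] := w.
  have [ga gb] := good_cut g.
  have := IHa _ wa ua ga; have := IHb _ wb ub gb; rewrite !big_cat /= -e1 -e2 => hb ha.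
  rewrite -(selected_cut theta i g).
  set A := (selected _ _ _)%:R in ha *; set B := (selected _ _ _)%:R in hb *.
  have -> : (d i * (A + B) - (thru a i + thru b i)) = (d i * A - thru a i) + (d i * B - thru b i).
    by ring.
  by rewrite mulrDl -ha -hb; ring.
Qed.

End Routing.

(** * Breakpoints and rounded flows *)

Section Rounding.
Variables (V E : finType) (R : realFieldType) (k : nat) (C : commodities V R k).
Notation d := (demand C).
Notation item := ('I_k * (R * R))%type.

(** As theta grows, the choice for an item changes only at [lo / d i] and [hi / d i]; these are the
    breakpoints. *)
Definition pieces_step (ps : seq (R * R)) (q : E * item) :=
  refine_at (q.2.2.2 / d q.2.1) (refine_at (q.2.2.1 / d q.2.1) ps).

Definition pieces (out : seq (E * item)) := foldl pieces_step [:: (0, 1)] out.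

Definition rounded (out : seq (E * item)) (theta : R) (e : E) (i : 'I_k) : R :=
  if has (fun q => [&& q.1 == e, q.2.1 == i & covers C theta q.2]) out then d i else 0.

Definition tagged_items (r : seq (E * seq item)) : seq (E * item) :=
  flatten [seq [seq (q.1, it) | it <- q.2] | q <- r].

Lemma mem_tagged_items (r : seq (E * seq item)) (q : E * item) : reflect (exists2 l, (q.1, l) \in r & q.2 \in l) (q \in tagged_items r).
Proof.
apply: (iffP flatten_mapP) => [[[e l] h /mapP[it itl ->]]|[l h1 h2]]; first by exists l.
by exists (q.1, l); rewrite // (surjective_pairing q) map_f.
Qed.

Lemma subdivides_pieces out : exists2 bs, subdivides bs (pieces out) &
  forall q, q \in out -> q.2.2.1 / d q.2.1 \in bs /\ q.2.2.2 / d q.2.1 \in bs.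
Proof.
suff aux bs ps : subdivides bs ps -> exists2 bs', subdivides bs' (foldl pieces_step ps out) &
    {subset bs <= bs'} /\
    forall q, q \in out -> q.2.2.1 / d q.2.1 \in bs' /\ q.2.2.2 / d q.2.1 \in bs'.
  by have [bs' h [_ h']] := aux _ _ (subdivides_unit R); exists bs'.
elim: out bs ps => /= [|q out IH] bs ps h; first by (exists bs => //; split; [move=> x |]).
have [bs' h1 [h2 h3]] := IH _ _ (subdivides_refine (q.2.2.2 / d q.2.1)
  (subdivides_refine (q.2.2.1 / d q.2.1) h)).
exists bs' => //; split=> [x xb|q']; first by apply: h2; rewrite !inE xb !orbT.
rewrite inE => /orP[/eqP ->|/h3 //].
by split; apply: h2; rewrite !inE eqxx ?orbT.
Qed.

End Rounding.

(** * The convex combination of unsplittable multiflows *)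

Section Combination.
Variables (V E : finType) (G : digraph V E) (pi : V -> rat).
Hypothesis pi_lt : forall e, pi (tail G e) < pi (head G e).
Variables (R : realFieldType) (k : nat) (C : commodities V R k) (X : E -> 'I_k -> R).
Hypothesis inst : multiflow_instance G C.
Hypothesis flowX : multiflow G C X.
Notation d := (demand C).
Notation item := ('I_k * (R * R))%type.

Variable T : tree E.
Hypotheses (wfT : wf G T) (arcsT : perm_eq (arcs T) (enum E)).

Let uT : uniq (arcs T). Proof. by rewrite (perm_uniq arcsT) enum_uniq. Qed.
Let dpos i : 0 < d i := d_gt0 inst i.

Definition root_items : seq item :=
  [seq full_item C i | i <- enum 'I_k & ~~ (thru X T i <= 0)].

Lemma sum_arcs (P : pred E) (F : E -> R) : \sum_(e <- arcs T | P e) F e = \sum_(e | P e) F e.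
Proof. by rewrite (perm_big _ arcsT) /= big_enum_cond. Qed.

(** No arc enters the start node of the whole digraph, so the outflow of [i] there is its supply,
    which is positive only if it equals [d i]. *)
Lemma root_thru i : ~~ (thru X T i <= 0) -> thru X T i = d i.
Proof.
rewrite -ltNge => pos.
have nb : ~~ blocked G C T i.
  by apply/negP => /(thru_blocked pi_lt inst flowX wfT uT) e; rewrite e ltxx in pos.
have := X_div inst flowX i (tsrc G T).
rewrite [X in _ - X]big1 ?subr0; last first.
  move=> e /eqP he; have ea : e \in arcs T by rewrite (perm_mem arcsT) mem_enum.
  have [h _] := arcs_between pi_lt wfT ea.
  by have := pi_lt e; rewrite he ltNge h.
rewrite -sum_arcs -/(outflow G X (arcs T) (tsrc G T) i) -(thru_unblocked pi_lt inst flowX wfT uT nb).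
move=> e; move: pos; rewrite e; have := dpos i.
by case: eqP => _; case: eqP => _ /=; rewrite ?subrr ?subr0 ?sub0r ?mulr0 ?mulr1 ?mulrN1 // => ?; lra.
Qed.

Lemma good_root : good G C X T root_items.
Proof.
have mem it : it \in root_items -> it = full_item C it.1 /\ ~~ (thru X T it.1 <= 0).
  by case/mapP => i; rewrite mem_filter => /andP[h _] ->.
split.
- rewrite /unzip1 -map_comp map_inj_in_uniq; last by move=> i j _ _.
  exact/filter_uniq/enum_uniq.
- by move=> it /mem[-> _]; split=> //=.
- by apply: trim_full => it /mem[].
- move=> it /mem[_]; rewrite -ltNge; apply: contraL => h.
  by rewrite (thru_blocked pi_lt inst flowX wfT uT h) ltxx.
- rewrite /amount big_map big_filter /= enumT /flow_through.
  rewrite [RHS](bigID (fun i => ~~ (thru X T i <= 0))) /= [X in _ = _ + X]big1 ?addr0.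
    by apply: eq_bigr => i /root_thru ->; rewrite subr0.
  by move=> i; rewrite negbK => h; apply/eqP; rewrite eq_le h (thru_ge0 flowX).
Qed.

(** Only membership is fixed, as the worklist emits the same items in another order. *)
Variable out : seq (E * item).
Hypothesis out_routes : out =i tagged_items (routes C X T root_items).

Let rs := routes C X T root_items.

Lemma rs_uniq e l l' : (e, l) \in rs -> (e, l') \in rs -> l = l'.
Proof.
have : uniq (unzip1 rs) by rewrite /rs map_fst_routes.
elim: rs => //= -[e1 l1] r IH /= /andP[n u]; rewrite !inE => /orP[/eqP[-> ->]|h].
  by case/orP => [/eqP[->] //|/(map_f fst) /= h]; rewrite h in n.
case/orP => [/eqP[e2 _]|h']; last exact: IH.
by move: n; rewrite -e2; move/(map_f fst): h => /= ->.
Qed.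

Lemma rs_ex e : exists l, (e, l) \in rs.
Proof.
have : e \in unzip1 rs by rewrite /rs map_fst_routes (perm_mem arcsT) mem_enum.
by case/mapP => [[e' l] h ->]; exists l.
Qed.

Lemma rounded_selected theta e l i : (e, l) \in rs ->
  rounded C out theta e i = d i * (selected C theta l i)%:R.
Proof.
move=> el; rewrite /rounded.
have -> : has (fun q => [&& q.1 == e, q.2.1 == i & covers C theta q.2]) out = selected C theta l i.
  rewrite (eq_has_r out_routes); apply/hasP/hasP => [[q /mem_tagged_items[l' h1 h2]]|[it itl h]].
    case/and3P => /eqP e1 e2 e3; exists q.2; last by rewrite e2 e3.
    by rewrite e1 in h1; rewrite (rs_uniq el h1).
  by exists (e, it); rewrite /= ?eqxx //; apply/mem_tagged_items; exists l.
by case: ifP => _; rewrite ?mulr1 ?mulr0.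
Qed.

Lemma sum_rounded theta (P : pred E) i :
  \sum_(e | P e) rounded C out theta e i =
  \sum_(q <- rs | P q.1) d i * (selected C theta q.2 i)%:R.
Proof.
rewrite -sum_arcs -(map_fst_routes C X T root_items) big_map /=.
rewrite [LHS]big_seq_cond [RHS]big_seq_cond; apply: eq_bigr => -[e l] /andP[h _] /=.
exact: rounded_selected.
Qed.

Section Threshold.
Variable theta : R.
Hypotheses (th0 : 0 <= theta) (th1 : theta < 1).

Lemma covers_full i : covers C theta (full_item C i).
Proof. by rewrite /covers /= mulr_ge0 ?(ltW (dpos i)) //= gtr_pMl. Qed.

(** The surplus of [routes_div] is zero at the root: a commodity crossing the whole digraph is a
    root item with full demand, selected by every threshold, and any other is neither selected nor
    crossing. *)
Lemma rounded_div v i :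
  \sum_(e | tail G e == v) rounded C out theta e i -
  \sum_(e | head G e == v) rounded C out theta e i =
  \sum_(e | tail G e == v) X e i - \sum_(e | head G e == v) X e i.
Proof.
rewrite !sum_rounded; apply/eqP; rewrite -subr_eq0; apply/eqP.
rewrite -!sum_arcs (routes_div pi_lt inst flowX v i th0 th1 wfT uT good_root).
have -> : d i * (selected C theta root_items i)%:R - thru X T i = 0; last by rewrite mul0r.
case: (boolP (thru X T i <= 0)) => h.
  rewrite selected_notin; last first.
    by apply/negP => /mapP[it /mapP[j]]; rewrite mem_filter => /andP[h' _] -> /= e; rewrite -e h in h'.
  by rewrite mulr0 sub0r; apply/eqP; rewrite oppr_eq0 eq_le h (thru_ge0 flowX).
suff -> : selected C theta root_items i by rewrite mulr1 root_thru ?subrr.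
apply/hasP; exists (full_item C i); last by rewrite /= eqxx covers_full.
by rewrite map_f // mem_filter h mem_enum.
Qed.

Lemma rounded_values e i : rounded C out theta e i = 0 \/ rounded C out theta e i = d i.
Proof. by rewrite /rounded; case: ifP; [right|left]. Qed.

Lemma rounded_unsplittable : unsplittable G C (rounded C out theta).
Proof.
split.
- split=> [e i|v i]; first by case: (rounded_values e i) => ->; rewrite ?(ltW (dpos i)).
  by rewrite rounded_div; case: flowX.
- exact: rounded_values.
move=> i; pose A := [set e | rounded C out theta e i == d i].
have AE e : (e \in A)%:R = rounded C out theta e i / d i.
  rewrite inE; case: (rounded_values e i) => ->; last by rewrite eqxx divff ?gt_eqF.
  by rewrite eq_sym gt_eqF // mul0r.
(* [unit_flow_walk] speaks about [rat]; this identity between integers is brought there from [R]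
   through the injective embedding [ratr]. *)
have natR (P Q : pred E) (v : V) : (\sum_(e | P e) (e \in A)%:R - \sum_(e | Q e) (e \in A)%:R =
     (v == source C i)%:R - (v == sink C i)%:R :> R) ->
   (\sum_(e | P e) (e \in A)%:R - \sum_(e | Q e) (e \in A)%:R =
     (v == source C i)%:R - (v == sink C i)%:R :> rat).
  move=> h; apply: (fmorph_inj (@ratr R)).
  rewrite !rmorphB /= !rmorph_nat !rmorph_sum /= -h.
  by congr (_ - _); apply: eq_bigr => e _; rewrite rmorph_nat.
have [|p w pA] := @unit_flow_walk V E G pi pi_lt A (source C i) (sink C i).
  move=> v; apply: natR; under eq_bigr do rewrite AE; under [X in _ - X]eq_bigr do rewrite AE.
  rewrite -!mulr_suml -mulrBl rounded_div (X_div inst flowX).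
  by rewrite mulrAC divff ?mul1r ?gt_eqF.
exists p; first exact: walk_dipath w.
by move=> e; rewrite pA inE.
Qed.

Lemma total_rounded e l : (e, l) \in rs -> uniq (unzip1 l) ->
  total_flow (rounded C out theta) e = \sum_(it <- l) d it.1 * (covers C theta it)%:R.
Proof.
move=> el u; rewrite /total_flow; under eq_bigr do rewrite (rounded_selected _ _ el).
elim: l u {el} => [|it l IH] /=.
  by rewrite big_nil big1 // => i _; rewrite mulr0.
case/andP => n u; rewrite big_cons -IH // (bigD1 it.1) //= [in RHS](bigD1 it.1) //= addrA.
have -> : selected C theta l it.1 = false by apply: selected_notin.
rewrite mulr0 addr0 eqxx orbF.
congr (_ + _); apply: eq_bigr => i; rewrite eq_sym => /negPf ->.
by [].
Qed.

Lemma d_le_dmax i : d i <= dmax C.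
Proof. by rewrite /dmax; apply: le_bigmax. Qed.

Lemma dmax_gt0 : 0 < dmax C.
Proof.
have [k0 _] := inst; exact: lt_le_trans (dpos (Ordinal k0)) (d_le_dmax _).
Qed.

(** Strict on both sides: a covered item has positive length, and an uncovered one is not all of
    [[0, d i)], which every threshold covers. *)
Lemma item_deviation it : item_ok C it ->
  `|d it.1 * (covers C theta it)%:R - (it.2.2 - it.2.1)| < dmax C.
Proof.
case=> h1 h2 h3; apply: lt_le_trans (d_le_dmax it.1); rewrite ltr_norml.
have := covers_full it.1; rewrite /covers /=; set x := theta * _ => /andP[x0 xd].
case: (leP it.2.1 x) => a; case: (ltP x it.2.2) => b /=; apply/andP; split; lra.
Qed.

(** Items strictly inside the list are full, hence covered with deviation zero; at most two
    deviations remain, each strictly below [dmax C]. *)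
Lemma deviation l : trim C l -> (forall it, it \in l -> item_ok C it) ->
  `|\sum_(it <- l) (d it.1 * (covers C theta it)%:R - (it.2.2 - it.2.1))| < 2 * dmax C.
Proof.
move=> tr ok; have d0 := dmax_gt0.
pose F (it : item) := d it.1 * (covers C theta it)%:R - (it.2.2 - it.2.1).
rewrite (eq_bigr F) //.
have one it : it \in l -> `|F it| < dmax C by move=> /ok; apply: item_deviation.
have full it : it = full_item C it.1 -> F it = 0.
  by rewrite /F => ->; rewrite covers_full /= mulr1 subr0 subrr.
case: l tr ok one => [|x l] tr ok one.
  by rewrite big_nil normr0; lra.
rewrite big_cons; case/lastP: l tr ok one => [|l y] tr ok one.
  by rewrite big_nil addr0; apply: lt_trans (one x (mem_head _ _)) _; rewrite ltr_pMl // ltr1n.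
rewrite -cats1 big_cat big_seq1 /= big_seq big1 ?add0r.
  apply: le_lt_trans (ler_normD _ _) _; rewrite [2 * _]mulr_natl mulr2n.
  by apply: ltrD; apply: one; rewrite !inE ?eqxx // mem_rcons mem_head orbT.
move=> it /(nthP x)[j js <-]; apply: full.
have := tr x j.+1 isT; rewrite /= size_rcons nth_rcons js; apply; exact: js.
Qed.

End Threshold.

Definition piece (j : 'I_(size (pieces C out))) := nth (0, 1) (pieces C out) j.

(** No breakpoint lies inside a piece, so its left end may stand for all its thresholds, weighted by
    the length of the piece. *)
Theorem tree_combination :
  unsplittable_combination G C X (fun j => (piece j).2 - (piece j).1)
    (fun j => rounded C out (piece j).1).
Proof.
have [bs sub bpts] := subdivides_pieces C out.
have sumE (F : R * R -> R) : \sum_j F (piece j) = \sum_(p <- pieces C out) F p.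
  by rewrite (big_nth (0, 1)) big_mkord.
have [sub1 _ _] := sub.
have pieceP j : [/\ 0 <= (piece j).1, (piece j).1 < (piece j).2 & (piece j).2 <= 1].
  by apply: sub1; apply: mem_nth.
have th0 j : 0 <= (piece j).1 by case: (pieceP j).
have th1 j : (piece j).1 < 1 by case: (pieceP j) => _; apply: lt_le_trans.
have goodr q : q \in rs -> good G C X (Leaf q.1) q.2.
  exact: (good_routes pi_lt inst flowX wfT uT good_root).
split.
- split=> [j|]; first by case: (pieceP j) => _ /ltW; rewrite subr_ge0.
  by rewrite (sumE (fun p => p.2 - p.1)) (subdivides_total sub).
- move=> e; have [l el] := rs_ex e.
  have [/= ul ok _ _ tot] := goodr _ el.
  under eq_bigr do rewrite (total_rounded _ el) //.
  rewrite (sumE (fun p => (p.2 - p.1) * \sum_(it <- l) d it.1 * (covers C p.1 it)%:R)).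
  rewrite -[total_flow X e]/(flow_through X (Leaf e)) -tot /amount.
  under [RHS]eq_bigr do rewrite mulr_sumr.
  rewrite exchange_big /= !big_seq; apply: eq_bigr => it itl.
  have [lo0 lohi hid] := ok _ itl; have d0 := dpos it.1.
  have [b1 b2] : it.2.1 / d it.1 \in bs /\ it.2.2 / d it.1 \in bs.
    by apply: (bpts (e, it)); rewrite out_routes; apply/mem_tagged_items; exists l.
  (* The weight of the thresholds covered by the item is the measure below [hi / d i] minus the
     measure below [lo / d i]. *)
  have m1 : \sum_(p <- pieces C out) (p.2 - p.1) * (p.1 < it.2.1 / d it.1)%R%:R = it.2.1 / d it.1.
    apply: subdivides_measure sub b1 _ _; first by rewrite divr_ge0 // ltW.
    by rewrite ler_pdivrMr // mul1r (le_trans (ltW lohi)).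
  have m2 : \sum_(p <- pieces C out) (p.2 - p.1) * (p.1 < it.2.2 / d it.1)%R%:R = it.2.2 / d it.1.
    apply: subdivides_measure sub b2 _ _; last by rewrite ler_pdivrMr // mul1r.
    by rewrite divr_ge0 ?ltW // (le_lt_trans lo0).
  have -> : it.2.2 - it.2.1 = d it.1 * (it.2.2 / d it.1 - it.2.1 / d it.1).
    by rewrite mulrBr ![d it.1 * (_ / _)]mulrC !divfK ?gt_eqF.
  rewrite -{1}m1 -{1}m2 -sumrB mulr_sumr; apply: eq_bigr => p _.
  rewrite !ltr_pdivlMr // /covers; case: (leP it.2.1) => a; case: (ltP _ it.2.2) => b /=; try ring.
  by exfalso; lra.
- by move=> j; apply: rounded_unsplittable.
- move=> j e; have [l el] := rs_ex e.
  have [/= ul ok tr _ tot] := goodr _ el.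
  have := deviation (th0 j) (th1 j) tr ok.
  rewrite sumrB -(total_rounded _ el ul) -/(amount l) tot -[flow_through X _]/(total_flow X e).
  by rewrite ltr_norml => /andP[h1 h2]; apply/andP; split; lra.
Qed.

End Combination.

(** * Parsing and iterative routing *)

Lemma tree_comparable (E : eqType) : comparable (tree E).
Proof. by move=> x y; rewrite /decidable; decide equality; apply: eq_comparable. Qed.

HB.instance Definition _ (E : eqType) :=
  hasDecEq.Build (tree E) (compareP (@tree_comparable E)).

Section Parsing.
Variables (V E : finType) (G : digraph V E).
Implicit Types (T e f : tree E) (D : seq (tree E)).

Definition tree_ends T : V * V := (tsrc G T, tdst G T).

Definition parallel e f := (tsrc G f == tsrc G e) && (tdst G f == tdst G e).
(** Includes trees that end at this node: a series merge is allowed only if nothing but the next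
    tree touches it. *)
Definition follows e f := touches (tdst G e) (tree_ends f).

(** Only partners of the head entry are tried, and without success it moves to the back. For a
    series pair it suffices to search from the first of the two trees, since rotation brings every
    entry to the head. *)
Definition parse_step D : seq (tree E) :=
  if D is e :: r then
    let P := [seq f <- r | parallel e f] in
    let Q := [seq f <- r | follows e f] in
    if P is f :: P' then Par e f :: P' ++ [seq f <- r | ~~ parallel e f]
    else if Q is f :: Q' then
      if nilp Q' && (tsrc G f == tdst G e)
      then Ser e f :: [seq f <- r | ~~ follows e f] else rcons r e
    else rcons r e
  else D.

Definition mergeable e D :=
  has (parallel e) D ||
  ((size [seq f <- D | follows e f] == 1)%N && all (fun f => follows e f ==> (tsrc G f == tdst G e)) D).

Lemma mergeable_perm e D D' : perm_eq D D' -> mergeable e D = mergeable e D'.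
Proof.
move=> p; rewrite /mergeable (eq_has_r (perm_mem p)) (eq_all_r (perm_mem p)).
by rewrite !size_filter (permP p).
Qed.

Lemma parse_step_rotate e r : ~~ mergeable e r -> parse_step (e :: r) = rcons r e.
Proof.
rewrite /mergeable negb_or has_filter negbK => /andP[/eqP e1 h] /=; rewrite e1.
case eQ: [seq f <- r | follows e f] h => [|f [|//]] //= h.
case: ifP => // h'; move: h => /negP[]; apply/allP => g gr.
apply/implyP => fg; have : g \in [seq f <- r | follows e f] by rewrite mem_filter fg.
by rewrite eQ inE => /eqP ->.
Qed.

Lemma parse_step_merge e r : mergeable e r -> (size (parse_step (e :: r)) <= size r)%N.
Proof.
rewrite /mergeable /= => h; have pp := perm_size (permEl (perm_filterC (parallel e) r)).
have pf := perm_size (permEl (perm_filterC (follows e) r)).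
move: h; rewrite has_filter; move: pp; case: [seq f <- r | parallel e f] => [_|f P' pp _] /=; last first.
  by rewrite -pp /= !size_cat /=.
move: pf; case eQ: [seq f <- r | follows e f] => [|f [|//]] //= pf h.
have fr : f \in r /\ follows e f.
  have : f \in [seq f <- r | follows e f] by rewrite eQ mem_head.
  by rewrite mem_filter => /andP[].
have -> : tsrc G f == tdst G e by have /allP/(_ f fr.1) := h; rewrite fr.2.
by rewrite -pf.
Qed.

Lemma size_parse_step D : (size (parse_step D) <= size D)%N.
Proof.
case: D => // e r; case: (boolP (mergeable e r)) => h.
  by apply: leq_trans (parse_step_merge h) _.
by rewrite parse_step_rotate // size_rcons.
Qed.

Lemma size_iter_parse n D : (size (iter n parse_step D) <= size D)%N.
Proof. by elim: n => //= n; apply: leq_trans (size_parse_step _). Qed.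

(** Mergeability of [e] depends on the other entries only up to order, so it survives the rotation
    of the entries before it; either one of those merges, or [e] reaches the head and does. *)
Lemma iter_rotate D1 e D2 n : mergeable e (D2 ++ D1) -> (size D1 < n)%N ->
  (size (iter n parse_step (D1 ++ e :: D2)) < size (D1 ++ e :: D2))%N.
Proof.
elim: D1 D2 n => [|c D1 IH] D2 [//|n] m; rewrite iterSr => ln.
  rewrite cats0 in m; apply: leq_ltn_trans (size_iter_parse _ _) _.
  by rewrite ltnS; apply: parse_step_merge.
case: (boolP (mergeable c (D1 ++ e :: D2))) => hc.
  apply: leq_ltn_trans (size_iter_parse _ _) _.
  by rewrite ltnS; apply: parse_step_merge.
rewrite parse_step_rotate // rcons_cat rcons_cons.
have -> : size ((c :: D1) ++ e :: D2) = size (D1 ++ e :: rcons D2 c).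
  by rewrite /= !size_cat /= size_rcons !addnS.
apply: IH => //; rewrite (mergeable_perm _ (_ : perm_eq _ (D2 ++ c :: D1))) //.
by rewrite cat_rcons.
Qed.

Lemma perm_map_cons (A B : eqType) (g : A -> B) (x : seq A) b y :
  perm_eq (map g x) (b :: y) ->
  exists a x', [/\ perm_eq x (a :: x'), g a = b & perm_eq (map g x') y].
Proof.
move=> p; have : b \in map g x by rewrite (perm_mem p) mem_head.
case/mapP => a ax e; exists a, (rem a x); split=> //; first exact: perm_to_rem.
by rewrite -(perm_cons b) -(permPr p) {1}e -map_cons perm_map // perm_sym perm_to_rem.
Qed.

Lemma reducible_mergeable D : reducible (map tree_ends D) ->
  exists D1 e D2, D = D1 ++ e :: D2 /\ mergeable e (D2 ++ D1).
Proof.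
suff aux e D' : perm_eq D (e :: D') -> mergeable e D' ->
    exists D1 e D2, D = D1 ++ e :: D2 /\ mergeable e (D2 ++ D1).
  case=> [[x [y [C' p]]]|[x [w [y [C' [p nw]]]]]].
    have [e [D1 [p1 e1 p2]]] := perm_map_cons p.
    have [f [D2 [p3 e2 p4]]] := perm_map_cons p2.
    apply: aux p1 _; apply/orP; left; apply/hasP; exists f.
      by rewrite (perm_mem p3) mem_head.
    by case: e1 e2 => [<- <-] [e3 e4]; rewrite /parallel e3 e4 !eqxx.
  have [e [D1 [p1 e1 p2]]] := perm_map_cons p.
  have [f [D2 [p3 e2 p4]]] := perm_map_cons p2.
  apply: aux p1 _; rewrite (mergeable_perm _ p3); apply/orP; right.
  case: e1 e2 => [_ ew] [fw _].
  have nf : all (fun g => ~~ follows e g) D2.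
    by move: nw; rewrite -(on_perm _ p4) has_map -all_predC /follows ew.
  have -> : [seq g <- f :: D2 | follows e g] = [:: f].
    rewrite /= {1}/follows /touches /= fw ew eqxx /=; congr (_ :: _).
    by apply/eqP; rewrite -[_ == _]negbK -has_filter -all_predC.
  rewrite eqxx /= fw ew eqxx implybT /=.
  by apply: sub_all nf => g /negPf ->.
move=> p m; have eD : e \in D by rewrite (perm_mem p) mem_head.
case/splitPr: eD p => D1 D2 p; exists D1, e, D2; split=> //.
rewrite (mergeable_perm _ (_ : perm_eq _ D')) // -(perm_cons e) -(permPr p) perm_sym.
by rewrite (perm_catC D1) /= perm_cons.
Qed.

Definition parse_inv u v D :=
  [/\ sp (map tree_ends D) u v, (forall T, T \in D -> wf G T)
    & perm_eq (flatten (map (@arcs E) D)) (enum E)].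

Lemma parse_inv_perm u v D D' : perm_eq D D' -> parse_inv u v D -> parse_inv u v D'.
Proof.
move=> p [h1 h2 h3]; split.
- exact: sp_perm h1 (perm_map _ p).
- by move=> T; rewrite -(perm_mem p); apply: h2.
- by rewrite -(permPr h3) perm_sym; apply: perm_flatten; apply: perm_map.
Qed.

Lemma parse_inv_par u v e f D : tree_ends e = tree_ends f ->
  parse_inv u v [:: e, f & D] -> parse_inv u v (Par e f :: D).
Proof.
move=> ef [h1 h2 h3]; have [e1 e2] := ef; split.
- have -> : map tree_ends (Par e f :: D) = (tsrc G e, tdst G e) :: map tree_ends D by [].
  by apply: sp_merge_par h1 _; rewrite /= -ef.
- move=> T; rewrite inE => /orP[/eqP ->|h]; last by apply: h2; rewrite !inE h !orbT.
  by split=> //; apply: h2; rewrite !inE eqxx ?orbT.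
- by move: h3; rewrite /= catA.
Qed.

(** For the closure clause of [wf], suppose an arc at the middle node lies in another tree [g]. The
    node is no terminal of [g], so it is an inner one; then [wf_closed] puts an arc of [e] into [g]
    as well, although the trees share no arcs. *)
Lemma parse_inv_ser u v e f D : tsrc G f = tdst G e -> all (fun g => ~~ follows e g) D ->
  parse_inv u v [:: e, f & D] -> parse_inv u v (Ser e f :: D).
Proof.
move=> ef nD [h1 h2 h3].
have nw : ~~ has (touches (tdst G e)) (map tree_ends D) by rewrite has_map -all_predC.
have we : wf G e by apply: h2; rewrite mem_head.
have wf' : wf G f by apply: h2; rewrite !inE eqxx orbT.
split.
- have -> : map tree_ends (Ser e f :: D) = (tsrc G e, tdst G f) :: map tree_ends D by [].
  by apply: sp_merge_ser h1 _ nw; rewrite /= /tree_ends ef.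
- move=> T; rewrite inE => /orP[/eqP ->|h]; last by apply: h2; rewrite !inE h !orbT.
  split=> // a; rewrite ef => aw.
  have : a \in flatten (map (@arcs E) [:: e, f & D]) by rewrite (perm_mem h3) mem_enum.
  rewrite /= catA mem_cat => /orP[//|/flatten_mapP[g gD ag]].
  have wg : wf G g by apply: h2; rewrite !inE gD !orbT.
  have := arc_ends wg ag aw.
  have := allP nD _ gD; rewrite /follows /touches /= ![_ == tdst G e]eq_sym => /norP[/negPf -> /negPf ->] /= wi.
  have [b be hb] := tdst_arc we.
  have bg : b \in arcs g by apply: wf_closed wg wi _; rewrite /touches /= hb eqxx orbT.
  have : uniq (flatten (map (@arcs E) [:: e, f & D])) by rewrite (perm_uniq h3) enum_uniq.
  rewrite /= cat_uniq => /and3P[_ /hasPn h _]; exfalso.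
  have : b \in arcs f ++ flatten (map (@arcs E) D).
    by rewrite mem_cat; apply/orP; right; apply/flatten_mapP; exists g.
  by move/h; rewrite be.
- by move: h3; rewrite /= catA.
Qed.

Lemma parse_inv_step u v D : parse_inv u v D -> parse_inv u v (parse_step D).
Proof.
case: D => // e r inv /=.
have pp := permEl (perm_filterC (parallel e) r).
have pf := permEl (perm_filterC (follows e) r).
have rot : parse_inv u v (rcons r e).
  by apply: parse_inv_perm inv; rewrite perm_sym perm_rcons.
case eP: [seq f <- r | parallel e f] pp => [|f P'] pp.
  case eQ: [seq f <- r | follows e f] pf => [|f [|f' Q']] pf //=; rewrite ?andFb //.
  case: eqP => // ef; apply: parse_inv_ser => //; first exact: filter_all.
  by apply: parse_inv_perm inv; rewrite perm_cons perm_sym.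
apply: parse_inv_par; last by apply: parse_inv_perm inv; rewrite perm_cons perm_sym.
have : f \in [seq f <- r | parallel e f] by rewrite eP mem_head.
by rewrite mem_filter => /andP[/andP[/eqP e1 /eqP e2] _]; rewrite /tree_ends e1 e2.
Qed.

Lemma parse_inv_iter u v n D : parse_inv u v D -> parse_inv u v (iter n parse_step D).
Proof. by move=> h; elim: n => //= n; apply: parse_inv_step. Qed.

(** A list of several entries has a reduction, hence a mergeable entry, and [n] steps reach it. Each
    round thus shortens the list, so [n] rounds leave one tree. *)
Lemma parse_inv_decrease u v n D : parse_inv u v D -> (size D <= n)%N ->
  (size (iter n parse_step D) <= maxn 1 (size D).-1)%N.
Proof.
move=> [h1 _ _] Dn; have [e|red] := sp_reducible h1.
  have := size_iter_parse n D; have := congr1 size e; rewrite size_map /= => ->.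
  by move=> h; apply: leq_trans h _.
have [D1 [e [D2 [eD m]]]] := reducible_mergeable red.
have := @iter_rotate D1 e D2 n m; rewrite -eD => /(_ _).
have : (size D1 < n)%N by apply: leq_trans Dn; rewrite eD size_cat /= addnS ltnS leq_addr.
by move=> h /(_ h); lia.
Qed.

Definition parse_leaves : seq (tree E) := [seq Leaf a | a : E <- enum E].
Definition parse n := iter n (iter n parse_step) parse_leaves.

Lemma parse_inv_leaves : series_parallel G ->
  exists u v, parse_inv u v parse_leaves.
Proof.
case=> u [v /sp_of_part[h _]]; exists u, v; split.
- rewrite /parse_leaves -map_comp; move: h.
  rewrite (_ : enum [set: E] = enum E) //; apply: eq_enum => e; by rewrite !inE.
- by move=> T /mapP[e _ ->].
- by rewrite /parse_leaves -map_comp flatten_seq1.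
Qed.

Lemma parse_correct n : series_parallel G -> #|E| = n ->
  exists2 T, parse n = [:: T] & wf G T /\ perm_eq (arcs T) (enum E).
Proof.
move=> /parse_inv_leaves[u [v inv]] En.
have inv' j : parse_inv u v (iter j (iter n parse_step) parse_leaves).
  by elim: j => //= j IH; apply: parse_inv_iter.
have sz j : (size (iter j (iter n parse_step) parse_leaves) <= maxn 1 (n - j))%N.
  elim: j => [|j IH]; first by rewrite /= size_map -cardE En subn0 leq_maxr.
  have [h|h] := leqP (size (iter j (iter n parse_step) parse_leaves)) n.
    by apply: leq_trans (parse_inv_decrease (inv' j) h) _; lia.
  have n0 : n = 0%N by lia.
  by rewrite iterS {1}n0 /=; lia.
have := sz n; rewrite subnn -/(parse n) => le1.
have [h1 h2 h3] := inv' n; rewrite -/(parse n) in h1 h2 h3.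
case e: (parse n) le1 h1 h2 h3 => [|T [|]] //= _; first by move/sp_size.
by move=> _ h2; rewrite cats0 => h3; exists T => //; split=> //; apply: h2; rewrite mem_head.
Qed.

Lemma series_parallel_potential : series_parallel G ->
  exists pi : V -> rat, forall a, pi (tail G a) < pi (head G a).
Proof.
case=> u [v /sp_of_part[/sp_potential[pi [_ _ h]] _]]; exists pi => a.
by have /h[] : ends G a \in map (ends G) (enum [set: E]) by rewrite map_f // mem_enum inE.
Qed.

End Parsing.

(** * Iterative routing with an explicit stack *)

Section Worklist.
Variables (V E : finType) (G : digraph V E) (pi : V -> rat).
Hypothesis pi_lt : forall e, pi (tail G e) < pi (head G e).
Variables (R : realFieldType) (k : nat) (C : commodities V R k) (X : E -> 'I_k -> R).
Hypothesis inst : multiflow_instance G C.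
Hypothesis flowX : multiflow G C X.
Notation item := ('I_k * (R * R))%type.
Notation state := (seq (tree E * seq item) * seq (E * item))%type.

Definition route_step (st : state) : state :=
  if st.1 is (T, l) :: stk then
    match T with
    | Leaf e => (stk, catrev [seq (e, it) | it <- l] st.2)
    | Ser a b => ([:: (a, insert l (locals C X a b)), (b, insert l (locals C X b a)) & stk], st.2)
    | Par a b => ([:: (a, (cut (flow_through X a) l).1), (b, (cut (flow_through X a) l).2) & stk], st.2)
    end
  else st.

Fixpoint tree_size (T : tree E) : nat :=
  match T with Leaf _ => 1 | Ser a b | Par a b => (tree_size a + tree_size b).+1 end.

(** A binary tree with [n] leaves has [2 * n - 1] nodes, so two steps per arc empty the stack. *)
Lemma tree_size_arcs T : (tree_size T).+1 = (size (arcs T)).*2.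
Proof. by elim: T => //= a IHa b IHb; rewrite size_cat doubleD -IHa -IHb; lia. Qed.

Definition pending (st : state) : nat := sumn [seq tree_size p.1 | p <- st.1].

Lemma tree_size_gt0 T : (0 < tree_size T)%N. Proof. by case: T. Qed.

Lemma pending_step st : pending (route_step st) = (pending st).-1.
Proof.
case: st => [[|[T l] stk] o] //; rewrite /pending /route_step /=.
by case: T => //= a b; rewrite addnA.
Qed.

Definition routed (st : state) : seq (E * item) :=
  st.2 ++ flatten [seq tagged_items (routes C X p.1 p.2) | p <- st.1].

Lemma tagged_items_cat (r1 r2 : seq (E * seq item)) :
  tagged_items (r1 ++ r2) = tagged_items r1 ++ tagged_items r2.
Proof. by rewrite /tagged_items map_cat flatten_cat. Qed.

Lemma routed_step st : routed (route_step st) =i routed st.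
Proof.
case: st => [[|[T l] stk] o] //; case: T => [e|a b|a b] q; rewrite /routed /=.
- rewrite catrevE /tagged_items /= cats0 !mem_cat mem_rev.
  by do !case: (q \in _).
- by rewrite tagged_items_cat !catA.
- by rewrite tagged_items_cat !catA.
Qed.

Lemma route_correct n T : (size (arcs T) <= n)%N -> forall l,
  let st := iter n (iter 2 route_step) ([:: (T, l)], [::]) in
  st.1 = [::] /\ st.2 =i tagged_items (routes C X T l).
Proof.
move=> nT l st.
have iterE : st = iter (n * 2) route_step ([:: (T, l)], [::]) by rewrite iterM.
have inv j : routed (iter j route_step ([:: (T, l)], [::])) =i tagged_items (routes C X T l).
  by elim: j => [|j IH] q; rewrite ?routed_step //= /routed /= cats0.
have wt j : pending (iter j route_step ([:: (T, l)], [::])) = (tree_size T - j)%N.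
  by elim: j => [|j IH]; rewrite ?subn0 //= ?pending_step ?IH ?subnS // /pending /= addn0.
have st1 : st.1 = [::].
  have := wt (n * 2)%N; rewrite -iterE.
  have -> : (tree_size T - n * 2)%N = 0%N by have := tree_size_arcs T; lia.
  by case: (st) => [[|[T' l'] stk] o] //=; rewrite /pending /=; have := tree_size_gt0 T'; lia.
split=> // q; have := inv (n * 2)%N q; rewrite -iterE /routed st1 /= cats0.
by [].
Qed.

Definition state_inv (st : state) := forall p, p \in st.1 ->
  [/\ wf G p.1, uniq (arcs p.1) & good G C X p.1 p.2].

Lemma state_inv_step st : state_inv st -> state_inv (route_step st).
Proof.
case: st => [[|[T l] stk] o] // h; rewrite /route_step /=.
have [/= w u g] := h _ (mem_head _ _).
have rest p : p \in stk -> [/\ wf G p.1, uniq (arcs p.1) & good G C X p.1 p.2].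
  by move=> ps; apply: h; rewrite inE ps orbT.
case: T w u g {h} => [e|a b|a b] w u g p //=; first exact: rest.
  have := u; rewrite /= cat_uniq => /and3P[ua _ ub]; have [wa wb _ _] := w.
  rewrite !inE => /or3P[/eqP ->|/eqP ->|/rest //]; split=> //=.
    by apply: (good_insert pi_lt inst flowX w u g); left.
  by apply: (good_insert pi_lt inst flowX w u g); right.
have := u; rewrite /= cat_uniq => /and3P[ua _ ub]; have [wa wb _ _] := w.
have [ga gb] := good_cut flowX g.
by rewrite !inE => /or3P[/eqP ->|/eqP ->|/rest //].
Qed.

End Worklist.

Section Algorithm.
Variables (V E : finType) (G : digraph V E).
Variables (R : realFieldType) (k : nat) (C : commodities V R k) (X : E -> 'I_k -> R).

Definition routing n (T : tree E) :=
  (iter n (iter 2 (route_step C X)) ([:: (T, root_items C X T)], [::])).2.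

Lemma algorithm_correct n : series_parallel G -> multiflow_instance G C ->
  multiflow G C X -> #|E| = n ->
  exists2 T, parse G n = [:: T] &
  [/\ wf G T, perm_eq (arcs T) (enum E) &
    unsplittable_combination G C X
    (fun j : 'I_(size (pieces C (routing n T))) => (piece j).2 - (piece j).1)
    (fun j => rounded C (routing n T) (piece j).1)].
Proof.
move=> spG inst flowX En; have [T eT [w p]] := parse_correct spG En.
have [pi pi_lt] := series_parallel_potential spG.
exists T => //; split=> //; apply: (tree_combination pi_lt inst flowX w p).
have nT : (size (arcs T) <= n)%N by rewrite (perm_size p) -cardE En.
by have [_] := route_correct C X nT (root_items C X T).
Qed.

End Algorithm.

Lemma combination_exists (R : realFieldType) (V E : finType) (G : digraph V E) (k : nat)
    (C : commodities V R k) (X : E -> 'I_k -> R) :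
  series_parallel G -> multiflow_instance G C -> multiflow G C X ->
  exists (N : nat) (lam : 'I_N -> R) (Y : 'I_N -> E -> 'I_k -> R),
    unsplittable_combination G C X lam Y.
Proof.
move=> spG inst flowX.
have [T _ [_ _ h]] := algorithm_correct spG inst flowX (erefl _).
by do 3!eexists; apply: h.
Qed.

Local Close Scope ring_scope.
Local Open Scope nat_scope.

(** * Polynomial-time computability *)

Lemma bits_leq n m : 0 < m -> n < 2 ^ m -> bits n <= m.
Proof.
move=> m0 nm; rewrite /bits; case: n nm => [|n] nm; first by rewrite trunc_log0.
by rewrite -(@ltn_exp2l 2) //; apply: leq_ltn_trans (trunc_logP _ _) nm.
Qed.

Lemma ltn_bits n : n < 2 ^ bits n.
Proof. exact: trunc_log_ltn. Qed.

Lemma bits_mono n m : n <= m -> bits n <= bits m.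
Proof. by move=> nm; apply: bits_leq => //; apply: leq_ltn_trans nm (ltn_bits m). Qed.

Lemma bits_mul n m : bits (n * m) <= bits n + bits m.
Proof.
apply: bits_leq => //; rewrite expnD.
by apply: ltn_mul; apply: ltn_bits.
Qed.

Lemma bits_add n m : bits (n + m) <= (maxn (bits n) (bits m)).+1.
Proof.
apply: bits_leq => //; rewrite expnS mul2n -addnn -addSn.
apply: leq_add; first by apply: leq_trans (ltn_bits n) _; rewrite leq_exp2l // leq_maxl.
by apply: ltnW; apply: leq_trans (ltn_bits m) _; rewrite leq_exp2l // leq_maxr.
Qed.

Lemma bits_nat n : bits n <= n.+1.
Proof. by apply: bits_leq => //; apply: leq_trans (ltn_expl n (isT : 1 < 2)) _; rewrite leq_exp2l. Qed.

(** * Bit sizes in rational arithmetic *)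

Section RatBits.
Local Open Scope ring_scope.

Lemma rat_frac (q : rat) (n e : int) : e != 0 -> q = n%:Q / e%:Q ->
  (`|numq q| <= `|n|)%N /\ (`|denq q| <= `|e|)%N.
Proof.
move=> + ->; case: divqP => // j x j0 _; rewrite !abszM.
by split; apply: leq_pmull; rewrite absz_gt0.
Qed.

Lemma numden_add (x y : rat) :
  (`|numq (x + y)| <= `|numq x| * `|denq y| + `|numq y| * `|denq x|)%N /\
  (`|denq (x + y)| <= `|denq x| * `|denq y|)%N.
Proof.
have [||h1 h2] := @rat_frac (x + y) (numq x * denq y + numq y * denq x) (denq x * denq y).
- by rewrite mulf_neq0 ?denq_neq0.
- rewrite -{1}(divq_num_den x) -{1}(divq_num_den y) !rmorphD /= !rmorphM /=.
  by rewrite addf_div ?intr_eq0 ?denq_neq0.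
rewrite -!abszM; split=> //; apply: leq_trans h1 _.
by move: (numq x * _) (numq y * _) => a b; lia.
Qed.

Lemma numden_mul (x y : rat) :
  (`|numq (x * y)| <= `|numq x| * `|numq y|)%N /\
  (`|denq (x * y)| <= `|denq x| * `|denq y|)%N.
Proof.
have [||h1 h2] := @rat_frac (x * y) (numq x * numq y) (denq x * denq y).
- by rewrite mulf_neq0 ?denq_neq0.
- by rewrite -{1}(divq_num_den x) -{1}(divq_num_den y) !rmorphM /= mulf_div.
by rewrite -!abszM.
Qed.

Lemma dsize_add x y : (dsize (Num (x + y)) <= 2 * (dsize (Num x) + dsize (Num y)))%N.
Proof.
have [h1 h2] := numden_add x y; rewrite /=.
have := bits_mono h1; have := bits_mono h2.
have := bits_mul `|denq x| `|denq y|; have := bits_add (`|numq x| * `|denq y|) (`|numq y| * `|denq x|).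
have := bits_mul `|numq x| `|denq y|; have := bits_mul `|numq y| `|denq x|.
lia.
Qed.

Lemma dsize_mul x y : (dsize (Num (x * y)) <= 2 * (dsize (Num x) + dsize (Num y)))%N.
Proof.
have [h1 h2] := numden_mul x y; rewrite /=.
have := bits_mono h1; have := bits_mono h2.
have := bits_mul `|denq x| `|denq y|; have := bits_mul `|numq x| `|numq y|.
lia.
Qed.

Lemma dsize_opp x : dsize (Num (- x)) = dsize (Num x).
Proof. by rewrite /= numqN denqN abszN. Qed.

Lemma dsize_inv x : (dsize (Num x^-1) <= dsize (Num x) + 3)%N.
Proof.
have [->|x0] := eqVneq x 0; first by rewrite invr0; lia.
have [||h1 h2] := @rat_frac (x^-1) (denq x) (numq x).
- by rewrite numq_eq0.
- by rewrite -{1}(divq_num_den x) invf_div.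
by rewrite /=; have := bits_mono h1; have := bits_mono h2; lia.
Qed.

(** Iterating [dsize_add] would allow the size to double with every summand. Bounding the bits of
    numerator and denominator separately against the size of the whole list keeps the growth
    linear. *)
Lemma dsize_sum (s : seq rat) :
  (dsize (Num (\sum_(x <- s) x)) <= 2 * dsize (enc_list [seq Num x | x <- s]))%N.
Proof.
suff [h1 h2] : (bits `|numq (\sum_(x <- s) x)| <= dsize (enc_list [seq Num x | x <- s]))%N /\
    (bits `|denq (\sum_(x <- s) x)| < dsize (enc_list [seq Num x | x <- s]))%N.
  have -> : dsize (Num (\sum_(x <- s) x)) = (bits `|numq (\sum_(x <- s) x)| + bits `|denq (\sum_(x <- s) x)|).+1 by [].
  by rewrite mul2n -addnn -addnS; apply: leq_add h1 h2.
elim: s => [|x s [IH1 IH2]]; first by rewrite big_nil.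
rewrite big_cons; set S := \sum_(x <- s) x in IH1 IH2 *.
have [h1 h2] := numden_add x S; rewrite /=.
set W := dsize _ in IH1 IH2 *.
have := bits_mono h1; have := bits_mono h2.
have := bits_mul `|denq x| `|denq S|; have := bits_add (`|numq x| * `|denq S|) (`|numq S| * `|denq x|).
have := bits_mul `|numq x| `|denq S|; have := bits_mul `|numq S| `|denq x|.
have : (0 < bits `|numq x|)%N by [].
have : (0 < bits `|denq x|)%N by [].
lia.
Qed.

End RatBits.

Lemma dsize_gt0 a : 0 < dsize a. Proof. by case: a. Qed.

Lemma dsize_bool b : dsize (num_of_bool b) <= 5.
Proof. by case: b. Qed.

Lemma dsize_cons a s : dsize (enc_list (a :: s)) = (dsize a + dsize (enc_list s)).+1.
Proof. by []. Qed.

Lemma dsize_list_bound s n : (forall a, List.In a s -> dsize a <= n) ->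
  dsize (enc_list s) <= size s * n.+1 + 3.
Proof.
elim: s => //= a s IH h; have := h a (or_introl erefl).
have := IH (fun b hb => h b (or_intror hb)); nia.
Qed.

Lemma dsize_mem a s : List.In a s -> dsize a < dsize (enc_list s).
Proof.
elim: s => //= b s IH [->|/IH] /=; first by rewrite ltnS leq_addr.
by move=> h; rewrite ltnS (leq_trans (ltnW h)) ?leq_addl.
Qed.

Lemma size_enc_list s : size s < dsize (enc_list s).
Proof. by elim: s => //= a s; have := dsize_gt0 a; lia. Qed.

Lemma leq_expn m n e : m <= n -> m ^ e <= n ^ e.
Proof. by case: e => // e; rewrite leq_exp2r. Qed.

(** * Polynomial bounds and polynomial time between encodings *)

Section Bounds.
Variables (I : Type) (D : I -> Prop) (f : I -> data).

(** A single monomial is as good as a polynomial, because sizes are at least one. *)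
Definition pbound (h : I -> nat) := exists c r, forall x, D x -> h x <= c * dsize (f x) ^ r.

Lemma pb_le h h' : (forall x, D x -> h' x <= h x) -> pbound h -> pbound h'.
Proof. by move=> le [c [r b]]; exists c, r => x Dx; apply: leq_trans (le x Dx) (b x Dx). Qed.

Lemma pb_const n : pbound (fun=> n).
Proof. by exists n, 0 => x _; rewrite expn0 muln1. Qed.

Lemma pb_self : pbound (fun x => dsize (f x)).
Proof. by exists 1, 1 => x _; rewrite mul1n. Qed.

Lemma pb_mul h h' : pbound h -> pbound h' -> pbound (fun x => h x * h' x).
Proof.
case=> [c [r b]] [c' [r' b']]; exists (c * c'), (r + r') => x Dx.
by rewrite expnD mulnACA leq_mul ?b ?b'.
Qed.

Lemma pb_add h h' : pbound h -> pbound h' -> pbound (fun x => h x + h' x).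
Proof.
case=> [c [r b]] [c' [r' b']]; exists (c + c'), (r + r') => x Dx.
rewrite mulnDl; apply: leq_add.
  by apply: leq_trans (b x Dx) _; rewrite leq_mul2l leq_pexp2l ?dsize_gt0 ?leq_addr ?orbT.
by apply: leq_trans (b' x Dx) _; rewrite leq_mul2l leq_pexp2l ?dsize_gt0 ?leq_addl ?orbT.
Qed.

Lemma pb_exp h n : pbound h -> pbound (fun x => h x ^ n).
Proof.
move=> b; elim: n => [|n IH]; first exact: pb_const.
by apply: pb_le (pb_mul b IH) => x _; rewrite expnS.
Qed.

(* Index types range over mathematical objects, so that [f] and [g] are encodings of typed
   values and partiality is expressed by [D]. *)
Definition ptime (g : I -> data) := exists P c r, forall x, D x ->
  exists2 t, runs P (f x) t (g x) & t <= c * dsize (f x) ^ r.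

Lemma ptimeI P g h : pbound h ->
  (forall x, D x -> exists2 t, runs P (f x) t (g x) & t <= h x) -> ptime g.
Proof.
move=> [c [r b]] run; exists P, c, r => x Dx; have [t rt le] := run x Dx.
by exists t => //; apply: leq_trans le (b x Dx).
Qed.

Lemma ptimeE g : ptime g -> exists P, exists2 h, pbound h &
  forall x, D x -> exists2 t, runs P (f x) t (g x) & t <= h x.
Proof.
move=> [P [c [r run]]]; exists P, (fun x => c * dsize (f x) ^ r); last exact: run.
by exists c, r.
Qed.

End Bounds.

(** Lets a time bound serve as a bound on the output size, which makes [ptime] closed under
    composition. *)
Lemma runs_dsize P a t b : runs P a t b -> dsize a <= t /\ dsize b <= t.
Proof. by elim=> {P a t b} *; rewrite /=; lia. Qed.

Section Combinators.
Variables (I : Type) (D : I -> Prop).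
Implicit Types (f g h : I -> data) (b : I -> bool).

Lemma pb_trans f g (n : I -> nat) : pbound D f (fun x => dsize (g x)) -> pbound D g n -> pbound D f n.
Proof.
move=> bg [c [r bn]]; apply: pb_le (pb_mul (pb_const _ _ c) (pb_exp r bg)) => x Dx.
exact: bn.
Qed.

Lemma pb_ptime f g : ptime D f g -> pbound D f (fun x => dsize (g x)).
Proof.
case/ptimeE=> P [h bh run]; apply: pb_le bh => x Dx; have [t rt le] := run x Dx.
by apply: leq_trans le; have [] := runs_dsize rt.
Qed.

Lemma pt_ext f g g' : ptime D f g -> (forall x, D x -> g x = g' x) -> ptime D f g'.
Proof.
move=> [P [c [r run]]] e; exists P, c, r => x Dx.
by rewrite -e //; apply: run.
Qed.

Lemma pt_trans g f h : ptime D f g -> ptime D g h -> ptime D f h.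
Proof.
move=> fg gh; have [P [b bb run]] := ptimeE fg; have [Q [b' bb' run']] := ptimeE gh.
apply: (@ptimeI _ _ _ (Seq P Q) _ (fun x => (b x + b' x).+1)).
  apply: pb_le (pb_add (pb_const _ _ 1) (pb_add bb (pb_trans (pb_ptime fg) bb'))) => x _.
  by rewrite add1n.
move=> x Dx; have [t r1 l1] := run x Dx; have [u r2 l2] := run' x Dx.
by exists (t + u).+1; [apply: RunSeq r1 r2 | rewrite ltnS leq_add].
Qed.

Lemma pt_pair f g h : ptime D f g -> ptime D f h -> ptime D f (fun x => Pair (g x) (h x)).
Proof.
move=> fg gh; have [P [b bb run]] := ptimeE fg; have [Q [b' bb' run']] := ptimeE gh.
apply: (@ptimeI _ _ _ (Fork P Q) _ (fun x => (b x + b' x).+1)).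
  by apply: pb_le (pb_add (pb_const _ _ 1) (pb_add bb bb')) => x _; rewrite add1n.
move=> x Dx; have [t r1 l1] := run x Dx; have [u r2 l2] := run' x Dx.
by exists (t + u).+1; [apply: RunFork r1 r2 | rewrite ltnS leq_add].
Qed.

Lemma pt_prim p c f : (forall x, D x -> dsize (prim_eval p (f x)) <= c * dsize (f x)) ->
  ptime D f (fun x => prim_eval p (f x)).
Proof.
move=> le; apply: (@ptimeI _ _ _ (Prim p) _ (fun x => dsize (f x) + c * dsize (f x))).
  by apply: pb_add; [apply: pb_self | apply: pb_mul; [apply: pb_const | apply: pb_self]].
move=> x Dx; exists (dsize (f x) + dsize (prim_eval p (f x))); first exact: RunPrim.
by rewrite leq_add2l le.
Qed.

Lemma pt_id f : ptime D f f.
Proof. by apply: pt_ext (@pt_prim Id 1 f _) _ => x _ //=; rewrite mul1n. Qed.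

Lemma pt_const q f : ptime D f (fun=> Num q).
Proof.
apply: pt_ext (@pt_prim (Const q) (dsize (Num q)) f _) _ => x _ //.
by rewrite -[X in X <= _]muln1 leq_mul2l dsize_gt0 orbT.
Qed.

Lemma pt_fst f g h : ptime D f (fun x => Pair (g x) (h x)) -> ptime D f g.
Proof.
move=> fgh; apply: pt_trans fgh _.
by apply: pt_ext (@pt_prim Fst 1 (fun x => Pair (g x) (h x)) _) _ => x _ //=; lia.
Qed.

Lemma pt_snd f g h : ptime D f (fun x => Pair (g x) (h x)) -> ptime D f h.
Proof.
move=> fgh; apply: pt_trans fgh _.
by apply: pt_ext (@pt_prim Snd 1 (fun x => Pair (g x) (h x)) _) _ => x _ //=; lia.
Qed.

Lemma pt_add f (u v : I -> rat) : ptime D f (fun x => Num (u x)) -> ptime D f (fun x => Num (v x)) ->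
  ptime D f (fun x => Num (u x + v x)%R).
Proof.
move=> fu fv; apply: pt_trans (pt_pair fu fv) _.
apply: pt_ext (@pt_prim Add 2 (fun x => Pair (Num (u x)) (Num (v x))) _) _ => x _ //.
apply: leq_trans (dsize_add _ _) _; rewrite leq_mul2l /=; lia.
Qed.

Lemma pt_mul f (u v : I -> rat) : ptime D f (fun x => Num (u x)) -> ptime D f (fun x => Num (v x)) ->
  ptime D f (fun x => Num (u x * v x)%R).
Proof.
move=> fu fv; apply: pt_trans (pt_pair fu fv) _.
apply: pt_ext (@pt_prim Mul 2 (fun x => Pair (Num (u x)) (Num (v x))) _) _ => x _ //.
apply: leq_trans (dsize_mul _ _) _; rewrite leq_mul2l /=; lia.
Qed.

Lemma pt_opp f (u : I -> rat) : ptime D f (fun x => Num (u x)) -> ptime D f (fun x => Num (- u x)%R).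
Proof.
move=> fu; apply: pt_trans fu _.
apply: pt_ext (@pt_prim Opp 1 (fun x => Num (u x)) _) _ => x _ //.
by rewrite /prim_eval dsize_opp mul1n.
Qed.

Lemma pt_sub f (u v : I -> rat) : ptime D f (fun x => Num (u x)) -> ptime D f (fun x => Num (v x)) ->
  ptime D f (fun x => Num (u x - v x)%R).
Proof. by move=> fu /pt_opp; apply: pt_add. Qed.

Lemma pt_inv f (u : I -> rat) : ptime D f (fun x => Num (u x)) -> ptime D f (fun x => Num (u x)^-1%R).
Proof.
move=> fu; apply: pt_trans fu _.
apply: pt_ext (@pt_prim Inv 4 (fun x => Num (u x)) _) _ => x _ //.
by apply: leq_trans (dsize_inv _) _; have := dsize_gt0 (Num (u x)); lia.
Qed.

Lemma pt_div f (u v : I -> rat) : ptime D f (fun x => Num (u x)) -> ptime D f (fun x => Num (v x)) ->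
  ptime D f (fun x => Num (u x / v x)%R).
Proof. by move=> fu /pt_inv; apply: pt_mul. Qed.

Definition pbool f b := ptime D f (fun x => num_of_bool (b x)).

Lemma pt_le f (u v : I -> rat) : ptime D f (fun x => Num (u x)) -> ptime D f (fun x => Num (v x)) ->
  pbool f (fun x => (u x <= v x)%R).
Proof.
move=> fu fv; apply: pt_trans (pt_pair fu fv) _.
apply: pt_ext (@pt_prim Le 7 (fun x => Pair (Num (u x)) (Num (v x))) _) _ => x _ //.
by apply: leq_trans (dsize_bool _) _; have := dsize_gt0 (Pair (Num (u x)) (Num (v x))); lia.
Qed.

Lemma pt_ispair f (u : I -> data) : ptime D f u ->
  pbool f (fun x => if u x is Pair _ _ then true else false).
Proof.
move=> fu; apply: pt_trans fu _.
apply: pt_ext (@pt_prim IsPair 7 u _) _ => x _; last by case: (u x).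
have h : dsize (prim_eval IsPair (u x)) <= 5 by case: (u x) => [q|a b]; apply: dsize_bool.
by apply: leq_trans h _; have := dsize_gt0 (u x); lia.
Qed.

End Combinators.

Lemma pt_reindex (I J : Type) (D : I -> Prop) (D' : J -> Prop) (f g : I -> data) (f' g' : J -> data) :
  ptime D f g ->
  (forall y, D' y -> exists x, [/\ D x, f x = f' y & g x = g' y]) -> ptime D' f' g'.
Proof.
move=> [P [c [r run]]] e; exists P, c, r => y Dy; have [x [Dx <- <-]] := e y Dy.
exact: run.
Qed.

Lemma pb_reindex (I J : Type) (D : I -> Prop) (D' : J -> Prop) f h f' h' :
  pbound D f h -> (forall y, D' y -> exists x, [/\ D x, f x = f' y & h x = h' y]) -> pbound D' f' h'.
Proof.
move=> [c [r b]] e; exists c, r => y Dy; have [x [Dx <- <-]] := e y Dy.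
exact: b.
Qed.

Section If.
Variables (I : Type) (D : I -> Prop).

Lemma pt_if f (b : I -> bool) g h : pbool D f b ->
  ptime (fun x => D x /\ b x) f g -> ptime (fun x => D x /\ ~~ b x) f h ->
  ptime D f (fun x => if b x then g x else h x).
Proof.
move=> /ptimeE[P [n bn run]] [Q [c [r runQ]]] [S [c' [r' runS]]].
apply: (@ptimeI _ _ _ (If P Q S) _
  (fun x => (n x + (c * dsize (f x) ^ r + c' * dsize (f x) ^ r')).+1)).
  apply: pb_le (pb_add (pb_const _ _ 1) (pb_add bn (pb_add
    (pb_mul (pb_const _ _ c) (pb_exp r (pb_self _ _)))
    (pb_mul (pb_const _ _ c') (pb_exp r' (pb_self _ _)))))) => x _.
  by rewrite add1n.
move=> x Dx; have [t r1 l1] := run x Dx; case: (boolP (b x)) r1 => bx r1.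
  have [u r2 l2] := runQ x (conj Dx bx).
  exists (t + u).+1; first by apply: RunIfTrue r1 _ r2.
  by rewrite ltnS leq_add // (leq_trans l2) ?leq_addr.
have [u r2 l2] := runS x (conj Dx bx).
exists (t + u).+1; first by apply: RunIfFalse r1 _ r2.
by rewrite ltnS leq_add // (leq_trans l2) ?leq_addl.
Qed.

Lemma pt_not f b : pbool D f b -> pbool D f (fun x => ~~ b x).
Proof.
move=> fb; apply: pt_ext (pt_if fb (pt_const _ 0%R _) (pt_const _ 1%R _)) _ => x _.
by case: (b x).
Qed.

Lemma pt_and f b b' : pbool D f b -> pbool (fun x => D x /\ b x) f b' ->
  pbool D f (fun x => b x && b' x).
Proof.
move=> fb fb'; apply: pt_ext (pt_if fb fb' (pt_const _ 0%R _)) _ => x _.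
by case: (b x).
Qed.

Lemma pt_or f b b' : pbool D f b -> pbool (fun x => D x /\ ~~ b x) f b' ->
  pbool D f (fun x => b x || b' x).
Proof.
move=> fb fb'; apply: pt_ext (pt_if fb (pt_const _ 1%R _) fb') _ => x _.
by case: (b x).
Qed.

Lemma pt_weaken (D' : I -> Prop) f g : ptime D f g -> (forall x, D' x -> D x) -> ptime D' f g.
Proof. by move=> h s; apply: pt_reindex h _ => x Dx; exists x; split=> //; apply: s. Qed.

Lemma pt_eqrat f (u v : I -> rat) : ptime D f (fun x => Num (u x)) -> ptime D f (fun x => Num (v x)) ->
  pbool D f (fun x => u x == v x).
Proof.
move=> fu fv.
have fvu : pbool (fun x => D x /\ (u x <= v x)%R) f (fun x => (v x <= u x)%R).
  by apply: pt_weaken (pt_le fv fu) _ => x [].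
by apply: pt_ext (pt_and (pt_le fu fv) fvu) _ => x _; rewrite eq_le.
Qed.

Lemma pt_eqnat f (u v : I -> nat) :
  ptime D f (fun x => enc_nat (u x)) -> ptime D f (fun x => enc_nat (v x)) ->
  pbool D f (fun x => u x == v x).
Proof. by move=> fu fv; apply: pt_ext (pt_eqrat fu fv) _ => x _; rewrite eqr_nat. Qed.

End If.

Section While.
Variables (I : Type) (D : I -> Prop) (s : I -> nat -> data) (N : I -> nat).

(** Polynomially many rounds of a polynomial body may still blow up, since each round starts from
    the previous result. The last premise therefore bounds all states in terms of the initial one,
    which makes every round cost at most [K x]. *)
Lemma pt_while :
  ptime (fun p : I * nat => D p.1 /\ p.2 < N p.1) (fun p => s p.1 p.2) (fun p => s p.1 p.2.+1) ->
  pbool (fun p : I * nat => D p.1 /\ p.2 <= N p.1) (fun p => s p.1 p.2) (fun p => p.2 < N p.1) ->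
  pbound D (s^~ 0) N ->
  pbound (fun p : I * nat => D p.1 /\ p.2 <= N p.1) (fun p => s p.1 0) (fun p => dsize (s p.1 p.2)) ->
  ptime D (s^~ 0) (fun x => s x (N x)).
Proof.
move=> [P [c1 [r1 body]]] [Q [c2 [r2 cond]]] bN [c3 [r3 bs]].
pose S x := c3 * dsize (s x 0) ^ r3.
pose K x := (c1 * S x ^ r1 + c2 * S x ^ r2).+1.
have bS : pbound D (s^~ 0) S by exists c3, r3.
have bK : pbound D (s^~ 0) K.
  apply: pb_le (pb_add (pb_const _ _ 1) (pb_add (pb_mul (pb_const _ _ c1) (pb_exp r1 bS))
    (pb_mul (pb_const _ _ c2) (pb_exp r2 bS)))) => x _; by rewrite add1n.
apply: (@ptimeI _ _ _ (While Q P) _ (fun x => (N x).+1 * K x)).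
  by apply: pb_le (pb_mul (pb_add (pb_const _ _ 1) bN) bK) => x _; rewrite add1n.
move=> x Dx.
suff aux n : n <= N x -> exists2 t, runs (While Q P) (s x (N x - n)) t (s x (N x)) & t <= n.+1 * K x.
  by have [t] := aux _ (leqnn _); rewrite subnn; exists t.
elim: n => [|n IH] nN.
  have [t rt lt] := cond (x, N x) (conj Dx (leqnn _)); rewrite subn0.
  rewrite /= ltnn in rt lt.
  exists t.+1; first by apply: RunWhileStop rt _.
  rewrite mul1n ltnS; apply: leq_trans lt _; apply: leq_trans (leq_addl _ _).
  by rewrite leq_mul2l leq_expn ?orbT //; apply: (bs (x, N x)).
have lt : N x - n.+1 < N x by lia.
have [t1 rt1 l1] := cond (x, N x - n.+1) (conj Dx (ltnW lt)).
rewrite /= lt in rt1.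
have [t2 rt2 l2] := body (x, N x - n.+1) (conj Dx lt).
have [t3 rt3 l3] := IH (ltnW nN).
rewrite /= in rt2; rewrite (_ : (N x - n.+1).+1 = N x - n) in rt2; last by lia.
exists (t1 + t2 + t3).+1; first exact: RunWhileStep rt1 _ rt2 rt3.
have sz : dsize (s x (N x - n.+1)) <= S x by apply: (bs (x, N x - n.+1)); split=> //=; apply: ltnW.
have l1' : t1 <= c2 * S x ^ r2 by apply: leq_trans l1 _; rewrite leq_mul2l leq_expn ?orbT.
have l2' : t2 <= c1 * S x ^ r1 by apply: leq_trans l2 _; rewrite leq_mul2l leq_expn ?orbT.
by rewrite mulSn -addSn leq_add // /K ltnS addnC leq_add.
Qed.

End While.

Lemma dsize_enc_list s : dsize (enc_list s) = (sumn [seq (dsize a).+1 | a <- s]) + 3.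
Proof. by elim: s => //= a s ->; lia. Qed.

Lemma dsize_enc_cat s s' : dsize (enc_list (s ++ s')) + 3 = dsize (enc_list s) + dsize (enc_list s').
Proof. by rewrite !dsize_enc_list map_cat sumn_cat; lia. Qed.

Lemma dsize_enc_prefix s s' : dsize (enc_list s) <= dsize (enc_list (s ++ s')).
Proof. by have := dsize_enc_cat s s'; have := dsize_enc_list s'; lia. Qed.

Lemma dsize_enc_rev s : dsize (enc_list (rev s)) = dsize (enc_list s).
Proof. by rewrite !dsize_enc_list map_rev sumn_rev. Qed.

Lemma split_at (A : Type) (l : seq A) j : j < size l ->
  exists l1 a l2, l = l1 ++ a :: l2 /\ size l1 = j.
Proof.
elim: l j => // a l IH [_|j /IH[l1 [b [l2 [-> <-]]]]]; first by exists [::], a, l.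
by exists (a :: l1), b, l2.
Qed.

(** Stands in for membership, because [A] carries no decidable equality. *)
Definition occurs (A : Type) (a : A) (l : seq A) := exists l1 l2, l = l1 ++ a :: l2.

(** * List processing in polynomial time *)

Section Lists.
Variables (I : Type) (D : I -> Prop) (ctx : I -> data).

(** The loop carries the context, the unread rest of the list and the accumulator after [j] entries.
    The context stays in the state so that every step can consult it. *)
Lemma pt_fold_data (l : I -> seq data) (acc : I -> nat -> data) :
  ptime D ctx (fun x => enc_list (l x)) -> ptime D ctx (acc^~ 0) ->
  ptime (fun p : I * nat => D p.1 /\ p.2 < size (l p.1))
    (fun p => Pair (ctx p.1) (Pair (nth (Num 0) (l p.1) p.2) (acc p.1 p.2)))
    (fun p => acc p.1 p.2.+1) ->
  pbound (fun p : I * nat => D p.1 /\ p.2 <= size (l p.1)) (fun p => ctx p.1)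
    (fun p => dsize (acc p.1 p.2)) ->
  ptime D ctx (fun x => acc x (size (l x))).
Proof.
move=> hl h0 step bd.
pose s x j := Pair (ctx x) (Pair (enc_list (drop j (l x))) (acc x j)).
have start : ptime D ctx (s^~ 0).
  apply: pt_pair (pt_id _ _) (pt_pair _ h0).
  by apply: pt_ext hl _ => x _; rewrite drop0.
apply: (pt_trans start); apply: (@pt_trans _ _ (fun x => s x (size (l x)))); last first.
  exact: (pt_snd (pt_snd (pt_id _ _))).
apply: (@pt_while I D s (fun x => size (l x))).
- have c : ptime (fun p : I * nat => D p.1 /\ p.2 < size (l p.1)) (fun p => s p.1 p.2) (fun p => ctx p.1).
    exact: pt_fst (pt_id _ _).
  have r : ptime (fun p : I * nat => D p.1 /\ p.2 < size (l p.1)) (fun p => s p.1 p.2)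
      (fun p => Pair (nth (Num 0) (l p.1) p.2) (enc_list (drop p.2.+1 (l p.1)))).
    apply: pt_ext (pt_fst (pt_snd (pt_id _ _))) _ => -[x j] [_ /= jl].
    by rewrite (drop_nth (Num 0) jl).
  have a : ptime (fun p : I * nat => D p.1 /\ p.2 < size (l p.1)) (fun p => s p.1 p.2)
      (fun p => acc p.1 p.2).
    exact: pt_snd (pt_snd (pt_id _ _)).
  apply: (pt_pair c (pt_pair (pt_snd r) _)).
  exact: pt_trans (pt_pair c (pt_pair (pt_fst r) a)) step.
- apply: pt_ext (pt_ispair (pt_fst (pt_snd (pt_id _ _)))) _ => -[x j] [_ /= jl].
  case: ltnP => jl'; first by rewrite (drop_nth (Num 0) jl').
  by rewrite drop_oversize.
- apply: pb_le (pb_self _ _) => x _; rewrite /s drop0 /=.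
  by have := size_enc_list (l x); lia.
- have b1 : pbound (fun p : I * nat => D p.1 /\ p.2 <= size (l p.1)) (fun p => s p.1 0) (fun p => dsize (ctx p.1)).
    by apply: pb_le (pb_self _ _) => p _ /=; lia.
  apply: pb_le (pb_add (pb_self _ _) (pb_trans b1 bd)) => -[x j] _ /=.
  rewrite drop0; have := dsize_enc_cat (take j (l x)) (drop j (l x)).
  have := dsize_enc_list (take j (l x)).
  by rewrite cat_take_drop; lia.
Qed.

(** The step is judged only at states the fold actually reaches, so facts about prefixes of [l x]
    are available there. The types depend on [x] because arcs and commodities are ordinals of the
    instance. *)
Lemma pt_foldl (A B : I -> Type) (l : forall x, seq (A x)) (ea : forall x, A x -> data)
    (b0 : forall x, B x) (eb : forall x, B x -> data) (f : forall x, B x -> A x -> B x) (h : I -> nat) :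
  ptime D ctx (fun x => enc_list (map (@ea x) (l x))) ->
  ptime D ctx (fun x => eb x (b0 x)) ->
  ptime (fun p : {x : I & (B x * A x)%type} => D (projT1 p) /\ exists l1 l2,
      l (projT1 p) = l1 ++ (projT2 p).2 :: l2 /\ (projT2 p).1 = foldl (@f _) (b0 _) l1)
    (fun p => Pair (ctx (projT1 p)) (Pair (ea _ (projT2 p).2) (eb _ (projT2 p).1)))
    (fun p => eb _ (f _ (projT2 p).1 (projT2 p).2)) ->
  pbound D ctx h ->
  (forall x l1 l2, D x -> l x = l1 ++ l2 -> dsize (eb x (foldl (@f x) (b0 x) l1)) <= h x) ->
  ptime D ctx (fun x => eb x (foldl (@f x) (b0 x) (l x))).
Proof.
move=> hl hb step bh le.
pose acc x j := eb x (foldl (@f x) (b0 x) (take j (l x))).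
suff hacc : ptime D ctx (fun x => acc x (size (map (@ea x) (l x)))).
  by apply: pt_ext hacc _ => x _; rewrite /acc size_map take_size.
apply: (@pt_fold_data (fun x => map (@ea x) (l x)) acc) => //.
- by apply: pt_ext hb _ => x _; rewrite /acc take0.
- apply: pt_reindex step _ => -[x j] [Dx /=]; rewrite size_map => jl.
  have [l1 [a [l2 [e sl]]]] := split_at jl.
  exists (existT _ x (foldl (@f x) (b0 x) l1, a)) => /=; split.
  + by split=> //; exists l1, l2.
  + by rewrite /acc e map_cat nth_cat size_map sl ltnn subnn /= -sl take_size_cat.
  + by rewrite /acc e -cat_rcons take_size_cat ?size_rcons ?sl // foldl_rcons.
- have bh' : pbound (fun p : I * nat => D p.1 /\ p.2 <= size (map (@ea p.1) (l p.1)))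
      (fun p => ctx p.1) (fun p => h p.1).
    by apply: pb_reindex bh _ => -[x j] [Dx _]; exists x.
  apply: pb_le bh' => -[x j] [Dx _] /=.
  by apply: (le x _ (drop j (l x))) => //; rewrite cat_take_drop.
Qed.

Lemma pt_nil : ptime D ctx (fun=> enc_list [::]).
Proof. exact: pt_const. Qed.

Lemma pt_catrev (l l' : I -> seq data) :
  ptime D ctx (fun x => enc_list (l x)) -> ptime D ctx (fun x => enc_list (l' x)) ->
  ptime D ctx (fun x => enc_list (catrev (l x) (l' x))).
Proof.
move=> hl hl'.
have H : ptime D ctx (fun x => enc_list (foldl (fun b a => a :: b) (l' x) (l x))).
  apply: (@pt_foldl (fun=> data) (fun=> seq data) l (fun=> id) l' (fun=> enc_list) (fun _ b a => a :: b)
    (fun x => dsize (enc_list (l x)) + dsize (enc_list (l' x)))) => //.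
  - by apply: pt_ext hl _ => x _; rewrite map_id.
  - exact: pt_snd (pt_id _ _).
  - by apply: pb_add; apply: pb_ptime.
  - move=> x l1 l2 _ e; have -> : foldl (fun b a => a :: b) (l' x) l1 = catrev l1 (l' x).
      by elim: l1 (l' x) {e} => //= a l1 IH u; rewrite IH.
    have := dsize_enc_cat (rev l1) (l' x); rewrite -catrevE dsize_enc_rev.
    by have := dsize_enc_cat l1 l2; have := dsize_enc_list l2; rewrite -e; lia.
apply: pt_ext H _ => x _; congr enc_list.
by elim: (l x) (l' x) => //= a l1 IH u; rewrite IH.
Qed.

Lemma pt_rev (l : I -> seq data) :
  ptime D ctx (fun x => enc_list (l x)) -> ptime D ctx (fun x => enc_list (rev (l x))).
Proof. by move=> hl; apply: (pt_catrev hl pt_nil). Qed.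

Lemma pt_cat (l l' : I -> seq data) :
  ptime D ctx (fun x => enc_list (l x)) -> ptime D ctx (fun x => enc_list (l' x)) ->
  ptime D ctx (fun x => enc_list (l x ++ l' x)).
Proof.
move=> /pt_rev hl hl'; apply: pt_ext (pt_catrev hl hl') _ => x _.
by rewrite catrevE revK.
Qed.

Lemma pt_cons (a : I -> data) (l : I -> seq data) :
  ptime D ctx a -> ptime D ctx (fun x => enc_list (l x)) ->
  ptime D ctx (fun x => enc_list (a x :: l x)).
Proof. exact: pt_pair. Qed.

Lemma pt_nilp (l : I -> seq data) :
  ptime D ctx (fun x => enc_list (l x)) -> pbool D ctx (fun x => nilp (l x)).
Proof.
move=> hl; apply: pt_ext (pt_not (pt_ispair hl)) _ => x _.
by case: (l x).
Qed.

Lemma pt_behead (l : I -> seq data) :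
  ptime D ctx (fun x => enc_list (l x)) -> ptime D ctx (fun x => enc_list (behead (l x))).
Proof.
move=> hl; apply: (pt_trans hl).
apply: pt_ext (@pt_prim I D Snd 1 (fun x => enc_list (l x)) _) _ => x _; last by case: (l x).
by case: (l x) => //= a s; rewrite mul1n; lia.
Qed.

Lemma pt_head (l : I -> seq data) (a : I -> data) :
  ptime D ctx (fun x => enc_list (l x)) -> (forall x, D x -> l x = a x :: behead (l x)) ->
  ptime D ctx a.
Proof.
move=> hl e; apply: (@pt_fst _ _ _ _ (fun x => enc_list (behead (l x)))).
by apply: pt_ext hl _ => x Dx; rewrite {1}e.
Qed.

(** A fold collects the results in reverse. Their sizes are bounded by applying the polynomial of
    [g] to the context and the whole list, which is larger than each of its entries. *)
Lemma pt_filter_map (A : I -> Type) (l : forall x, seq (A x)) (ea : forall x, A x -> data)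
    (p : forall x, A x -> bool) (g : forall x, A x -> data) :
  ptime D ctx (fun x => enc_list (map (@ea x) (l x))) ->
  pbool (fun y : {x : I & A x} => D (projT1 y) /\ occurs (projT2 y) (l (projT1 y)))
    (fun y => Pair (ctx (projT1 y)) (ea _ (projT2 y))) (fun y => p _ (projT2 y)) ->
  ptime (fun y : {x : I & A x} => (D (projT1 y) /\ occurs (projT2 y) (l (projT1 y))) /\ p _ (projT2 y))
    (fun y => Pair (ctx (projT1 y)) (ea _ (projT2 y))) (fun y => g _ (projT2 y)) ->
  ptime D ctx (fun x => enc_list [seq g x a | a <- l x & p x a]).
Proof.
move=> hl hp hg.
pose f x (b : seq data) (a : A x) := if p x a then g x a :: b else b.
have foldE x l1 b : foldl (@f x) b l1 = rev [seq g x a | a <- l1 & p x a] ++ b.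
  elim: l1 b => //= a l1 IH b; rewrite IH /f; case: ifP => //= _.
  by rewrite rev_cons cat_rcons.
suff H : ptime D ctx (fun x => enc_list (foldl (@f x) [::] (l x))).
  by apply: pt_ext (pt_rev H) _ => x _; rewrite foldE cats0 revK.
have [h bh le] : exists2 h, pbound D ctx h &
    forall x a, D x -> occurs a (l x) -> p x a -> dsize (g x a) <= h x.
  have [c [r b]] := pb_ptime hg.
  exists (fun x => c * (dsize (ctx x) + dsize (enc_list (map (@ea x) (l x)))).+1 ^ r).
    apply: pb_mul; first exact: pb_const.
    apply: pb_exp; apply: pb_le (pb_add (pb_const _ _ 1) (pb_add (pb_self _ _) (pb_ptime hl))) => x _.
    by rewrite add1n.
  move=> x a Dx oa pa; have := b (existT _ x a) (conj (conj Dx oa) pa) => /= {}b.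
  apply: leq_trans b _; rewrite leq_mul2l leq_expn ?orbT // ltnS leq_add2l.
  apply: ltnW; apply: dsize_mem; case: oa => l1 [l2 ->].
  by rewrite map_cat; apply/List.in_or_app; right; left.
apply: (@pt_foldl A (fun=> seq data) l ea (fun=> [::]) (fun=> enc_list) f
  (fun x => dsize (enc_list (map (@ea x) (l x))) * (h x).+1 + 3)) => //.
- exact: pt_nil.
- pose DJ := fun q : {x : I & (seq data * A x)%type} => D (projT1 q) /\ exists l1 l2,
    l (projT1 q) = l1 ++ (projT2 q).2 :: l2 /\ (projT2 q).1 = foldl (@f _) [::] l1.
  have occ q : DJ q -> D (projT1 q) /\ occurs (projT2 q).2 (l (projT1 q)).
    by case=> Dx [l1 [l2 [e _]]]; split=> //; exists l1, l2.
  have arg (D' : {x : I & (seq data * A x)%type} -> Prop) : ptime D'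
     (fun q => Pair (ctx (projT1 q)) (Pair (ea _ (projT2 q).2) (enc_list (projT2 q).1)))
     (fun q => Pair (ctx (projT1 q)) (ea _ (projT2 q).2)).
    exact: (pt_pair (pt_fst (pt_id _ _)) (pt_fst (pt_snd (pt_id _ _)))).
  have acc (D' : {x : I & (seq data * A x)%type} -> Prop) : ptime D'
     (fun q => Pair (ctx (projT1 q)) (Pair (ea _ (projT2 q).2) (enc_list (projT2 q).1)))
     (fun q => enc_list (projT2 q).1).
    exact: pt_snd (pt_snd (pt_id _ _)).
  have Hif := @pt_if _ DJ _ (fun q => p _ (projT2 q).2)
    (fun q => enc_list (g _ (projT2 q).2 :: (projT2 q).1)) (fun q => enc_list (projT2 q).1).
  apply: pt_ext (Hif _ _ _ _) _.
  + apply: (pt_trans (arg _)); apply: pt_reindex hp _ => -[x [b a]] /occ /= o.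
    by exists (existT _ x a).
  + apply: pt_pair (acc _); apply: (pt_trans (arg _)).
    apply: pt_reindex hg _ => -[x [b a]] [/occ /= o pa].
    by exists (existT _ x a).
  + exact: acc.
  + by move=> [x [b a]] _ /=; rewrite /f; case: ifP.
- apply: pb_add; last exact: pb_const.
  apply: pb_mul; first exact: pb_ptime.
  by apply: pb_le (pb_add (pb_const _ _ 1) bh) => x _; rewrite add1n.
- move=> x l1 l2 Dx e; rewrite foldE cats0 dsize_enc_rev.
  apply: leq_trans (@dsize_list_bound _ (h x) _) _.
    move=> a /List.in_map_iff[b [<- /List.filter_In[bl pb]]]; apply: le => //.
    by have [u [v e']] := List.in_split _ _ bl; exists u, (v ++ l2); rewrite e e' -catA.
  rewrite leq_add2r leq_mul2r /=; apply: ltnW.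
  apply: leq_ltn_trans (size_enc_list _); rewrite !size_map e size_cat.
  by rewrite size_filter (leq_trans (count_size _ _)) ?leq_addr.
Qed.

Lemma pt_map (A : I -> Type) (l : forall x, seq (A x)) (ea : forall x, A x -> data)
    (g : forall x, A x -> data) :
  ptime D ctx (fun x => enc_list (map (@ea x) (l x))) ->
  ptime (fun y : {x : I & A x} => D (projT1 y) /\ occurs (projT2 y) (l (projT1 y)))
    (fun y => Pair (ctx (projT1 y)) (ea _ (projT2 y))) (fun y => g _ (projT2 y)) ->
  ptime D ctx (fun x => enc_list [seq g x a | a <- l x]).
Proof.
move=> hl hg; apply: pt_ext (@pt_filter_map A l ea (fun _ _ => true) g hl _ _) _.
- exact: pt_const.
- by apply: pt_weaken hg _ => x [].
- by move=> x _; rewrite filter_predT.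
Qed.

Lemma pt_filter (A : I -> Type) (l : forall x, seq (A x)) (ea : forall x, A x -> data)
    (p : forall x, A x -> bool) :
  ptime D ctx (fun x => enc_list (map (@ea x) (l x))) ->
  pbool (fun y : {x : I & A x} => D (projT1 y) /\ occurs (projT2 y) (l (projT1 y)))
    (fun y => Pair (ctx (projT1 y)) (ea _ (projT2 y))) (fun y => p _ (projT2 y)) ->
  ptime D ctx (fun x => enc_list (map (@ea x) [seq a <- l x | p x a])).
Proof.
move=> hl hp; apply: (@pt_filter_map A l ea p ea hl hp).
exact: pt_snd (pt_id _ _).
Qed.

Lemma pt_has (A : I -> Type) (l : forall x, seq (A x)) (ea : forall x, A x -> data)
    (p : forall x, A x -> bool) :
  ptime D ctx (fun x => enc_list (map (@ea x) (l x))) ->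
  pbool (fun y : {x : I & A x} => D (projT1 y) /\ occurs (projT2 y) (l (projT1 y)))
    (fun y => Pair (ctx (projT1 y)) (ea _ (projT2 y))) (fun y => p _ (projT2 y)) ->
  pbool D ctx (fun x => has (p x) (l x)).
Proof.
move=> hl hp; apply: pt_ext (pt_not (pt_nilp (pt_filter hl hp))) _ => x _.
by rewrite /nilp size_map size_filter has_count lt0n.
Qed.

Lemma pt_sum (s : I -> seq rat) :
  ptime D ctx (fun x => enc_list (map Num (s x))) -> ptime D ctx (fun x => Num (\sum_(q <- s x) q)%R).
Proof.
move=> hs; pose f (b a : rat) := (a + b)%R.
have foldE l b : foldl f b l = (b + \sum_(q <- l) q)%R.
  elim: l b => [|a l IH] b /=; first by rewrite big_nil addr0.
  by rewrite IH big_cons addrCA addrA.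
have H : ptime D ctx (fun x => Num (foldl f 0%R (s x))).
  apply: (@pt_foldl (fun=> rat) (fun=> rat) s (fun=> Num) (fun=> 0%R) (fun=> Num) (fun=> f)
    (fun x => 2 * dsize (enc_list (map Num (s x))))) => //.
  - exact: pt_const.
  - apply: pt_add; first exact: pt_fst (pt_snd (pt_id _ _)).
    exact: pt_snd (pt_snd (pt_id _ _)).
  - by apply: pb_mul; [apply: pb_const | apply: pb_ptime].
  - move=> x l1 l2 _ e; rewrite foldE add0r; apply: leq_trans (dsize_sum _) _.
    by rewrite e map_cat leq_mul2l dsize_enc_prefix.
by apply: pt_ext H _ => x _; rewrite foldE add0r.
Qed.

Lemma pt_zip (A : I -> Type) (s : forall x, seq (A x)) (f g : forall x, A x -> data) :
  ptime D ctx (fun x => enc_list (map (@f x) (s x))) ->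
  ptime D ctx (fun x => enc_list (map (@g x) (s x))) ->
  ptime D ctx (fun x => enc_list [seq Pair (f x a) (g x a) | a <- s x]).
Proof.
move=> hf hg; pose pr x (a : A x) := Pair (f x a) (g x a).
pose acc x j := Pair (enc_list (drop j (map (@g x) (s x)))) (enc_list (rev (map (@pr x) (take j (s x))))).
have H : ptime D ctx (fun x => acc x (size (map (@f x) (s x)))).
  apply: (@pt_fold_data (fun x => map (@f x) (s x)) acc hf).
  - apply: pt_pair; first by apply: pt_ext hg _ => x _; rewrite drop0.
    by apply: pt_ext pt_nil _ => x _; rewrite take0.
  - set src := (X in ptime _ X _); set dom := (X in ptime X _ _).
    have a0 : ptime dom src (fun q => nth (Num 0) (map (@f q.1) (s q.1)) q.2).
      exact: pt_fst (pt_snd (pt_id _ _)).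
    have a1 : ptime dom src (fun q => Pair (nth (Num 0) (map (@g q.1) (s q.1)) q.2)
        (enc_list (drop q.2.+1 (map (@g q.1) (s q.1))))).
      apply: pt_ext (pt_fst (pt_snd (pt_snd (pt_id _ _)))) _ => -[x j] [_ /=].
      by rewrite size_map => jl; rewrite (drop_nth (Num 0)) ?size_map.
    have a2 : ptime dom src (fun q => enc_list (rev (map (@pr q.1) (take q.2 (s q.1))))).
      exact: pt_snd (pt_snd (pt_snd (pt_id _ _))).
    apply: pt_ext (pt_pair (pt_snd a1) (pt_pair (pt_pair a0 (pt_fst a1)) a2)) _ => -[x j] [_ /=].
    rewrite size_map => /split_at[l1 [a [l2 [e sl]]]]; rewrite /acc; congr Pair.
    have t1 : take j (s x) = l1 by rewrite e -sl take_size_cat.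
    have t2 : take j.+1 (s x) = rcons l1 a by rewrite e -cat_rcons take_size_cat // size_rcons sl.
    by rewrite t1 t2 e !map_cat !nth_cat !size_map sl ltnn subnn /= map_rcons rev_rcons.
  - have b0 : pbound D ctx (fun x => dsize (enc_list (map (@g x) (s x))) + dsize (enc_list (map (@f x) (s x)))
        + dsize (enc_list (map (@g x) (s x))) + 1).
      by do !apply: pb_add; try exact: pb_ptime; exact: pb_const.
    have b1 : pbound (fun q : I * nat => D q.1) (fun q => ctx q.1) (fun q =>
        dsize (enc_list (map (@g q.1) (s q.1))) + dsize (enc_list (map (@f q.1) (s q.1)))
        + dsize (enc_list (map (@g q.1) (s q.1))) + 1).
      by apply: pb_reindex b0 _ => -[x j] /= Dx; exists x.
    case: b1 => c [r b1]; exists c, r => -[x j] [/= Dx _].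
    apply: leq_trans (b1 (x, j) Dx) => /=.
    rewrite dsize_enc_rev.
    have := dsize_enc_cat (take j (map (@g x) (s x))) (drop j (map (@g x) (s x))).
    rewrite cat_take_drop; have := dsize_enc_list (take j (map (@g x) (s x))).
    have : dsize (enc_list (map (@pr x) (take j (s x)))) <=
        dsize (enc_list (map (@f x) (s x))) + dsize (enc_list (map (@g x) (s x))).
      rewrite -{2 3}(cat_take_drop j (s x)) !map_cat.
      have := dsize_enc_cat (map (@f x) (take j (s x))) (map (@f x) (drop j (s x))).
      have := dsize_enc_cat (map (@g x) (take j (s x))) (map (@g x) (drop j (s x))).
      have := dsize_enc_list (map (@f x) (drop j (s x))).
      have := dsize_enc_list (map (@g x) (drop j (s x))).
      have : dsize (enc_list (map (@pr x) (take j (s x)))) + 3 =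
         dsize (enc_list (map (@f x) (take j (s x)))) + dsize (enc_list (map (@g x) (take j (s x)))).
        by elim: (take j (s x)) => //= a l IH; lia.
      by lia.
    by lia.
apply: pt_ext (pt_rev (pt_snd H)) _ => x _.
by rewrite revK size_map take_size.
Qed.

(** Indices of arcs and commodities occur in the input only as positions; counting along a list
    recovers them. *)
Lemma pt_iota (l : I -> seq data) :
  ptime D ctx (fun x => enc_list (l x)) ->
  ptime D ctx (fun x => enc_list (map enc_nat (iota 0 (size (l x))))).
Proof.
move=> hl; pose acc (x : I) j := Pair (enc_nat j) (enc_list (rev (map enc_nat (iota 0 j)))).
have H : ptime D ctx (fun x => acc x (size (l x))).
  apply: (@pt_fold_data l acc hl).
  - by apply: pt_pair; exact: pt_const.
  - have a : ptime (fun p : I * nat => D p.1 /\ p.2 < size (l p.1))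
        (fun p => Pair (ctx p.1) (Pair (nth (Num 0) (l p.1) p.2) (acc p.1 p.2))) (fun p => acc p.1 p.2).
      exact: pt_snd (pt_snd (pt_id _ _)).
    apply: pt_ext (pt_pair (pt_add (pt_fst a) (pt_const _ 1%R _)) (pt_pair (pt_fst a) (pt_snd a))) _.
    move=> [x j] _ /=; rewrite /acc /enc_nat natr1; congr Pair.
    by rewrite -addn1 iotaD add0n map_cat rev_cat.
  - have b0 : pbound D ctx (fun x => size (l x) * (size (l x) + 5) + (size (l x) + 9)).
      have bs : pbound D ctx (fun x => size (l x)).
        by apply: pb_le (pb_ptime hl) => x _; apply: ltnW; apply: size_enc_list.
      by do !(apply: pb_add || apply: pb_mul) => //; apply: pb_const.
    case: b0 => c [r b0]; exists c, r => -[x j] [/= Dx jl].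
    apply: leq_trans (b0 x Dx); rewrite dsize_enc_rev.
    have dn i : dsize (enc_nat i) <= i + 4.
      rewrite /enc_nat /= -[i%:R%R]/((i%:Z)%:~R)%R numq_int denq_int /=.
      by have := bits_nat i; have : bits 1 = 1 by []; lia.
    have := @dsize_list_bound (map enc_nat (iota 0 j)) (j + 4) _ .
    rewrite size_map size_iota => /(_ _) h.
    have {}h : dsize (enc_list (map enc_nat (iota 0 j))) <= j * (j + 4).+1 + 3.
      apply: h => a /List.in_map_iff[i [<- ij]]; apply: leq_trans (dn i) _.
      have : i \in iota 0 j by elim: (iota 0 j) ij => //= b t IH [->|/IH h]; rewrite inE ?eqxx ?h ?orbT.
      by rewrite mem_iota => /andP[_]; lia.
    have : j * (j + 4).+1 <= size (l x) * (size (l x) + 5) by apply: leq_mul => //; lia.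
    by have := dn j; rewrite /=; lia.
apply: pt_ext (pt_rev (pt_snd H)) _ => x _.
by rewrite revK.
Qed.

End Lists.

(** The list serves only as a counter. The invariant both supplies the size bound [h] and restricts
    the states at which the step has to be computed. *)
Lemma pt_iter (I : Type) (D : I -> Prop) (ctx : I -> data) (B : I -> Type) (l : I -> seq data)
    (b0 : forall x, B x) (eb : forall x, B x -> data) (f : forall x, B x -> B x)
    (inv : forall x, B x -> Prop) (h : I -> nat) :
  ptime D ctx (fun x => enc_list (l x)) -> ptime D ctx (fun x => eb x (b0 x)) ->
  (forall x, D x -> inv x (b0 x)) -> (forall x b, D x -> inv x b -> inv x (f x b)) ->
  ptime (fun p : {x : I & B x} => D (projT1 p) /\ inv _ (projT2 p))
    (fun p => Pair (ctx (projT1 p)) (eb _ (projT2 p))) (fun p => eb _ (f _ (projT2 p))) ->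
  pbound D ctx h -> (forall x b, D x -> inv x b -> dsize (eb x b) <= h x) ->
  ptime D ctx (fun x => eb x (iter (size (l x)) (f x) (b0 x))).
Proof.
move=> hl hb i0 iS step bh le.
have foldE x b (s : seq data) : foldl (fun b' _ => f x b') b s = iter (size s) (f x) b.
  by elim: s b => //= a s IH b; rewrite IH -iterSr.
have invj x j : D x -> inv x (iter j (f x) (b0 x)).
  by move=> Dx; elim: j => [|j IH]; [apply: i0 | apply: iS].
have H : ptime D ctx (fun x => eb x (foldl (fun b' _ => f x b') (b0 x) (l x))).
  apply: (@pt_foldl I D ctx (fun=> data) B l (fun=> id) b0 eb (fun x b _ => f x b) h) => //.
  - by apply: pt_ext hl _ => x _; rewrite map_id.
  - apply: (@pt_trans _ _ (fun q => Pair (ctx (projT1 q)) (eb _ (projT2 q).1))).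
      exact: (pt_pair (pt_fst (pt_id _ _)) (pt_snd (pt_snd (pt_id _ _)))).
    apply: pt_reindex step _ => -[x [b a]] [/= Dx [l1 [l2 [_ ->]]]].
    by exists (existT _ x (foldl (fun b' _ => f x b') (b0 x) l1)); rewrite foldE; split=> //; split=> //; apply: invj.
  - by move=> x l1 l2 Dx _; rewrite foldE; apply: le => //; apply: invj.
by apply: pt_ext H _ => x _; rewrite foldE.
Qed.

(** * Encodings and their sizes *)

(* All numbers of a run satisfy this with the same [d] and [M], which bounds their bit sizes. *)
Definition okq (d M : nat) (q : rat) := ((q * d%:R)%R \is a Num.int) && (`|q| <= M%:R)%R.

Lemma dsize_okq d M q : 0 < d -> okq d M q -> dsize (Num q) <= (bits M + bits d + bits d).+1.
Proof.
move=> d0 /andP[/intrP[z ez] qM].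
have d0' : (d%:R != 0 :> rat)%R by rewrite pnatr_eq0 -lt0n.
have [||h1 h2] := @rat_frac q z d%:Z.
- by rewrite eqz_nat -lt0n.
- by rewrite -[RHS]/(z%:~R / d%:R)%R -ez mulfK.
rewrite /= ltnS; apply: leq_add; last exact: bits_mono h2.
apply: leq_trans (bits_mono h1) _; apply: leq_trans (bits_mul _ _); apply: bits_mono.
have : (`|z|%N%:R <= (M * d)%:R :> rat)%R.
  rewrite natrM natr_absz; have -> : ((`|z|%:~R : rat) = `|q| * d%:R)%R.
    by rewrite intr_norm -ez normrM [X in (_ * X)%R]ger0_norm ?ler0n.
  by rewrite ler_wpM2r ?ler0n.
by rewrite ler_nat.
Qed.

(** Together with [mag_data] it provides a common denominator and a common bound for all numbers of
    the input, both with a bit length of at most the input size. *)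
Fixpoint den_data (a : data) : nat :=
  match a with Num q => `|denq q| | Pair b c => den_data b * den_data c end.

Fixpoint mag_data (a : data) : nat :=
  match a with Num q => `|numq q| | Pair b c => mag_data b + mag_data c end.

Fixpoint leaf (q : rat) (a : data) : Prop :=
  match a with Num r => q = r | Pair b c => leaf q b \/ leaf q c end.

Lemma den_data_gt0 a : 0 < den_data a.
Proof. by elim: a => [q|a IHa b IHb] /=; rewrite ?muln_gt0 ?IHa ?IHb // absz_gt0 denq_neq0. Qed.

Lemma bits_den_data a : bits (den_data a) <= dsize a.
Proof.
elim: a => [q|a IHa b IHb] /=; first by lia.
by apply: leq_trans (bits_mul _ _) _; lia.
Qed.

Lemma bits_mag_data a : bits (mag_data a) <= dsize a.
Proof.
elim: a => [q|a IHa b IHb] /=; first by lia.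
by apply: leq_trans (bits_add _ _) _; have := dsize_gt0 a; have := dsize_gt0 b; lia.
Qed.

Lemma leaf_den q a : leaf q a -> (q * (den_data a)%:R)%R \is a Num.int.
Proof.
elim: a => [r ->|a IHa b IHb [/IHa h|/IHb h]] /=.
- have -> : (r * `|denq r|%N%:R = (numq r)%:~R)%R.
    by rewrite natr_absz gtr0_norm ?denq_gt0 // numqE.
  exact: intr_int.
- by rewrite natrM mulrA rpredM // natr_int.
- by rewrite natrM mulrCA rpredM // natr_int.
Qed.

Lemma leaf_mag q a : leaf q a -> (`|q| <= (mag_data a)%:R)%R.
Proof.
elim: a => [r ->|a IHa b IHb [/IHa h|/IHb h]] /=.
- rewrite natr_absz intr_norm numqE normrM ler_peMr //.
  by rewrite ger0_norm ?ler0z ?(ltW (denq_gt0 _)) // ler1z -gtz0_ge1 denq_gt0.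
- by apply: le_trans h _; rewrite ler_nat leq_addr.
- by apply: le_trans h _; rewrite ler_nat leq_addl.
Qed.

Lemma leaf_list q a s : List.In a s -> leaf q a -> leaf q (enc_list s).
Proof. by elim: s => //= b s IH [->|/IH h] l; [left|right; apply: h]. Qed.

Lemma In_mem (T : eqType) (a : T) s : List.In a s <-> a \in s.
Proof.
elim: s => //= b s IH; rewrite inE; split=> [[->|/IH ->]|/orP[/eqP ->|/IH h]];
  rewrite ?eqxx ?orbT //; [by left | by right].
Qed.

Lemma size_arcs_gt0 (E : Type) (T : tree E) : 0 < size (arcs T).
Proof. by elim: T => //= a IHa b IHb; rewrite size_cat addn_gt0 IHa. Qed.

Record instance := Instance {
  nodes : nat; narcs : nat; ncom : nat;
  graph : digraph 'I_nodes 'I_narcs;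
  coms : commodities 'I_nodes rat ncom;
  flow : 'I_narcs -> 'I_ncom -> rat }.

Definition input (x : instance) := enc_input (graph x) (coms x) (@flow x).

Definition valid (x : instance) := [/\ series_parallel (graph x),
  multiflow_instance (graph x) (coms x) & multiflow (graph x) (coms x) (@flow x)].

Section Encodings.
Variable x : instance.
Notation m := (narcs x).
Notation k := (ncom x).
Notation G := (graph x).
Notation C := (coms x).
Notation X := (@flow x).
Notation d := (demand C).
Notation item := ('I_k * (rat * rat))%type.

Definition enc_row (T : tree 'I_m) := enc_fun (fun i => Num (thru X T i)).

(** The demand is stored with the item, so that computing breakpoints and testing thresholds need no
    lookup of the commodity. *)
Definition enc_item (it : item) :=
  Pair (enc_nat it.1) (Pair (Num (d it.1)) (Pair (Num it.2.1) (Num it.2.2))).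

Definition enc_items (l : seq item) := enc_list (map enc_item l).

(** Each node stores what routing will need there, the local items of both children or the amount to
    cut off; [thru] is thus evaluated only while parsing. *)
Fixpoint enc_tree (T : tree 'I_m) : data :=
  match T with
  | Leaf e => Pair (enc_nat 0) (enc_nat e)
  | Ser a b => Pair (enc_nat 1) (Pair (Pair (enc_items (locals C X a b)) (enc_items (locals C X b a)))
                                      (Pair (enc_tree a) (enc_tree b)))
  | Par a b => Pair (enc_nat 2) (Pair (Num (flow_through X a)) (Pair (enc_tree a) (enc_tree b)))
  end.

Definition enc_node (T : tree 'I_m) :=
  Pair (enc_nat (tsrc G T)) (Pair (enc_nat (tdst G T)) (Pair (enc_row T) (enc_tree T))).

Definition enc_nodes (D : seq (tree 'I_m)) := enc_list (map enc_node D).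

Definition enc_job (p : tree 'I_m * seq item) := Pair (enc_tree p.1) (enc_items p.2).

Definition enc_out (q : 'I_m * item) := Pair (enc_nat q.1) (enc_item q.2).

Definition enc_state (st : seq (tree 'I_m * seq item) * seq ('I_m * item)) :=
  Pair (enc_list (map enc_job st.1)) (enc_list (map enc_out st.2)).

Definition common_den := den_data (input x).
(** At most [dsize (input x)] arcs and as many commodities contribute to any [flow_through], each
    pair at most [mag_data (input x)]. *)
Definition max_num := dsize (input x) * dsize (input x) * mag_data (input x).
Definition ok_num (q : rat) := okq common_den max_num q.
Notation S := (dsize (input x)).
(** By [dsize_okq] a number takes at most [5 * S + 3] units: [3 * S + 2] for the bits of [max_num],
    twice [S] for the common denominator, and one more. The constant is generous. *)
Definition num_bound := 20 * S.

Lemma S_gt0 : 0 < S. Proof. exact: dsize_gt0. Qed.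

Lemma dsize_ok_num q : ok_num q -> dsize (Num q) <= num_bound.
Proof.
move=> /(dsize_okq (den_data_gt0 _)) h; apply: leq_trans h _.
have h1 := bits_den_data (input x).
have h2 : bits max_num <= (S.+1 + S.+1) + S.
  apply: leq_trans (bits_mul _ _) _; apply: leq_add (bits_mag_data _).
  by apply: leq_trans (bits_mul _ _) _; apply: leq_add; apply: bits_nat.
by have := S_gt0; rewrite /num_bound; lia.
Qed.

Lemma dsize_nat n : n <= S -> dsize (enc_nat n) <= num_bound.
Proof.
move=> h; rewrite /enc_nat /= -[n%:R%R]/((n%:Z)%:~R)%R numq_int denq_int /=.
by have := bits_nat n; have : bits 1 = 1 by []; rewrite /num_bound; have := S_gt0; lia.
Qed.

Lemma dsize_encnat n : dsize (enc_nat n) = bits n + 2.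
Proof.
rewrite /enc_nat /= -[n%:R%R]/((n%:Z)%:~R)%R numq_int denq_int /=.
by have : bits 1 = 1 by []; lia.
Qed.

Lemma dsize_node (v : 'I_(nodes x)) : dsize (enc_nat v) <= num_bound.
Proof.
have : dsize (enc_nat v) <= dsize (enc_nat (nodes x)).
  by rewrite !dsize_encnat leq_add2r; apply: bits_mono; apply: ltnW.
have -> : num_bound = 20 * ((dsize (enc_nat (nodes x)) + dsize (enc_fun (fun e =>
   Pair (enc_nat (tail G e)) (enc_nat (head G e))))).+1 +
   dsize (Pair (enc_commodities C) (enc_flow X))).+1 by [].
by lia.
Qed.

Lemma narcs_le : m <= S.
Proof.
have := size_enc_list [seq (fun e => Pair (enc_nat (tail G e)) (enc_nat (head G e))) i | i <- enum 'I_m].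
by rewrite size_map size_enum_ord /input /enc_input /enc_digraph /enc_fun /=; lia.
Qed.

Lemma ncom_le : k <= S.
Proof.
have := size_enc_list [seq (fun i => Pair (enc_nat (source C i)) (Pair (enc_nat (sink C i)) (Num (d i)))) i | i <- enum 'I_k].
by rewrite size_map size_enum_ord /input /enc_input /enc_commodities /enc_fun /=; lia.
Qed.

Lemma dsize_arc (e : 'I_m) : dsize (enc_nat e) <= num_bound.
Proof. by apply: dsize_nat; apply: leq_trans narcs_le; apply: ltnW. Qed.

Lemma dsize_com (i : 'I_k) : dsize (enc_nat i) <= num_bound.
Proof. by apply: dsize_nat; apply: leq_trans ncom_le; apply: ltnW. Qed.

Lemma leaf_flow e i : leaf (X e i) (input x).
Proof.
right; right; apply: (@leaf_list _ (enc_fun (fun i => Num (X e i)))).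
  by apply/List.in_map_iff; exists e; split=> //; apply/In_mem; rewrite mem_enum.
apply: (@leaf_list _ (Num (X e i))) => //.
by apply/List.in_map_iff; exists i; split=> //; apply/In_mem; rewrite mem_enum.
Qed.

Lemma leaf_demand i : leaf (d i) (input x).
Proof.
right; left; apply: (@leaf_list _ (Pair (enc_nat (source C i)) (Pair (enc_nat (sink C i)) (Num (d i))))).
  by apply/List.in_map_iff; exists i; split=> //; apply/In_mem; rewrite mem_enum.
by right; right.
Qed.

Lemma mag_data_le : mag_data (input x) <= max_num.
Proof. by rewrite /max_num leq_pmull // muln_gt0 S_gt0. Qed.

Lemma ok_num_demand i : ok_num (d i).
Proof.
apply/andP; split; first exact: leaf_den (leaf_demand i).
by apply: le_trans (leaf_mag (leaf_demand i)) _; rewrite ler_nat mag_data_le.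
Qed.

Definition isint (q : rat) := (q * common_den%:R)%R \is a Num.int.

Lemma isintD p q : isint p -> isint q -> isint (p + q)%R.
Proof. by rewrite /isint mulrDl; apply: rpredD. Qed.

Lemma isintB p q : isint p -> isint q -> isint (p - q)%R.
Proof. by rewrite /isint mulrBl; apply: rpredB. Qed.

Lemma isint0 : isint 0%R. Proof. by rewrite /isint mul0r rpred0. Qed.

Lemma ok_numI q : isint q -> (0 <= q)%R -> (q <= max_num%:R)%R -> ok_num q.
Proof. by move=> h1 h2 h3; apply/andP; split; rewrite // ger0_norm. Qed.

Hypothesis vx : valid x.

Let flowX : multiflow G C X. Proof. by case: vx. Qed.
Let inst : multiflow_instance G C. Proof. by case: vx. Qed.

Lemma demand_mag i : (d i <= max_num%:R)%R.
Proof. by have /andP[_] := ok_num_demand i; rewrite ger0_norm // ltW // (d_gt0 inst). Qed.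

Lemma isint_thru T i : isint (thru X T i).
Proof.
elim: T => [e|a IHa b IHb|a IHa b IHb] /=; first exact: leaf_den (leaf_flow e i).
  by case: ifP.
exact: isintD.
Qed.

Lemma thru_le T i : (thru X T i <= (size (arcs T) * mag_data (input x))%:R)%R.
Proof.
elim: T => [e|a IHa b IHb|a IHa b IHb] /=.
- rewrite mul1n; apply: le_trans (leaf_mag (leaf_flow e i)); exact: ler_norm.
- rewrite size_cat mulnDl natrD.
  by case: ifP => _; [apply: le_trans IHa _; rewrite lerDl ler0n | apply: le_trans IHb _; rewrite lerDr ler0n].
- by rewrite size_cat mulnDl natrD lerD.
Qed.

Lemma flow_through_le T : size (arcs T) <= m -> (flow_through X T <= max_num%:R)%R.
Proof.
move=> h; have aux i : (thru X T i <= (S * mag_data (input x))%:R)%R.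
  apply: le_trans (thru_le T i) _; rewrite ler_nat leq_mul2r.
  by rewrite (leq_trans h narcs_le) orbT.
apply: le_trans (ler_sum _ (fun i _ => aux i)) _.
rewrite sumr_const card_ord -mulrnA ler_nat /max_num mulnAC leq_mul2r.
by rewrite leq_mul2l ncom_le !orbT.
Qed.

Lemma thru_le_flow_through T i : (thru X T i <= flow_through X T)%R.
Proof.
rewrite /flow_through (bigD1 i) //= lerDl; apply: sumr_ge0 => j _.
exact: (thru_ge0 flowX).
Qed.

Lemma ok_num_thru T i : size (arcs T) <= m -> ok_num (thru X T i).
Proof.
move=> h; apply: ok_numI; [exact: isint_thru | exact: (thru_ge0 flowX) |].
exact: le_trans (thru_le_flow_through T i) (flow_through_le h).
Qed.

Lemma isint_flow_through T : isint (flow_through X T).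
Proof.
rewrite /flow_through /isint mulr_suml; apply: rpred_sum => i _.
exact: isint_thru.
Qed.

Lemma ok_num_flow_through T : size (arcs T) <= m -> ok_num (flow_through X T).
Proof.
move=> h; apply: ok_numI; [exact: isint_flow_through | exact: (flow_through_ge0 flowX) |].
exact: flow_through_le.
Qed.

Definition okit (it : item) := ok_num it.2.1 && ok_num it.2.2.

Lemma dsize_item it : okit it -> dsize (enc_item it) <= 4 * num_bound + 3.
Proof.
move=> /andP[/dsize_ok_num h1 /dsize_ok_num h2].
have h3 := dsize_com it.1; have h4 := dsize_ok_num (ok_num_demand it.1).
by rewrite /enc_item; move: h1 h2 h3 h4; rewrite /=; lia.
Qed.

Definition items_bound n := n * (4 * num_bound + 4) + 3.

Lemma dsize_items l n : all okit l -> size l <= n -> dsize (enc_items l) <= items_bound n.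
Proof.
move=> h ln; apply: leq_trans (@dsize_list_bound _ (4 * num_bound + 3) _) _.
  move=> a /List.in_map_iff[it [<- /In_mem il]]; apply: dsize_item.
  exact: (allP h).
by rewrite size_map /items_bound leq_add2r -addnS leq_mul2r ln orbT.
Qed.

Lemma ok_num0 : ok_num 0%R. Proof. by apply: ok_numI; rewrite ?isint0 ?ler0n. Qed.

Lemma okit_full i : okit (full_item C i).
Proof. by rewrite /okit /= ok_num0 ok_num_demand. Qed.

Lemma okit_locals a b : all okit (locals C X a b).
Proof. by apply/allP => it /mapP[i _ ->]; apply: okit_full. Qed.

Lemma size_locals a b : size (locals C X a b) <= k.
Proof. by rewrite size_map size_filter (leq_trans (count_size _ _)) // size_enum_ord. Qed.

Definition tree_bound := 2 * items_bound k + 3 * num_bound + 20.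

(** The summand on the left makes the induction work: a tree with [n] leaves has [2 * n - 1] nodes,
    each contributing at most [tree_bound]. *)
Lemma dsize_enc_tree T : size (arcs T) <= m -> dsize (enc_tree T) + tree_bound <= (2 * tree_bound) * size (arcs T).
Proof.
have W0 : 4 <= num_bound by rewrite /num_bound; have := S_gt0; lia.
have tagW n : n <= 2 -> dsize (enc_nat n) <= num_bound + 4.
  by move=> h; rewrite dsize_encnat; have := bits_nat n; lia.
elim: T => [e|a IHa b IHb|a IHa b IHb] h.
- have := dsize_arc e; have := tagW 0 isT; rewrite [size _]/=.
  have -> : dsize (enc_tree (Leaf e)) = (dsize (enc_nat 0) + dsize (enc_nat e)).+1 by [].
  by rewrite /tree_bound; lia.
- move: h; rewrite /= size_cat => h.
  have {}IHa := IHa (leq_trans (leq_addr _ _) h); have {}IHb := IHb (leq_trans (leq_addl _ _) h).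
  have := dsize_items (okit_locals a b) (size_locals a b).
  have := dsize_items (okit_locals b a) (size_locals b a).
  have := tagW 1 isT; rewrite -/(dsize (enc_nat 1)) mulnDr.
  by move: IHa IHb; rewrite /tree_bound /=; lia.
- move: h; rewrite /= size_cat => h.
  have {}IHa := IHa (leq_trans (leq_addr _ _) h); have {}IHb := IHb (leq_trans (leq_addl _ _) h).
  have := dsize_ok_num (ok_num_flow_through (leq_trans (leq_addr _ _) h)).
  have := tagW 2 isT; rewrite mulnDr.
  by move: IHa IHb; rewrite /tree_bound /=; lia.
Qed.

Lemma dsize_row T : size (arcs T) <= m -> dsize (enc_row T) <= items_bound k.
Proof.
move=> h; apply: leq_trans (@dsize_list_bound _ num_bound _) _.
  by move=> a /List.in_map_iff[i [<- _]]; apply: dsize_ok_num; apply: ok_num_thru.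
by rewrite size_map size_enum_ord /items_bound leq_add2r leq_mul2l; apply/orP; right; lia.
Qed.

Lemma dsize_enc_node T : size (arcs T) <= m -> dsize (enc_node T) < 4 * tree_bound * size (arcs T).
Proof.
move=> h; have := dsize_node (tsrc G T); have := dsize_node (tdst G T).
have := dsize_row h; have := dsize_enc_tree h.
have := size_arcs_gt0 T.
have -> : dsize (enc_node T) = (dsize (enc_nat (tsrc G T)) + (dsize (enc_nat (tdst G T)) +
  (dsize (enc_row T) + dsize (enc_tree T)).+1).+1).+1 by [].
have hK : 2 * num_bound + items_bound k + 3 < tree_bound by rewrite /tree_bound; lia.
case: (size (arcs T)) => // n _.
have -> : 2 * tree_bound * n.+1 = 2 * tree_bound * n + 2 * tree_bound by rewrite mulnS addnC.
have -> : 4 * tree_bound * n.+1 = 2 * tree_bound * n + 2 * tree_bound * n + 4 * tree_bound by rewrite mulnS; nia.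
by move: (2 * tree_bound * n) => z; lia.
Qed.

End Encodings.

(** * The program *)

Lemma pt_lift (I : Type) (A : I -> Type) (D : I -> Prop) (D' : {x : I & A x} -> Prop)
    (ctx g : I -> data) (e : {x : I & A x} -> data) :
  ptime D ctx g -> (forall y, D' y -> D (projT1 y)) ->
  ptime D' (fun y => Pair (ctx (projT1 y)) (e y)) (fun y => g (projT1 y)).
Proof.
move=> h s; apply: (@pt_trans _ _ (fun y => ctx (projT1 y))); first exact: pt_fst (pt_id _ _).
by apply: pt_reindex h _ => y /s Dy; exists (projT1 y).
Qed.

Lemma pt_cases (I : Type) (D : I -> Prop) (f g : I -> data) (b : I -> bool) : pbool D f b ->
  ptime (fun x => D x /\ b x) f g -> ptime (fun x => D x /\ ~~ b x) f g -> ptime D f g.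
Proof. by move=> h1 h2 h3; apply: pt_ext (pt_if h1 h2 h3) _ => x _; case: (b x). Qed.

(** * Computing with encoded parts *)

Section Nodes.
Variables (I : Type) (D : I -> Prop) (ctx : I -> data) (xx : I -> instance).
Notation tr y := (tree 'I_(narcs (xx y))).
Notation X y := (@flow (xx y)).

Lemma pt_row (a : forall y, tr y) : ptime D ctx (fun y => enc_node (a y)) ->
  ptime D ctx (fun y => enc_row (a y)).
Proof. by move=> h; apply: pt_fst (pt_snd (pt_snd h)). Qed.

Lemma pt_tree (a : forall y, tr y) : ptime D ctx (fun y => enc_node (a y)) ->
  ptime D ctx (fun y => enc_tree (a y)).
Proof. by move=> h; apply: pt_snd (pt_snd (pt_snd h)). Qed.

Lemma pt_tsrc (a : forall y, tr y) : ptime D ctx (fun y => enc_node (a y)) ->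
  ptime D ctx (fun y => enc_nat (tsrc (graph (xx y)) (a y))).
Proof. by move=> h; apply: pt_fst h. Qed.

Lemma pt_tdst (a : forall y, tr y) : ptime D ctx (fun y => enc_node (a y)) ->
  ptime D ctx (fun y => enc_nat (tdst (graph (xx y)) (a y))).
Proof. by move=> h; apply: pt_fst (pt_snd h). Qed.

(** The row of a merged tree comes entrywise from the rows of its children, by minimum or sum, so no
    crossing is ever recomputed from the arcs. *)
Lemma pt_map_rows (a b : forall y, tr y) (op : rat -> rat -> rat) :
  ptime D ctx (fun y => enc_row (a y)) -> ptime D ctx (fun y => enc_row (b y)) ->
  (forall (J : Type) (D' : J -> Prop) f (u v : J -> rat), ptime D' f (fun x => Num (u x)) ->
     ptime D' f (fun x => Num (v x)) -> ptime D' f (fun x => Num (op (u x) (v x)))) ->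
  ptime D ctx (fun y => enc_fun (fun i => Num (op (thru (X y) (a y) i) (thru (X y) (b y) i)))).
Proof.
move=> ha hb hop.
apply: (@pt_map _ _ _ (fun y => 'I_(ncom (xx y))) (fun y => enum 'I_(ncom (xx y)))
  (fun y i => Pair (Num (thru (X y) (a y) i)) (Num (thru (X y) (b y) i)))); first exact: pt_zip.
apply: hop; first exact: pt_fst (pt_snd (pt_id _ _)).
exact: pt_snd (pt_snd (pt_id _ _)).
Qed.

Lemma pt_flow_through (a : forall y, tr y) : ptime D ctx (fun y => enc_row (a y)) ->
  ptime D ctx (fun y => Num (flow_through (X y) (a y))).
Proof.
move=> h; have := @pt_sum I D ctx (fun y => [seq thru (X y) (a y) i | i <- enum 'I_(ncom (xx y))]).
move=> /(_ _) hs; apply: pt_ext (hs _) _.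
  by apply: pt_ext h _ => y _; rewrite -map_comp.
by move=> y _; rewrite big_map big_enum.
Qed.

Lemma pt_node_par (a b : forall y, tr y) :
  ptime D ctx (fun y => enc_node (a y)) -> ptime D ctx (fun y => enc_node (b y)) ->
  ptime D ctx (fun y => enc_node (Par (a y) (b y))).
Proof.
move=> ha hb; apply: pt_pair; first exact: pt_tsrc ha.
apply: pt_pair; first exact: pt_tdst ha.
apply: pt_pair.
  exact: (@pt_map_rows a b +%R (pt_row ha) (pt_row hb)) (@pt_add).
apply: pt_pair; first exact: pt_const.
apply: pt_pair; first exact: pt_flow_through (pt_row ha).
exact: pt_pair (pt_tree ha) (pt_tree hb).
Qed.

Definition enc_demands (x : instance) :=
  enc_fun (fun i : 'I_(ncom x) => Pair (enc_nat i) (Num (demand (coms x) i))).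

Lemma enum_iota n : map (@nat_of_ord n) (enum 'I_n) = iota 0 n.
Proof. exact: val_enum_ord. Qed.

Lemma pt_demands : ptime D ctx (fun y => input (xx y)) -> ptime D ctx (fun y => enc_demands (xx y)).
Proof.
move=> h; have hc : ptime D ctx (fun y => enc_commodities (coms (xx y))).
  exact: pt_fst (pt_snd h).
have hi : ptime D ctx (fun y => enc_list [seq enc_nat i | i : 'I_(ncom (xx y)) <- enum 'I_(ncom (xx y))]).
  apply: pt_ext (pt_iota hc) _ => y _.
  by rewrite size_map size_enum_ord -enum_iota -map_comp.
apply: (@pt_map _ _ _ (fun y => 'I_(ncom (xx y))) (fun y => enum 'I_(ncom (xx y)))
  (fun y i => Pair (enc_nat i) (Pair (enc_nat (source (coms (xx y)) i))
     (Pair (enc_nat (sink (coms (xx y)) i)) (Num (demand (coms (xx y)) i)))))).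
  exact: pt_zip hi hc.
apply: pt_pair; first exact: pt_fst (pt_snd (pt_id _ _)).
exact: pt_snd (pt_snd (pt_snd (pt_snd (pt_id _ _)))).
Qed.

Lemma pt_full_items (p : forall y, 'I_(ncom (xx y)) -> bool) (e : forall y, 'I_(ncom (xx y)) -> data) :
  ptime D ctx (fun y => enc_demands (xx y)) -> ptime D ctx (fun y => enc_fun (e y)) ->
  (forall J (D' : J -> Prop) f (u : J -> {y : I & 'I_(ncom (xx y))}),
     ptime D' f (fun z => e _ (projT2 (u z))) -> pbool D' f (fun z => p _ (projT2 (u z)))) ->
  ptime D ctx (fun y => enc_items [seq full_item (coms (xx y)) i | i <- enum 'I_(ncom (xx y)) & p y i]).
Proof.
move=> hd he hp.
have := @pt_filter_map _ D ctx (fun y => 'I_(ncom (xx y))) (fun y => enum 'I_(ncom (xx y)))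
  (fun y i => Pair (e y i) (Pair (enc_nat i) (Num (demand (coms (xx y)) i)))) p
  (fun y i => enc_item (full_item (coms (xx y)) i)).
move=> H; apply: pt_ext (H _ _ _) _.
- exact: pt_zip he hd.
- by apply: (hp _ _ _ id); exact: pt_fst (pt_snd (pt_id _ _)).
- apply: pt_pair; first exact: pt_fst (pt_snd (pt_snd (pt_id _ _))).
  apply: pt_pair; first exact: pt_snd (pt_snd (pt_snd (pt_id _ _))).
  apply: pt_pair; first exact: pt_const.
  exact: pt_snd (pt_snd (pt_snd (pt_id _ _))).
- by move=> y _; rewrite /enc_items -map_comp.
Qed.

Lemma pt_locals (a b : forall y, tr y) :
  ptime D ctx (fun y => enc_demands (xx y)) ->
  ptime D ctx (fun y => enc_row (a y)) -> ptime D ctx (fun y => enc_row (b y)) ->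
  ptime D ctx (fun y => enc_items (locals (coms (xx y)) (X y) (a y) (b y))).
Proof.
move=> hd ha hb; apply: (pt_full_items hd (pt_zip ha hb)) => J D' f u h.
apply: pt_and; first by apply: pt_le (pt_snd h) _; apply: pt_const.
by apply: pt_not; apply: pt_le; [apply: pt_weaken (pt_fst h) _ => y [] | apply: pt_const].
Qed.

Lemma pt_root_items (a : forall y, tr y) :
  ptime D ctx (fun y => enc_demands (xx y)) -> ptime D ctx (fun y => enc_row (a y)) ->
  ptime D ctx (fun y => enc_items (root_items (coms (xx y)) (X y) (a y))).
Proof.
move=> hd ha; apply: (pt_full_items hd ha) => J D' f u h.
by apply: pt_not; apply: pt_le h _; apply: pt_const.
Qed.

Lemma pt_node_ser (a b : forall y, tr y) :
  ptime D ctx (fun y => input (xx y)) ->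
  ptime D ctx (fun y => enc_node (a y)) -> ptime D ctx (fun y => enc_node (b y)) ->
  ptime D ctx (fun y => enc_node (Ser (a y) (b y))).
Proof.
move=> hx ha hb; have hd := pt_demands hx.
apply: pt_pair; first exact: pt_tsrc ha.
apply: pt_pair; first exact: pt_tdst hb.
apply: pt_pair.
  apply: (@pt_map_rows a b (fun u v => if (u <= v)%R then u else v) (pt_row ha) (pt_row hb)).
  move=> J D' f u v hu hv; apply: pt_ext (pt_if (pt_le hu hv) _ _) _.
  - by apply: pt_weaken hu _ => y [].
  - by apply: pt_weaken hv _ => y [].
  - by move=> y _ /=; case: ifP.
apply: pt_pair; first exact: pt_const.
apply: pt_pair; last exact: pt_pair (pt_tree ha) (pt_tree hb).
by apply: pt_pair; apply: pt_locals => //; apply: pt_row.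
Qed.

End Nodes.

(** * Parsing in polynomial time *)

Section Parse.

Notation trees x := (seq (tree 'I_(narcs x))).

Lemma pt_parse_cons :
  ptime (fun=> True)
    (fun p : {x : instance & (tree 'I_(narcs x) * trees x)%type} =>
       Pair (input (projT1 p)) (enc_nodes ((projT2 p).1 :: (projT2 p).2)))
    (fun p => enc_nodes (parse_step (graph (projT1 p)) ((projT2 p).1 :: (projT2 p).2))).
Proof.
pose J := ({x : instance & (tree 'I_(narcs x) * trees x)%type})%type.
set src := (X in ptime _ X _).
pose e (p : J) := (projT2 p).1; pose r (p : J) := (projT2 p).2.
have hx D : ptime D src (fun p : J => input (projT1 p)) by exact: pt_fst (pt_id _ _).
have he D : ptime D src (fun p : J => enc_node (e p)) by exact: pt_fst (pt_snd (pt_id _ _)).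
have hr D : ptime D src (fun p : J => enc_nodes (r p)) by exact: pt_snd (pt_snd (pt_id _ _)).
pose src1 (y : {p : J & tree 'I_(narcs (projT1 p))}) := Pair (src (projT1 y)) (enc_node (projT2 y)).
have a1 D' : ptime D' src1 (fun y => enc_node (projT2 y)) by exact: pt_snd (pt_id _ _).
have a2 (D' : _ -> Prop) : ptime D' src1 (fun y => enc_node (e (projT1 y))).
  exact: (@pt_lift J (fun p => tree 'I_(narcs (projT1 p))) (fun=> True) D' src _
    (fun y => enc_node (projT2 y)) (he _)).
have par D : pbool D src1
    (fun y => parallel (graph (projT1 (projT1 y))) (e (projT1 y)) (projT2 y)).
  apply: pt_ext (pt_and (pt_eqnat (pt_tsrc (a1 _)) (pt_tsrc (a2 _)))
    (pt_eqnat (pt_tdst (a1 _)) (pt_tdst (a2 _)))) _ => y _.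
  by rewrite /parallel -!val_eqE.
have fol D : pbool D src1
    (fun y => follows (graph (projT1 (projT1 y))) (e (projT1 y)) (projT2 y)).
  apply: pt_ext (pt_or (pt_eqnat (pt_tsrc (a1 _)) (pt_tdst (a2 _)))
    (pt_eqnat (pt_tdst (a1 _)) (pt_tdst (a2 _)))) _ => y _.
  by rewrite /follows /touches -!val_eqE.
have hP D : ptime D src (fun p => enc_nodes [seq f <- r p | parallel (graph (projT1 p)) (e p) f]).
  exact: pt_filter (hr _) (par _).
have hN D : ptime D src (fun p => enc_nodes [seq f <- r p | ~~ parallel (graph (projT1 p)) (e p) f]).
  exact: pt_filter (hr _) (pt_not (par _)).
have hQ D : ptime D src (fun p => enc_nodes [seq f <- r p | follows (graph (projT1 p)) (e p) f]).
  exact: pt_filter (hr _) (fol _).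
have hM D : ptime D src (fun p => enc_nodes [seq f <- r p | ~~ follows (graph (projT1 p)) (e p) f]).
  exact: pt_filter (hr _) (pt_not (fol _)).
have rot D : ptime D src (fun p => enc_nodes (rcons (r p) (e p))).
  apply: pt_ext (pt_cat (hr _) (pt_cons (he _) (pt_nil _ _))) _ => p _.
  by rewrite /enc_nodes -cats1 map_cat.
apply: (pt_cases (pt_not (pt_nilp (hP _)))).
  (* To name the first parallel tree and the remaining ones, they are made part of the index, and
     [D'] ties them to the filtered list; projections of its encoding then compute them. *)
  pose J' := ({p : J & (tree 'I_(narcs (projT1 p)) * trees (projT1 p))%type})%type.
  pose D' (q : J') := [seq f <- r (projT1 q) | parallel (graph (projT1 (projT1 q))) (e (projT1 q)) f] =
     (projT2 q).1 :: (projT2 q).2.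
  have lift (g : J -> data) : ptime (fun=> True) src g ->
      ptime D' (fun q : J' => src (projT1 q)) (fun q => g (projT1 q)).
    by move=> h; apply: pt_reindex h _ => q _; exists (projT1 q).
  have hP' : ptime D' (fun q : J' => src (projT1 q)) (fun q => enc_nodes ((projT2 q).1 :: (projT2 q).2)).
    by apply: pt_ext (lift _ (hP _)) _ => q Dq; rewrite Dq.
  have main : ptime D' (fun q : J' => src (projT1 q)) (fun q => enc_nodes
      (Par (e (projT1 q)) (projT2 q).1 :: (projT2 q).2 ++
        [seq f <- r (projT1 q) | ~~ parallel (graph (projT1 (projT1 q))) (e (projT1 q)) f])).
    rewrite /enc_nodes /=; apply: pt_cons.
      apply: (@pt_node_par _ _ _ (fun q : J' => projT1 (projT1 q)) (fun q => e (projT1 q))).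
        exact: lift (he _).
      exact: pt_fst hP'.
    apply: pt_ext (pt_cat (pt_snd hP') (lift _ (hN _))) _ => q _.
    by rewrite map_cat.
  apply: pt_reindex main _ => p [_ nP]; move: nP; rewrite /nilp size_map => nP.
  case E : [seq f <- r p | parallel (graph (projT1 p)) (e p) f] nP => [|f P'] //= _.
  exists (existT _ p (f, P')); split=> //=.
  by move: E; rewrite /e /r /= => ->.
(* The test succeeds exactly if a single tree touches the end node of [e] and starts there: the
   first conjunct allows at most one tree, the second requires one. *)
have hb2 : pbool (fun x : J => True /\ ~~ ~~ nilp (map (@enc_node (projT1 x)) [seq f <- r x | parallel (graph (projT1 x)) (e x) f]))
    src (fun p => nilp (behead (map (@enc_node (projT1 p)) [seq f <- r p | follows (graph (projT1 p)) (e p) f])) &&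
      has (fun f => tsrc (graph (projT1 p)) f == tdst (graph (projT1 p)) (e p))
       [seq f <- r p | follows (graph (projT1 p)) (e p) f]).
  apply: pt_and (pt_nilp (pt_behead (hQ _))) _.
  apply: (pt_has (hQ _)).
  by apply: pt_ext (pt_eqnat (pt_tsrc (a1 _)) (pt_tdst (a2 _))) _ => y _; rewrite -val_eqE.
apply: (pt_cases hb2).
  pose J' := ({p : J & tree 'I_(narcs (projT1 p))})%type.
  pose D' (q : J') := [seq f <- r (projT1 q) | follows (graph (projT1 (projT1 q))) (e (projT1 q)) f] =
     [:: projT2 q].
  have lift (g : J -> data) : ptime (fun=> True) src g ->
      ptime D' (fun q : J' => src (projT1 q)) (fun q => g (projT1 q)).
    by move=> h; apply: pt_reindex h _ => q _; exists (projT1 q).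
  have hQ' : ptime D' (fun q : J' => src (projT1 q)) (fun q => enc_nodes [:: projT2 q]).
    by apply: pt_ext (lift _ (hQ _)) _ => q Dq; rewrite Dq.
  have main : ptime D' (fun q : J' => src (projT1 q)) (fun q => enc_nodes
      (Ser (e (projT1 q)) (projT2 q) ::
        [seq f <- r (projT1 q) | ~~ follows (graph (projT1 (projT1 q))) (e (projT1 q)) f])).
    rewrite /enc_nodes /=; apply: pt_cons; last exact: lift (hM _).
    apply: (@pt_node_ser _ _ _ (fun q : J' => projT1 (projT1 q)) (fun q => e (projT1 q))).
    - exact: lift (hx _).
    - exact: lift (he _).
    - exact: pt_fst hQ'.
  apply: pt_reindex main _ => p [[_ nP] b2]; move: nP b2; rewrite /nilp !size_map size_behead size_map.
  case E : [seq f <- r p | follows (graph (projT1 p)) (e p) f] => [|f [|//]]; rewrite ?andbF //= orbF.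
  move=> nP ef; exists (existT _ p f); split=> //=.
  move: nP E ef; rewrite /e /r /=; case: [seq f <- _ | parallel _ _ f] => // _ -> /= ->.
  by [].
apply: pt_ext (rot _) _ => p [[_ nP] nb2]; move: nP nb2; rewrite /nilp !size_map size_behead size_map /=.
rewrite /e /r /=; case: [seq f <- _ | parallel _ _ f] => // _.
case: [seq f <- _ | follows _ _ f] => [|f [|f' Q']] //=; rewrite orbF.
by move/negPf => ->.
Qed.

Definition nodes_bound x := 4 * tree_bound x * narcs x + 3.

(** The trees of the list share out the arcs, and each entry has a size linear in its number of
    arcs; so the sizes add up to a multiple of [narcs x]. *)
Lemma dsize_enc_nodes x u v (D : trees x) : valid x -> parse_inv (graph x) u v D ->
  dsize (enc_nodes D) <= nodes_bound x.
Proof.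
move=> vx [_ _ h3].
have sz : size (flatten (map (@arcs _) D)) = narcs x by rewrite (perm_size h3) size_enum_ord.
rewrite /enc_nodes dsize_enc_list leq_add2r -map_comp.
have aux D' : size (flatten (map (@arcs 'I_(narcs x)) D')) <= narcs x ->
    sumn [seq (dsize (enc_node a)).+1 | a <- D'] <= 4 * tree_bound x * size (flatten (map (@arcs _) D')).
  elim: D' => //= T D' IH; rewrite size_cat => h; rewrite mulnDr; apply: leq_add.
    by apply: dsize_enc_node => //; apply: leq_trans h; apply: leq_addr.
  by apply: IH; apply: leq_trans h; apply: leq_addl.
by apply: leq_trans (aux D _) _; rewrite sz.
Qed.

End Parse.

Section Polynomials.
Variables (I : Type) (D : I -> Prop) (ctx : I -> data) (xx : I -> instance).
Hypothesis hx : ptime D ctx (fun y => input (xx y)).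

Lemma pb_S : pbound D ctx (fun y => dsize (input (xx y))).
Proof. exact: pb_ptime hx. Qed.

Lemma pb_num_bound : pbound D ctx (fun y => num_bound (xx y)).
Proof. exact: pb_mul (pb_const _ _ 20) pb_S. Qed.

Lemma pb_items_bound (n : I -> nat) : pbound D ctx n -> pbound D ctx (fun y => items_bound (xx y) (n y)).
Proof.
move=> hn; apply: pb_add (pb_const _ _ 3); apply: (pb_mul hn).
by apply: pb_add (pb_const _ _ 4); apply: pb_mul (pb_const _ _ 4) pb_num_bound.
Qed.

Lemma pb_ncom : pbound D ctx (fun y => ncom (xx y)).
Proof. by apply: pb_le pb_S => y _; apply: ncom_le. Qed.

Lemma pb_narcs : pbound D ctx (fun y => narcs (xx y)).
Proof. by apply: pb_le pb_S => y _; apply: narcs_le. Qed.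

Lemma pb_tree_bound : pbound D ctx (fun y => tree_bound (xx y)).
Proof.
apply: pb_add (pb_const _ _ 20); apply: pb_add; first exact: pb_mul (pb_const _ _ 2) (pb_items_bound pb_ncom).
exact: pb_mul (pb_const _ _ 3) pb_num_bound.
Qed.

Lemma pb_nodes_bound : pbound D ctx (fun y => nodes_bound (xx y)).
Proof.
apply: pb_add (pb_const _ _ 3); apply: pb_mul pb_narcs.
exact: pb_mul (pb_const _ _ 4) pb_tree_bound.
Qed.

(* Loops are driven by this list: the number of arcs bounds their number of rounds. *)
Lemma pt_arc_list : ptime D ctx (fun y =>
  enc_list [seq Pair (enc_nat (tail (graph (xx y)) e)) (enc_nat (head (graph (xx y)) e))
           | e <- enum 'I_(narcs (xx y))]).
Proof. exact: pt_snd (pt_fst hx). Qed.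

End Polynomials.

Section ParseLoop.
Notation trees x := (seq (tree 'I_(narcs x))).

Lemma pt_parse_step : ptime
  (fun p : {x : instance & trees x} => exists u v, parse_inv (graph (projT1 p)) u v (projT2 p))
  (fun p => Pair (input (projT1 p)) (enc_nodes (projT2 p)))
  (fun p => enc_nodes (parse_step (graph (projT1 p)) (projT2 p))).
Proof.
apply: pt_reindex pt_parse_cons _ => -[x D] /= [u [v [s _ _]]].
case: D s => [/sp_size //|e r] _.
by exists (existT _ x (e, r)).
Qed.

Lemma pt_parse_round : ptime
  (fun p : {x : instance & trees x} => valid (projT1 p) /\
     exists u v, parse_inv (graph (projT1 p)) u v (projT2 p))
  (fun p => Pair (input (projT1 p)) (enc_nodes (projT2 p)))
  (fun p => enc_nodes (iter (narcs (projT1 p)) (parse_step (graph (projT1 p))) (projT2 p))).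
Proof.
pose J := ({x : instance & trees x})%type; set Dm := (X in ptime X _ _); set src := (X in ptime _ X _).
have hx : ptime Dm src (fun p : J => input (projT1 p)) by exact: pt_fst (pt_id _ _).
have H := @pt_iter J Dm src (fun p => trees (projT1 p)) _ (fun p => projT2 p)
  (fun p => @enc_nodes (projT1 p)) (fun p => parse_step (graph (projT1 p)))
  (fun p D => exists u v, parse_inv (graph (projT1 p)) u v D)
  (fun p => nodes_bound (projT1 p)) (pt_arc_list hx).
apply: pt_ext (H _ _ _ _ _ _) _.
- exact: pt_snd (pt_id _ _).
- by move=> p [].
- by move=> p D _ [u [v h]]; exists u, v; apply: parse_inv_step.
- apply: (@pt_trans _ _ (fun q : {p : J & trees (projT1 p)} =>
    Pair (input (projT1 (projT1 q))) (enc_nodes (projT2 q)))).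
    by apply: pt_pair; [exact: pt_fst (pt_fst (pt_id _ _)) | exact: pt_snd (pt_id _ _)].
  by apply: pt_reindex pt_parse_step _ => -[[x D0] D] [_ /= h]; exists (existT _ x D).
- exact: pb_nodes_bound hx.
- by move=> p D [vx _] [u [v h]]; apply: dsize_enc_nodes h.
- by move=> p _; rewrite size_map size_enum_ord.
Qed.

Lemma pt_leaves : ptime valid input (fun x => enc_nodes (parse_leaves 'I_(narcs x))).
Proof.
have hx : ptime valid input input by exact: pt_id.
have hi : ptime valid input (fun x => enc_list [seq enc_nat e | e : 'I_(narcs x) <- enum 'I_(narcs x)]).
  apply: pt_ext (pt_iota (pt_arc_list hx)) _ => x _.
  by rewrite size_map size_enum_ord -enum_iota -map_comp.
have hX : ptime valid input (fun x => enc_fun (fun e => enc_fun (fun i => Num (@flow x e i)))).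
  exact: pt_snd (pt_snd hx).
have h3 := pt_zip hi (pt_zip (pt_arc_list hx) hX).
have := @pt_map _ valid input (fun x => 'I_(narcs x)) (fun x => enum 'I_(narcs x)) _
  (fun x e => enc_node (Leaf e)) h3.
move=> H; apply: pt_ext (H _) _; last first.
  move=> x _; congr enc_list; exact: (map_comp (@enc_node x) (@Leaf 'I_(narcs x)) _).
set src := (X in ptime _ X _).
have s1 D : ptime D src (fun y => enc_nat (projT2 y)) by exact: pt_fst (pt_snd (pt_id _ _)).
apply: pt_pair; first exact: pt_fst (pt_fst (pt_snd (pt_snd (pt_id _ _)))).
apply: pt_pair; first exact: pt_snd (pt_fst (pt_snd (pt_snd (pt_id _ _)))).
apply: pt_pair; first exact: pt_snd (pt_snd (pt_snd (pt_id _ _))).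
exact: pt_pair (pt_const _ _ _) (s1 _).
Qed.

Lemma pt_parse : ptime valid input (fun x => enc_nodes (parse (graph x) (narcs x))).
Proof.
have hx : ptime valid input input by exact: pt_id.
have H := @pt_iter instance valid input (fun x => trees x) _ (fun x => parse_leaves 'I_(narcs x))
  (fun x => @enc_nodes x) (fun x => iter (narcs x) (parse_step (graph x)))
  (fun x D => exists u v, parse_inv (graph x) u v D)
  (fun x => nodes_bound x) (pt_arc_list hx).
apply: pt_ext (H _ _ _ _ _ _) _.
- exact: pt_leaves.
- by move=> x [sp _ _]; apply: parse_inv_leaves.
- by move=> x D _ [u [v h]]; exists u, v; apply: parse_inv_iter.
- by apply: pt_reindex pt_parse_round _ => -[x D] h; exists (existT _ x D).
- exact: pb_nodes_bound hx.
- by move=> x D vx [u [v h]]; apply: dsize_enc_nodes h.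
- by move=> x _; rewrite size_map size_enum_ord.
Qed.

End ParseLoop.

(** * Size bounds for cutting lists *)

Section CutBounds.
Variable x : instance.
Hypothesis vx : valid x.
Notation k := (ncom x).
Notation item := ('I_k * (rat * rat))%type.

Definition item_fits (it : item) :=
  [/\ isint x it.2.1, isint x it.2.2, (0 <= it.2.1)%R, (it.2.1 <= it.2.2)%R
    & (it.2.2 <= (max_num x)%:R)%R].

Lemma item_fits_ok it : item_fits it -> okit it.
Proof.
case=> h1 h2 h3 h4 h5; apply/andP; split; apply: ok_numI => //.
  exact: le_trans h4 h5.
exact: le_trans h3 h4.
Qed.

Definition cut_fits n (st : rat * (seq item * seq item)) :=
  [/\ isint x st.1, (0 <= st.1)%R, (st.1 <= (max_num x)%:R)%R,
      (forall it, it \in st.2.1 -> item_fits it) /\ (forall it, it \in st.2.2 -> item_fits it)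
    & size st.2.1 <= n /\ size st.2.2 <= n].

(** Cutting only adds and subtracts, so the common denominator persists, and a new end [lo + z] lies
    below [hi]; hence the numbers do not grow however often lists are cut. *)
Lemma cut_fits_step n st it : cut_fits n st -> item_fits it -> cut_fits n.+1 (cut_step st it).
Proof.
case: st => z [a b] [/= h1 h2 h3 [h4 h5] [h6 h7]] fit; have [i1 i2 i3 i4 i5] := fit.
rewrite /cut_step /=; case: (leP z 0%R) => hz.
  split=> //=; last by split=> //; apply: leqW.
  by split=> // it'; rewrite inE => /orP[/eqP ->|/h5].
case: (leP (it.2.2 - it.2.1)%R z) => hw.
  split=> //=; [exact: isintB (isintB _ _) | lra | lra | | by split=> //; apply: leqW].
  by split=> // it'; rewrite inE => /orP[/eqP ->|/h4].
have im : isint x (it.2.1 + z)%R by apply: isintD.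
split=> //=; [exact: isint0 | split=> it'].
  by rewrite inE => /orP[/eqP ->|/h4 //]; split=> //=; lra.
by rewrite inE => /orP[/eqP ->|/h5 //]; split=> //=; lra.
Qed.

Lemma cut_fits_fold z l : isint x z -> (0 <= z)%R -> (z <= (max_num x)%:R)%R ->
  (forall it, it \in l -> item_fits it) ->
  cut_fits (size l) (foldl (@cut_step _ _) (z, ([::], [::])) l).
Proof.
move=> h1 h2 h3; elim/last_ind: l => [|l it IH] h; first by split.
rewrite foldl_rcons size_rcons; apply: cut_fits_step.
  by apply: IH => it' h'; apply: h; rewrite mem_rcons inE h' orbT.
by apply: h; rewrite mem_rcons mem_head.
Qed.

Definition enc_cut (st : rat * (seq item * seq item)) :=
  Pair (Num st.1) (Pair (enc_items st.2.1) (enc_items st.2.2)).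

Lemma dsize_cut n st : cut_fits n st -> dsize (enc_cut st) <= num_bound x + 2 * items_bound x n + 2.
Proof.
case=> h1 h2 h3 [h4 h5] [h6 h7].
have := dsize_ok_num (ok_numI h1 h2 h3).
have := @dsize_items x st.2.1 n _ h6; have := @dsize_items x st.2.2 n _ h7.
have a4 : all (@okit x) st.2.1 by apply/allP => it /h4/item_fits_ok.
have a5 : all (@okit x) st.2.2 by apply/allP => it /h5/item_fits_ok.
move=> /(_ a5) e5 /(_ a4) e4 e1.
have -> : dsize (enc_cut st) = (dsize (Num st.1) + (dsize (enc_items st.2.1) + dsize (enc_items st.2.2)).+1).+1 by [].
lia.
Qed.

End CutBounds.

Section Items.
Variables (I : Type) (D : I -> Prop) (ctx : I -> data) (xx : I -> instance).
Notation items y := (seq ('I_(ncom (xx y)) * (rat * rat))).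

Lemma map_catrev (A B : Type) (f : A -> B) l l' : map f (catrev l l') = catrev (map f l) (map f l').
Proof. by elim: l l' => //= a l IH l'; rewrite IH. Qed.

Lemma pt_insert (l L : forall y, items y) :
  ptime D ctx (fun y => enc_items (l y)) -> ptime D ctx (fun y => enc_items (L y)) ->
  ptime D ctx (fun y => enc_items (insert (l y) (L y))).
Proof.
move=> hl hL; apply: (pt_cases (pt_nilp hl)).
  apply: pt_ext (pt_weaken hL _) _ => [y []|y [_]] //.
  by case: (l y).
have hl' : ptime (fun y => D y /\ ~~ nilp (map (@enc_item (xx y)) (l y))) ctx (fun y => enc_items (l y)).
  by apply: pt_weaken hl _ => y [].
have hL' : ptime (fun y => D y /\ ~~ nilp (map (@enc_item (xx y)) (l y))) ctx (fun y => enc_items (L y)).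
  by apply: pt_weaken hL _ => y [].
have hh := @pt_head _ _ _ _ (fun y => nth (Num 0) (map (@enc_item (xx y)) (l y)) 0) hl'.
apply: pt_ext (pt_cons (hh _) (pt_catrev hL' (pt_behead hl'))) _ => [y [_]|y [_]].
  by case: (l y).
by rewrite /enc_items /insert; case: (l y) => //= a l' _; rewrite map_catrev.
Qed.

Lemma pt_cut_step :
  ptime (fun=> True)
   (fun p : {y : I & ((rat * (items y * items y)) * ('I_(ncom (xx y)) * (rat * rat)))%type} =>
     Pair (ctx (projT1 p)) (Pair (enc_item (projT2 p).2) (enc_cut (projT2 p).1)))
   (fun p => enc_cut (cut_step (projT2 p).1 (projT2 p).2)).
Proof.
set src := (X in ptime _ X _).
have hz D' : ptime D' src (fun p => Num (projT2 p).1.1) by exact: pt_fst (pt_snd (pt_snd (pt_id _ _))).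
have ha D' : ptime D' src (fun p => enc_items (projT2 p).1.2.1).
  exact: pt_fst (pt_snd (pt_snd (pt_snd (pt_id _ _)))).
have hb D' : ptime D' src (fun p => enc_items (projT2 p).1.2.2).
  exact: pt_snd (pt_snd (pt_snd (pt_snd (pt_id _ _)))).
have hit D' : ptime D' src (fun p => enc_item (projT2 p).2) by exact: pt_fst (pt_snd (pt_id _ _)).
have hi D' : ptime D' src (fun p => enc_nat (projT2 p).2.1) by exact: pt_fst (hit _).
have hd D' : ptime D' src (fun p => Num (demand (coms (xx (projT1 p))) (projT2 p).2.1)).
  exact: pt_fst (pt_snd (hit _)).
have hlo D' : ptime D' src (fun p => Num (projT2 p).2.2.1) by exact: pt_fst (pt_snd (pt_snd (hit _))).
have hhi D' : ptime D' src (fun p => Num (projT2 p).2.2.2) by exact: pt_snd (pt_snd (pt_snd (hit _))).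
apply: pt_ext (pt_if (pt_le (hz _) (pt_const _ 0%R _))
  (pt_pair (hz _) (pt_pair (ha _) (pt_cons (hit _) (hb _))))
  (pt_if (pt_le (pt_sub (hhi _) (hlo _)) (hz _))
    (pt_pair (pt_sub (hz _) (pt_sub (hhi _) (hlo _))) (pt_pair (pt_cons (hit _) (ha _)) (hb _)))
    (pt_pair (pt_const _ 0%R _)
      (pt_pair (pt_cons (pt_pair (hi _) (pt_pair (hd _) (pt_pair (hlo _) (pt_add (hlo _) (hz _))))) (ha _))
        (pt_cons (pt_pair (hi _) (pt_pair (hd _) (pt_pair (pt_add (hlo _) (hz _)) (hhi _)))) (hb _)))))) _.
by move=> p _; rewrite /cut_step; case: ifP => // _; case: ifP.
Qed.

Lemma pt_cut (z : I -> rat) (l : forall y, items y) :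
  ptime D ctx (fun y => input (xx y)) ->
  ptime D ctx (fun y => Num (z y)) -> ptime D ctx (fun y => enc_items (l y)) ->
  (forall y, D y -> [/\ isint (xx y) (z y), (0 <= z y)%R, (z y <= (max_num (xx y))%:R)%R &
     forall it, it \in l y -> item_fits it]) ->
  ptime D ctx (fun y => Pair (enc_items (cut (z y) (l y)).1) (enc_items (cut (z y) (l y)).2)).
Proof.
move=> hx hz hl fit.
have hsz : pbound D ctx (fun y => size (l y)).
  by apply: pb_le (pb_ptime hl) => y _; have := size_enc_list (map (@enc_item (xx y)) (l y)); rewrite size_map => /ltnW.
apply: (@pt_snd _ _ _ (fun y => Num (foldl (@cut_step _ _) (z y, ([::], [::])) (l y)).1)).
have := @pt_foldl I D ctx (fun y => 'I_(ncom (xx y)) * (rat * rat))%type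
  (fun y => rat * (items y * items y))%type l (fun y => @enc_item (xx y))
  (fun y => (z y, ([::], [::]))) (fun y => @enc_cut (xx y)) (fun y => @cut_step _ _)
  (fun y => num_bound (xx y) + 2 * items_bound (xx y) (size (l y)) + 2) hl.
apply.
- apply: pt_pair hz _; exact: pt_pair (pt_nil _ _) (pt_nil _ _).
- by apply: pt_weaken pt_cut_step _.
- apply: pb_add (pb_const _ _ 2); apply: pb_add; first exact: pb_num_bound hx.
  exact: pb_mul (pb_const _ _ 2) (pb_items_bound hx hsz).
- move=> y l1 l2 Dy e; have [f1 f2 f3 f4] := fit y Dy.
  have fit1 : forall it, it \in l1 -> item_fits it by move=> it h; apply: f4; rewrite e mem_cat h.
  apply: leq_trans (dsize_cut (cut_fits_fold f1 f2 f3 fit1)) _.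
  rewrite leq_add2r leq_add2l leq_mul2l /items_bound leq_add2r leq_mul2r /= e size_cat.
  by rewrite leq_addr ?orbT.
Qed.

End Items.

(** * Routing in polynomial time *)

Section RouteState.
Variable x : instance.
Hypothesis vx : valid x.
Notation m := (narcs x).
Notation k := (ncom x).
Notation G := (graph x).
Notation C := (coms x).
Notation X := (@flow x).
Notation item := ('I_k * (rat * rat))%type.
Notation state := (seq (tree 'I_m * seq item) * seq ('I_m * item))%type.

Let flowX : multiflow G C X. Proof. by case: vx. Qed.
Let inst : multiflow_instance G C. Proof. by case: vx. Qed.

Definition pending_arcs (st : state) := sumn [seq size (arcs p.1) | p <- st.1].

(** The fourth clause is a potential: a pending arc will emit at most [k] items, so output and
    pending work together never exceed [k * m]. *)
Definition state_fits (st : state) :=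
  [/\ state_inv G C X st,
      forall p it, p \in st.1 -> it \in p.2 -> item_fits it,
      pending_arcs st <= m,
      size st.2 + k * pending_arcs st <= k * m
    & forall q, q \in st.2 -> item_fits q.2].

Lemma good_size T l : good G C X T l -> size l <= k.
Proof.
case=> u _ _ _ _; rewrite -(size_map fst) -[X in _ <= X](size_enum_ord k).
by apply: uniq_leq_size => // i _; rewrite mem_enum.
Qed.

Lemma fits_full i : item_fits (full_item C i).
Proof.
split=> //=; first exact: isint0.
- by have /andP[] := ok_num_demand i.
- exact: d_ge0 inst i.
- exact: demand_mag.
Qed.

Lemma fits_locals a b it : it \in locals C X a b -> item_fits it.
Proof. by case/mapP => i _ ->; apply: fits_full. Qed.

Lemma fits_cut T (l : seq item) : size (arcs T) <= m -> (forall it, it \in l -> item_fits it) ->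
  [/\ isint x (flow_through X T), (0 <= flow_through X T)%R, (flow_through X T <= (max_num x)%:R)%R &
     forall it, it \in l -> item_fits it].
Proof.
move=> h1 h2; split=> //; first exact: isint_flow_through.
  exact: (flow_through_ge0 flowX).
exact: flow_through_le.
Qed.

Lemma state_fits_step st : state_fits st -> state_fits (route_step C X st).
Proof.
move=> [h1 h2 h3 h4 h5].
have [pi pi_lt] : exists pi : 'I_(nodes x) -> rat, forall a, (pi (tail G a) < pi (head G a))%R.
  by case: vx => /series_parallel_potential.
have s1 := state_inv_step pi_lt inst flowX h1.
split=> //; move: h1 h2 h3 h4 h5 {s1}; case: st => [[|[T l] stk] out] //= h1 h2 h3 h4 h5; rewrite /route_step /=.
- have [/= _ _ g] := h1 _ (mem_head _ _).
  have fl it : it \in l -> item_fits it by apply: (h2 (T, l)); apply: mem_head.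
  have tl p it : p \in stk -> it \in p.2 -> item_fits it.
    by move=> ps; apply: h2; rewrite inE ps orbT.
  case: T h3 {h1 h2 h4 g} => [e|a b|a b] h3 p it //=; first exact: tl.
    rewrite !inE => /or3P[/eqP ->|/eqP ->|/tl h]; last exact: h.
      by rewrite /= (perm_mem (perm_insert_items _ _)) mem_cat => /orP[/fits_locals|/fl].
    by rewrite /= (perm_mem (perm_insert_items _ _)) mem_cat => /orP[/fits_locals|/fl].
  have sz : size (arcs a) <= m.
    by apply: leq_trans h3; rewrite /pending_arcs /= size_cat -addnA leq_addr.
  have [f1 f2 f3 f4] := fits_cut sz fl; have [_ _ _ [c1 c2] _] := cut_fits_fold f1 f2 f3 f4.
  rewrite !inE => /or3P[/eqP ->|/eqP ->|/tl h]; last exact: h.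
    exact: c1.
  exact: c2.
- by case: T h3 {h1 h2 h4} => [e|a b|a b]; rewrite /pending_arcs /= ?size_cat; lia.
- have [/= _ _ /good_size sl] := h1 _ (mem_head _ _).
  case: T h4 {h1 h2 h3} => [e|a b|a b]; rewrite /pending_arcs /= ?size_cat ?addnA //.
  move=> h4; rewrite catrevE size_cat size_rev size_map; apply: leq_trans h4.
  by rewrite mulnDr muln1 addnA leq_add2r addnC leq_add2l.
- case: T {h1 h3 h4} h2 => [e|a b|a b] h2 q //=; try exact: h5.
  rewrite catrevE mem_cat mem_rev => /orP[/mapP[it itl ->]|/h5 //].
  exact: (h2 _ _ (mem_head _ _) itl).
Qed.

Definition state_bound := m * (2 * tree_bound x + items_bound x k + 2) + k * m * (5 * num_bound x + 5) + 7.

Lemma dsize_state st : state_fits st -> dsize (enc_state st) <= state_bound.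
Proof.
case: st => stk out [h1 h2 h3 h4 h5].
have d1 : dsize (enc_list (map (@enc_job x) stk)) <= m * (2 * tree_bound x + items_bound x k + 2) + 3.
  rewrite dsize_enc_list leq_add2r -map_comp.
  apply: (@leq_trans (pending_arcs (stk, out) * (2 * tree_bound x + items_bound x k + 2))); last by rewrite leq_mul2r h3 orbT.
  move: h1 h2 h3 {h4 h5}; rewrite /pending_arcs /=; elim: stk => //= -[T l] stk IH h1 h2 h3.
  rewrite mulnDl; apply: leq_add; last first.
    apply: IH.
    - by move=> p ps; apply: h1; rewrite inE ps orbT.
    - by move=> p it ps; apply: h2; rewrite inE ps orbT.
    - by apply: leq_trans h3; apply: leq_addl.
  have [/= _ _ /good_size sl] := h1 _ (mem_head _ _).
  have al : all (@okit x) l by apply/allP => it /(h2 _ _ (mem_head _ _))/item_fits_ok.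
  have sz : size (arcs T) <= m by apply: leq_trans h3; apply: leq_addr.
  have := dsize_items al sl; have := dsize_enc_tree vx sz; have := size_arcs_gt0 T.
  rewrite /enc_job /=; case: (size (arcs T)) => // n _.
  have -> : 2 * tree_bound x * n.+1 = 2 * tree_bound x * n + 2 * tree_bound x by rewrite mulnS addnC.
  rewrite mulSn; have : 2 * tree_bound x * n <= n * (2 * tree_bound x + items_bound x k + 2) by rewrite mulnC leq_mul2l -addnA leq_addr orbT.
  lia.
have d2 : dsize (enc_list (map (@enc_out x) out)) <= k * m * (5 * num_bound x + 5) + 3.
  apply: leq_trans (@dsize_list_bound _ (5 * num_bound x + 4) _) _.
    move=> a /List.in_map_iff[q [<- /In_mem /h5/item_fits_ok/dsize_item h]].
    have -> : 5 * num_bound x + 4 = (num_bound x + (4 * num_bound x + 3)).+1 by lia.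
    exact: leq_add (dsize_arc q.1) h.
  rewrite size_map leq_add2r -addnS leq_mul2r; apply/orP; right.
  by apply: leq_trans h4; apply: leq_addr.
have -> : dsize (enc_state (stk, out)) = (dsize (enc_list (map (@enc_job x) stk)) + dsize (enc_list (map (@enc_out x) out))).+1 by [].
by rewrite /state_bound; lia.
Qed.

End RouteState.

Section RouteStep.
Notation items x := (seq ('I_(ncom x) * (rat * rat))).
Notation stack x := (seq (tree 'I_(narcs x) * items x)).
Notation outs x := (seq ('I_(narcs x) * ('I_(ncom x) * (rat * rat)))).

Let src_of x (st : stack x * outs x) := Pair (input x) (enc_state st).

Let fits (J : Type) (xx : J -> instance) (st : forall y, stack (xx y) * outs (xx y)) (y : J) :=
  valid (xx y) /\ state_fits (st y).

Lemma pt_route_leaf :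
  let st (p : {x : instance & ('I_(narcs x) * items x * (stack x * outs x))%type}) :=
    ((Leaf (projT2 p).1.1, (projT2 p).1.2) :: (projT2 p).2.1, (projT2 p).2.2) in
  ptime (fun=> True) (fun p => src_of (st p))
    (fun p => enc_state (route_step (coms (projT1 p)) (@flow (projT1 p)) (st p))).
Proof.
move=> st; set src := (X in ptime _ X _).
have hstk : ptime (fun=> True) src (fun p => enc_list (map (@enc_job (projT1 p)) (st p).1)).
  exact: pt_fst (pt_snd (pt_id _ _)).
have hout : ptime (fun=> True) src (fun p => enc_list (map (@enc_out (projT1 p)) (st p).2)).
  exact: pt_snd (pt_snd (pt_id _ _)).
have he : ptime (fun=> True) src (fun p => enc_nat (projT2 p).1.1) by exact: pt_snd (pt_fst (pt_fst hstk)).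
have hl : ptime (fun=> True) src (fun p => enc_items (projT2 p).1.2) by exact: pt_snd (pt_fst hstk).
apply: pt_pair; first exact: pt_snd hstk.
have hm := @pt_map _ _ src _ (fun p => (projT2 p).1.2) (fun p => @enc_item (projT1 p))
   (fun p it => enc_out ((projT2 p).1.1, it)) hl.
apply: pt_ext (pt_catrev (hm _) hout) _.
  apply: pt_pair; last exact: pt_snd (pt_id _ _).
  exact: (@pt_lift _ (fun p => 'I_(ncom (projT1 p)) * (rat * rat))%type (fun=> True) _ src _
    (fun y => enc_item (projT2 y)) he).
by move=> p _; rewrite /= map_catrev -map_comp.
Qed.

Lemma pt_route_ser :
  let st (p : {x : instance & (tree 'I_(narcs x) * tree 'I_(narcs x) * items x * (stack x * outs x))%type}) :=
    ((Ser (projT2 p).1.1.1 (projT2 p).1.1.2, (projT2 p).1.2) :: (projT2 p).2.1, (projT2 p).2.2) in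
  ptime (fun=> True) (fun p => src_of (st p))
    (fun p => enc_state (route_step (coms (projT1 p)) (@flow (projT1 p)) (st p))).
Proof.
move=> st; set src := (X in ptime _ X _).
have hstk : ptime (fun=> True) src (fun p => enc_list (map (@enc_job (projT1 p)) (st p).1)).
  exact: pt_fst (pt_snd (pt_id _ _)).
have hout : ptime (fun=> True) src (fun p => enc_list (map (@enc_out (projT1 p)) (st p).2)).
  exact: pt_snd (pt_snd (pt_id _ _)).
have hT := pt_snd (pt_fst (pt_fst hstk)).
have hl : ptime (fun=> True) src (fun p => enc_items (projT2 p).1.2) by exact: pt_snd (pt_fst hstk).
apply: pt_pair hout; apply: pt_cons.
  apply: pt_pair; first exact: pt_fst (pt_snd hT).
  exact: (pt_insert hl (pt_fst (pt_fst hT))).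
apply: pt_cons; last exact: pt_snd hstk.
apply: pt_pair; first exact: pt_snd (pt_snd hT).
exact: (pt_insert hl (pt_snd (pt_fst hT))).
Qed.

Lemma pt_route_par :
  let st (p : {x : instance & (tree 'I_(narcs x) * tree 'I_(narcs x) * items x * (stack x * outs x))%type}) :=
    ((Par (projT2 p).1.1.1 (projT2 p).1.1.2, (projT2 p).1.2) :: (projT2 p).2.1, (projT2 p).2.2) in
  ptime (fits st) (fun p => src_of (st p))
    (fun p => enc_state (route_step (coms (projT1 p)) (@flow (projT1 p)) (st p))).
Proof.
move=> st; set src := (X in ptime _ X _); set Dm := (X in ptime X _ _).
have hstk : ptime Dm src (fun p => enc_list (map (@enc_job (projT1 p)) (st p).1)).
  exact: pt_fst (pt_snd (pt_id _ _)).
have hout : ptime Dm src (fun p => enc_list (map (@enc_out (projT1 p)) (st p).2)).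
  exact: pt_snd (pt_snd (pt_id _ _)).
have hT := pt_snd (pt_fst (pt_fst hstk)).
have hl : ptime Dm src (fun p => enc_items (projT2 p).1.2) by exact: pt_snd (pt_fst hstk).
have hx : ptime Dm src (fun p => input (projT1 p)) by exact: pt_fst (pt_id _ _).
have hc := @pt_cut _ Dm src (fun p => projT1 p)
  (fun p => flow_through (@flow (projT1 p)) (projT2 p).1.1.1) (fun p => (projT2 p).1.2) hx (pt_fst hT) hl.
have {}hc := hc _.
apply: pt_pair hout; apply: pt_cons.
  apply: pt_pair; first exact: pt_fst (pt_snd hT).
  apply: pt_fst (hc _) => p [vx [_ h2 h3 _ _]]; apply: fits_cut => //.
    by apply: leq_trans h3; rewrite /pending_arcs /= size_cat -addnA leq_addr.
  by move=> it; apply: (h2 _ _ (mem_head _ _)).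
apply: pt_cons; last exact: pt_snd hstk.
apply: pt_pair; first exact: pt_snd (pt_snd hT).
apply: pt_snd (hc _) => p [vx [_ h2 h3 _ _]]; apply: fits_cut => //.
  by apply: leq_trans h3; rewrite /pending_arcs /= size_cat -addnA leq_addr.
by move=> it; apply: (h2 _ _ (mem_head _ _)).
Qed.

Definition tag (E : Type) (T : tree E) : nat :=
  match T with Leaf _ => 0 | Ser _ _ => 1 | Par _ _ => 2 end.

Lemma pt_route_step :
  ptime (fun p : {x : instance & (stack x * outs x)%type} => valid (projT1 p) /\ state_fits (projT2 p))
    (fun p => Pair (input (projT1 p)) (enc_state (projT2 p)))
    (fun p => enc_state (route_step (coms (projT1 p)) (@flow (projT1 p)) (projT2 p))).
Proof.
set src := (X in ptime _ X _).
have hst D : ptime D src (fun p => enc_state (projT2 p)) by exact: pt_snd (pt_id _ _).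
apply: (pt_cases (pt_nilp (pt_fst (hst _)))).
  apply: pt_ext (hst _) _ => -[x [stk out]] [_ /=].
  by case: stk.
have hT D : (forall p, D p -> ~~ nilp (map (@enc_job (projT1 p)) (projT2 p).1)) ->
    ptime D src (fun p => enc_nat (if (projT2 p).1 is q :: _ then tag q.1 else 0)).
  move=> nD; have hh := @pt_head _ D src _ (fun p => nth (Num 0) (map (@enc_job (projT1 p)) (projT2 p).1) 0) (pt_fst (hst D)).
  (* Displays the encoded head of the stack as nested pairs, so that its tag can be projected; the
     zeros for an empty stack are placeholders excluded by [D]. *)
  have {}hh : ptime D src (fun p => Pair
      (Pair (enc_nat (if (projT2 p).1 is q :: _ then tag q.1 else 0))
            (if (projT2 p).1 is q :: _ then (if enc_tree q.1 is Pair _ b then b else Num 0) else Num 0))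
      (if (projT2 p).1 is q :: _ then enc_items q.2 else Num 0)).
    apply: pt_ext (hh _) _ => -[x [stk out]] /nD /=; case: stk => //= -[T l] stk _.
    by rewrite /enc_job /=; case: T.
  exact: pt_fst (pt_fst hh).
apply: (pt_cases (pt_eqnat (hT _ _) (pt_const _ 0%:R%R _))); first by move=> p [].
  apply: pt_reindex pt_route_leaf _ => -[x [stk out]] [[_ /=]].
  by case: stk => // -[[e|a b|a b] l] stk _ //= _; exists (existT _ x (e, l, (stk, out))).
apply: (pt_cases (pt_eqnat (hT _ _) (pt_const _ 1%:R%R _))); first by move=> p [[]].
  apply: pt_reindex pt_route_ser _ => -[x [stk out]] [[[_ /=]]].
  by case: stk => // -[[e|a b|a b] l] stk _ //= _ _; exists (existT _ x (a, b, l, (stk, out))).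
apply: pt_reindex pt_route_par _ => -[x [stk out]] [[[/= h]]].
case: stk h => // -[[e|a b|a b] l] stk h _ //= _ _; exists (existT _ x (a, b, l, (stk, out))).
by split.
Qed.

End RouteStep.

(** * The number of pieces *)

Section PieceCount.
Variable R : realFieldType.
Implicit Types (ps acc : seq (R * R)) (b c : R).

Definition straddles c (p : R * R) := ((p.1 < c) && (c < p.2))%R.

Lemma size_refine_count b ps : size (refine_at b ps) = size ps + count (straddles b) ps.
Proof.
suff aux acc : size (foldl (refine_step b) acc ps) = size acc + (size ps + count (straddles b) ps).
  exact: (aux [::]).
elim: ps acc => [|p ps IH] acc /=; first by rewrite !addn0.
by rewrite IH /refine_step /straddles; case: ifP => _ /=; lia.
Qed.

(** A split replaces a piece by two with disjoint interiors inside it, so at most one of them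
    contains [c] in its interior, and only if the old piece did. *)
Lemma count_refine b c ps : count (straddles c) (refine_at b ps) <= count (straddles c) ps.
Proof.
suff aux acc : count (straddles c) (foldl (refine_step b) acc ps) <=
    count (straddles c) acc + count (straddles c) ps.
  exact: (aux [::]).
elim: ps acc => [|p ps IH] acc /=; first by rewrite addn0.
apply: leq_trans (IH _) _; rewrite addnA leq_add2r /refine_step.
case: ifP => [/andP[h1 h2]|_] /=; last by rewrite addnC.
rewrite addnA addnC leq_add2l /straddles /=.
case: (ltP p.1 c) => a1; case: (ltP c b) => a2; case: (ltP b c) => a3; case: (ltP c p.2) => a4 //=;
  exfalso; lra.
Qed.

(** At the start at most one piece straddles a given number, and [count_refine] keeps this true.
    Each breakpoint therefore splits at most one piece, and each item has two breakpoints. *)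
Lemma pieces_size (V E : finType) (k : nat) (C : commodities V R k) (out : seq (E * ('I_k * (R * R)))) :
  size (pieces C out) <= 1 + (size out).*2.
Proof.
suff aux ps : (forall c, count (straddles c) ps <= 1) ->
    size (foldl (@pieces_step V E R k C) ps out) <= size ps + (size out).*2.
  by apply: aux => c /=; case: (straddles c _).
elim: out ps => [|q out IH] ps h /=; first by rewrite addn0.
have step b : forall c, count (straddles c) (refine_at b ps) <= 1.
  by move=> c; apply: leq_trans (count_refine _ _ _) _.
apply: leq_trans (IH _ _) _; first by move=> c; apply: leq_trans (count_refine _ _ _) _.
rewrite /pieces_step size_refine_count size_refine_count.
have := h (q.2.2.1 / demand C q.2.1)%R.
by have := step (q.2.2.1 / demand C q.2.1)%R (q.2.2.2 / demand C q.2.1)%R; lia.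
Qed.

Lemma pieces_ends (V E : finType) (k : nat) (C : commodities V R k) (out : seq (E * ('I_k * (R * R))))
    (P : R -> Prop) : P 0%R -> P 1%R ->
  (forall q, q \in out -> P (q.2.2.1 / demand C q.2.1)%R /\ P (q.2.2.2 / demand C q.2.1)%R) ->
  forall p, p \in pieces C out -> P p.1 /\ P p.2.
Proof.
move=> P0 P1 Pout.
have refineP b ps : P b -> (forall p, p \in ps -> P p.1 /\ P p.2) ->
    forall p, p \in refine_at b ps -> P p.1 /\ P p.2.
  by move=> Pb h p /mem_refine[p0 /h[h1 h2]] [[-> _] //|[_ [] ->]].
suff aux ps : (forall p, p \in ps -> P p.1 /\ P p.2) ->
    forall p, p \in foldl (@pieces_step V E R k C) ps out -> P p.1 /\ P p.2.
  by apply: aux => p; rewrite inE => /eqP ->.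
elim: out Pout ps => [|q out IH] Pout ps h //=; apply: IH.
  by move=> q' q's; apply: Pout; rewrite inE q's orbT.
have [P2 P3] := Pout _ (mem_head _ _).
exact: (refineP _ _ P3 (refineP _ _ P2 h)).
Qed.

End PieceCount.

Definition enc_piece (p : rat * rat) := Pair (Num p.1) (Num p.2).
Definition enc_pieces ps := enc_list (map enc_piece ps).

Lemma pt_lt (I : Type) (D : I -> Prop) (ctx : I -> data) (u v : I -> rat) : ptime D ctx (fun x => Num (u x)) -> ptime D ctx (fun x => Num (v x)) ->
  pbool D ctx (fun x => (u x < v x)%R).
Proof. by move=> hu hv; apply: pt_ext (pt_not (pt_le hv hu)) _ => x _; rewrite ltNge. Qed.

Section Split.
Variables (I : Type) (D : I -> Prop) (ctx : I -> data).

(** A split copies [b] twice; the constant covers the additional pair constructors. *)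
Lemma dsize_refine_fold b l : dsize (enc_pieces (foldl (refine_step b) [::] l)) <=
  dsize (enc_pieces l) + size l * (2 * dsize (Num b) + 5).
Proof.
elim/last_ind: l => [|l [u v] IH] //; rewrite foldl_rcons size_rcons.
have E y z l' : dsize (enc_pieces ((y, z) :: l')) = (dsize (Num y) + dsize (Num z)).+2 + dsize (enc_pieces l').
  by rewrite /enc_pieces /=; lia.
have -> : dsize (enc_pieces (rcons l (u, v))) = dsize (enc_pieces ((u, v) :: l)).
  by rewrite /enc_pieces map_rcons -dsize_enc_rev rev_rcons !dsize_cons dsize_enc_rev.
rewrite E mulSn; move: IH; set a := foldl _ _ _; rewrite /refine_step.
case: ifP => _; rewrite !E;
  move: (dsize (Num b)) (dsize (Num u)) (dsize (Num v)) (dsize _) (dsize _) (size l * _); lia.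
Qed.

Lemma pt_refine (b : I -> rat) (ps : I -> seq (rat * rat)) :
  ptime D ctx (fun x => Num (b x)) -> ptime D ctx (fun x => enc_pieces (ps x)) ->
  ptime D ctx (fun x => enc_pieces (refine_at (b x) (ps x))).
Proof.
move=> hb hps.
have hsz : pbound D ctx (fun x => size (ps x)).
  by apply: pb_le (pb_ptime hps) => x _; have := size_enc_list (map enc_piece (ps x)); rewrite size_map => /ltnW.
apply: (@pt_foldl I D ctx (fun=> rat * rat)%type (fun=> seq (rat * rat)) ps (fun=> enc_piece)
  (fun=> [::]) (fun=> enc_pieces) (fun x => refine_step (b x))
  (fun x => dsize (enc_pieces (ps x)) + size (ps x) * (2 * dsize (Num (b x)) + 5)) hps).
- exact: pt_nil.
- set src := (X in ptime _ X _); set Dm := (X in ptime X _ _).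
  have hb' (D' : _ -> Prop) : (forall p, D' p -> D (projT1 p)) -> ptime D' src (fun p => Num (b (projT1 p))).
    move=> h; exact: (@pt_lift _ (fun=> (seq (rat * rat) * (rat * rat))%type) D D' ctx _
      (fun p => Pair (enc_piece (projT2 p).2) (enc_pieces (projT2 p).1)) hb).
  have h1 D' : ptime D' src (fun p => Num (projT2 p).2.1) by exact: pt_fst (pt_fst (pt_snd (pt_id _ _))).
  have h2 D' : ptime D' src (fun p => Num (projT2 p).2.2) by exact: pt_snd (pt_fst (pt_snd (pt_id _ _))).
  have hacc D' : ptime D' src (fun p => enc_pieces (projT2 p).1) by exact: pt_snd (pt_snd (pt_id _ _)).
  have d1 p : Dm p -> D (projT1 p) by case.
  have cnd : pbool Dm src (fun p => ((projT2 p).2.1 < b (projT1 p)) && (b (projT1 p) < (projT2 p).2.2))%R.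
    apply: pt_and; first by apply: pt_lt => //; apply: hb'.
    by apply: pt_lt => //; apply: hb' => p [/d1].
  apply: pt_ext (pt_if cnd (pt_cons (pt_pair (h1 _) (hb' _ _)) (pt_cons (pt_pair (hb' _ _) (h2 _)) (hacc _)))
    (pt_cons (pt_pair (h1 _) (h2 _)) (hacc _))) _.
  + by move=> p [/d1].
  + by move=> p [/d1].
  + by move=> p _; rewrite /refine_step; case: ifP.
- apply: pb_add; first exact: pb_ptime.
  apply: pb_mul hsz _; apply: pb_add (pb_const _ _ 5); apply: pb_mul (pb_const _ _ 2) _.
  exact: pb_ptime.
- move=> x l1 l2 _ e; apply: leq_trans (dsize_refine_fold _ _) _.
  apply: leq_add; first by rewrite e /enc_pieces map_cat dsize_enc_prefix.
  by rewrite leq_mul2r e size_cat leq_addr orbT.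
Qed.

End Split.

(** * The complete program *)

Section Output.
Notation items x := (seq ('I_(ncom x) * (rat * rat))).

Let J := ({x : instance & tree 'I_(narcs x)})%type.
(** The parse tree is part of the index and tied to the instance here, so later stages treat it as
    given while the program still starts from the bare input. *)
Let Dom (p : J) := valid (projT1 p) /\ parse (graph (projT1 p)) (narcs (projT1 p)) = [:: projT2 p].
Let inp (p : J) := input (projT1 p).
Let out (p : J) := routing (coms (projT1 p)) (@flow (projT1 p)) (narcs (projT1 p)) (projT2 p).

Let hx : ptime Dom inp (fun p => input (projT1 p)). Proof. exact: pt_id. Qed.

Lemma pt_parsed : ptime Dom inp (fun p => enc_node (projT2 p)).
Proof.
have h : ptime Dom inp (fun p => enc_nodes [:: projT2 p]).
  by apply: pt_reindex pt_parse _ => -[x T] [vx /= e]; exists x; rewrite e.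
exact: pt_fst h.
Qed.

Definition start_state (p : J) : seq (tree 'I_(narcs (projT1 p)) * items (projT1 p)) *
    seq ('I_(narcs (projT1 p)) * ('I_(ncom (projT1 p)) * (rat * rat))) :=
  ([:: (projT2 p, root_items (coms (projT1 p)) (@flow (projT1 p)) (projT2 p))], [::]).

Lemma start_fits p : Dom p -> state_fits (start_state p).
Proof.
case: p => x T [/= vx eT]; have [sp inst flowX] := vx.
have [T' eT' [w pT]] := parse_correct sp (card_ord (narcs x)).
have eTT : T' = T by move: eT'; rewrite eT => -[].
subst T'.
have [pi pi_lt] := series_parallel_potential sp.
have sz : size (arcs T) = narcs x by rewrite (perm_size pT) size_enum_ord.
split.
- move=> q; rewrite inE => /eqP -> /=; split=> //; first by rewrite (perm_uniq pT) enum_uniq.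
  exact (good_root pi_lt inst flowX w pT).
- by move=> q it; rewrite inE => /eqP -> /= /mapP[i _ ->]; apply: fits_full.
- by rewrite /pending_arcs /= sz addn0.
- by rewrite /pending_arcs /= sz addn0.
- by [].
Qed.

Lemma iter_fits p n : Dom p -> state_fits
  (iter n (iter 2 (route_step (coms (projT1 p)) (@flow (projT1 p)))) (start_state p)).
Proof.
move=> Dp; elim: n => [|n IH]; first exact: start_fits.
have [vx _] := Dp; rewrite iterS; exact: (state_fits_step vx (state_fits_step vx IH)).
Qed.

Lemma pt_routing : ptime Dom inp (fun p => enc_list (map (@enc_out (projT1 p)) (out p))).
Proof.
have hT := pt_parsed.
have hroot := pt_root_items (pt_demands hx) (pt_row hT).
have H := @pt_iter J Dom inp _ _ start_state (fun p => @enc_state (projT1 p))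
  (fun p => iter 2 (route_step (coms (projT1 p)) (@flow (projT1 p))))
  (fun p => @state_fits (projT1 p)) (fun p => state_bound (projT1 p)) (pt_arc_list hx).
have {}H : ptime Dom inp (fun p => enc_state
   (iter (narcs (projT1 p)) (iter 2 (route_step (coms (projT1 p)) (@flow (projT1 p)))) (start_state p))).
  apply: pt_ext (H _ _ _ _ _ _) _.
  - by apply: pt_pair; [apply: pt_cons; [exact: pt_pair (pt_tree hT) hroot | exact: pt_nil] | exact: pt_nil].
  - by move=> p; apply: start_fits.
  - by move=> p st [vx _] h; apply: (state_fits_step vx (state_fits_step vx h)).
  - set Dm := (X in ptime X _ _); set src := (X in ptime _ X _).
    have hx' : ptime Dm src (fun q => input (projT1 (projT1 q))) by exact: pt_fst (pt_id _ _).
    have h1 : ptime Dm src (fun q => enc_state (route_step (coms (projT1 (projT1 q))) (@flow (projT1 (projT1 q))) (projT2 q))).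
      by apply: pt_reindex pt_route_step _ => -[[x T] st] [[vx _] /= h]; exists (existT _ x st).
    apply: (pt_trans (pt_pair hx' h1)); apply: pt_reindex pt_route_step _ => -[[x T] st] [[vx _] /= h].
    exists (existT _ x (route_step (coms x) (@flow x) st)); split=> //=.
    by split=> //; apply: state_fits_step.
  - have bm := pb_narcs hx; have bk := pb_ncom hx.
    apply: pb_add (pb_const _ _ 7); apply: pb_add.
      apply: (pb_mul bm); apply: pb_add (pb_const _ _ 2); apply: pb_add (pb_items_bound hx bk).
      exact: pb_mul (pb_const _ _ 2) (pb_tree_bound hx).
    apply: (pb_mul (pb_mul bk bm)); apply: pb_add (pb_const _ _ 5).
    exact: pb_mul (pb_const _ _ 5) (pb_num_bound hx).
  - by move=> p st [vx _] h; apply: dsize_state.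
  - by move=> p _; rewrite size_map size_enum_ord.
exact: pt_snd H.
Qed.

Lemma pt_pieces : ptime Dom inp (fun p => enc_pieces (pieces (coms (projT1 p)) (out p))).
Proof.
(* A piece end is [0], [1] or a quotient [u / d i], whose size is at most
   [2 * (num_bound x + (num_bound x + 3))] by [dsize_mul] and [dsize_inv]; [h] combines this with
   the number of pieces. *)
pose B x := 4 * num_bound x + 6.
pose h (p : J) := (1 + (ncom (projT1 p) * narcs (projT1 p)).*2) * (B (projT1 p) + B (projT1 p)).+2 + 3.
have H := (@pt_foldl J Dom inp (fun p => 'I_(narcs (projT1 p)) * ('I_(ncom (projT1 p)) * (rat * rat)))%type
  (fun=> seq (rat * rat)) out (fun p => @enc_out (projT1 p))
  (fun=> [:: (0, 1)%R]) (fun=> enc_pieces)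
  (fun p => @pieces_step _ _ _ _ (coms (projT1 p))) h pt_routing).
apply: H.
- by apply: pt_cons; [exact: pt_pair (pt_const _ _ _) (pt_const _ _ _) | exact: pt_nil].
- set src := (X in ptime _ X _).
  have hit D' : ptime D' src (fun q => enc_item (projT2 q).2.2).
    exact: pt_snd (pt_fst (pt_snd (pt_id _ _))).
  have hacc D' : ptime D' src (fun q => enc_pieces (projT2 q).1) by exact: pt_snd (pt_snd (pt_id _ _)).
  have hd D' : ptime D' src (fun q => Num (demand (coms (projT1 (projT1 q))) (projT2 q).2.2.1)).
    exact: pt_fst (pt_snd (hit _)).
  have hlo D' : ptime D' src (fun q => Num (projT2 q).2.2.2.1) by exact: pt_fst (pt_snd (pt_snd (hit _))).
  have hhi D' : ptime D' src (fun q => Num (projT2 q).2.2.2.2) by exact: pt_snd (pt_snd (pt_snd (hit _))).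
  exact: pt_refine (pt_div (hhi _) (hd _)) (pt_refine (pt_div (hlo _) (hd _)) (hacc _)).
- have bB : pbound Dom inp (fun p => B (projT1 p)).
    by apply: pb_add (pb_const _ _ 6); apply: pb_mul (pb_const _ _ 4) (pb_num_bound hx).
  apply: pb_add (pb_const _ _ 3); apply: pb_mul.
    apply: pb_add (pb_const _ _ 1) _.
    apply: pb_le (pb_mul (pb_const _ _ 2) (pb_mul (pb_ncom hx) (pb_narcs hx))) => p _.
    by rewrite mul2n.
  by apply: pb_le (pb_add (pb_const _ _ 2) (pb_add bB bB)) => p _; lia.
- move=> p l1 l2 Dp e; have [vx _] := Dp.
  have [_ _ _ s1 s2] := iter_fits (narcs (projT1 p)) Dp.
  have so : size l1 <= ncom (projT1 p) * narcs (projT1 p).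
    apply: leq_trans (leq_trans (leq_addr _ _) s1).
    by rewrite -/(routing _ _ _ _) -/(out p) e size_cat leq_addr.
  rewrite -/(pieces (coms (projT1 p)) l1).
  apply: leq_trans (@dsize_list_bound _ (B (projT1 p) + B (projT1 p)).+1 _) _; last first.
    rewrite size_map /h leq_add2r leq_mul2r; apply/orP; right.
    by apply: leq_trans (pieces_size _ _) _; rewrite leq_add2l leq_double.
  have P0 q : q \in [:: 0%R; 1%R] -> dsize (Num q) <= B (projT1 p).
    have : 0 < num_bound (projT1 p) by rewrite /num_bound; have := S_gt0 (projT1 p); lia.
    by rewrite !inE /B => W0 /orP[]/eqP ->; have := dsize_bool true; have := dsize_bool false; rewrite /num_of_bool; lia.
  have frac (u : rat) i : ok_num (projT1 p) u -> dsize (Num (u / demand (coms (projT1 p)) i)%R) <= B (projT1 p).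
    move=> ou; apply: leq_trans (dsize_mul _ _) _.
    have := dsize_ok_num ou; have := dsize_ok_num (ok_num_demand i).
    have := dsize_inv (demand (coms (projT1 p)) i).
    rewrite /B; move: (dsize (Num _)) (dsize (Num _)) (dsize (Num _)) => a b c; lia.
  move=> a /List.in_map_iff[q [<- /In_mem qp]].
  have [] := @pieces_ends _ _ _ _ _ _ (fun u => dsize (Num u) <= B (projT1 p)) _ _ _ q qp.
  + by apply: P0; rewrite !inE eqxx.
  + by apply: P0; rewrite !inE eqxx orbT.
  + move=> q' q's; have fit : item_fits q'.2.
      by apply: s2; rewrite -/(routing _ _ _ _) -/(out p) e mem_cat q's.
    by have /andP[o1 o2] := item_fits_ok fit; split; apply: frac.
  + by move=> b1 b2; rewrite /enc_piece -[dsize (Pair _ _)]/((dsize (Num q.1) + dsize (Num q.2)).+1) ltnS leq_add.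
Qed.

Definition output (p : J) : data :=
  enc_list [seq Pair (Num (q.2 - q.1)%R) (enc_flow (rounded (coms (projT1 p)) (out p) q.1))
           | q <- pieces (coms (projT1 p)) (out p)].

Lemma pt_output : ptime Dom inp output.
Proof.
apply: (@pt_map J Dom inp (fun=> rat * rat)%type (fun p => pieces (coms (projT1 p)) (out p)) (fun=> enc_piece)
  (fun p q => Pair (Num (q.2 - q.1)%R) (enc_flow (rounded (coms (projT1 p)) (out p) q.1))) pt_pieces).
set src := (X in ptime _ X _); set Dm := (X in ptime X _ _).
have hq D' : ptime D' src (fun y => enc_piece (projT2 y)) by exact: pt_snd (pt_id _ _).
have lift1 (g : J -> data) : ptime Dom inp g -> ptime Dm src (fun y => g (projT1 y)).
  move=> hg; apply: (@pt_lift J (fun=> rat * rat)%type Dom Dm inp g (fun y => enc_piece (projT2 y)) hg).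
  exact: (fun y h => proj1 h).
apply: pt_pair; first exact: pt_sub (pt_snd (hq _)) (pt_fst (hq _)).
have harcs : ptime Dm src (fun y => enc_list [seq enc_nat e | e : 'I_(narcs (projT1 (projT1 y))) <- enum 'I_(narcs (projT1 (projT1 y)))]).
  apply: (lift1 (fun p => enc_list [seq enc_nat e | e : 'I_(narcs (projT1 p)) <- enum 'I_(narcs (projT1 p))])).
  apply: pt_ext (pt_iota (pt_arc_list hx)) _ => p _.
  by rewrite size_map size_enum_ord -enum_iota -map_comp.
apply: (@pt_map _ Dm src (fun y => 'I_(narcs (projT1 (projT1 y)))) (fun y => enum _) _
  (fun y e => enc_fun (fun i => Num (rounded (coms (projT1 (projT1 y))) (out (projT1 y)) (projT2 y).1 e i))) harcs).
set src2 := (X in ptime _ X _); set Dm2 := (X in ptime X _ _).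
have lift2 (g : _ -> data) : ptime Dm src g -> ptime Dm2 src2 (fun y => g (projT1 y)).
  move=> hg; apply: (@pt_lift _ (fun y => 'I_(narcs (projT1 (projT1 y)))) Dm Dm2 src g (fun y => enc_nat (projT2 y)) hg).
  by move=> y [].
have hdem : ptime Dm2 src2 (fun y => enc_demands (projT1 (projT1 (projT1 y)))).
  by apply: (lift2 (fun y => enc_demands (projT1 (projT1 y)))); apply: (lift1 (fun p => enc_demands (projT1 p)));
    apply: pt_demands.
apply: (@pt_map _ Dm2 src2 (fun y => 'I_(ncom (projT1 (projT1 (projT1 y))))) (fun y => enum _) _
  (fun y i => Num (rounded (coms (projT1 (projT1 (projT1 y)))) (out (projT1 (projT1 y))) (projT2 (projT1 y)).1 (projT2 y) i)) hdem).
set src3 := (X in ptime _ X _); set Dm3 := (X in ptime X _ _).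
have lift3 (g : _ -> data) : ptime Dm2 src2 g -> ptime Dm3 src3 (fun y => g (projT1 y)).
  move=> hg; apply: (@pt_lift _ (fun y => 'I_(ncom (projT1 (projT1 (projT1 y))))) Dm2 Dm3 src2 g
    (fun y => Pair (enc_nat (projT2 y)) (Num (demand (coms (projT1 (projT1 (projT1 (projT1 y))))) (projT2 y)))) hg).
  by move=> y [].
have hd D' : ptime D' src3 (fun y => Num (demand (coms (projT1 (projT1 (projT1 (projT1 y))))) (projT2 y))).
  exact: pt_snd (pt_snd (pt_id _ _)).
have hout : ptime Dm3 src3 (fun y => enc_list (map (@enc_out _) (out (projT1 (projT1 (projT1 y)))))).
  apply: (lift3 (fun y => enc_list (map (@enc_out _) (out (projT1 (projT1 y)))))).
  apply: (lift2 (fun y => enc_list (map (@enc_out _) (out (projT1 y))))).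
  exact: (lift1 _ pt_routing).
have hhas := @pt_has _ Dm3 src3 _ _ (fun y => @enc_out _)
  (fun y q => [&& q.1 == projT2 (projT1 y), q.2.1 == projT2 y &
     covers (coms _) (projT2 (projT1 (projT1 y))).1 q.2]) hout.
apply: pt_ext (pt_if (hhas _) (hd _) (pt_const _ 0%R _)) _; last first.
  by move=> y _; rewrite /rounded; case: ifP.
set src4 := (X in pbool _ X _).
have hq4 D' : ptime D' src4 (fun y => enc_out (projT2 y)) by exact: pt_snd (pt_id _ _).
have he4 D' : ptime D' src4 (fun y => enc_nat (projT2 (projT1 (projT1 y)))).
  exact: pt_snd (pt_fst (pt_fst (pt_id _ _))).
have hi4 D' : ptime D' src4 (fun y => enc_nat (projT2 (projT1 y))).
  exact: pt_fst (pt_snd (pt_fst (pt_id _ _))).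
have ht4 D' : ptime D' src4 (fun y => Num (projT2 (projT1 (projT1 (projT1 y)))).1).
  exact: pt_fst (pt_snd (pt_fst (pt_fst (pt_fst (pt_id _ _))))).
have hit D' : ptime D' src4 (fun y => enc_item (projT2 y).2) by exact: pt_snd (hq4 _).
have hdit D' : ptime D' src4 (fun y => Num (demand (coms (projT1 (projT1 (projT1 (projT1 (projT1 y)))))) (projT2 y).2.1)).
  exact: pt_fst (pt_snd (hit _)).
have hlo D' : ptime D' src4 (fun y => Num (projT2 y).2.2.1) by exact: pt_fst (pt_snd (pt_snd (hit _))).
have hhi D' : ptime D' src4 (fun y => Num (projT2 y).2.2.2) by exact: pt_snd (pt_snd (pt_snd (hit _))).
apply: pt_ext (pt_and (pt_eqnat (pt_fst (hq4 _)) (he4 _)) (pt_and (pt_eqnat (pt_fst (hit _)) (hi4 _))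
  (pt_and (pt_le (hlo _) (pt_mul (ht4 _) (hdit _))) (pt_lt (pt_mul (ht4 _) (hdit _)) (hhi _))))) _.
by move=> y _; rewrite -!val_eqE.
Qed.

Lemma output_combination p : output p = enc_combination
  (fun j : 'I_(size (pieces (coms (projT1 p)) (out p))) => (piece j).2 - (piece j).1)%R
  (fun j => rounded (coms (projT1 p)) (out p) (piece j).1).
Proof.
rewrite /output /enc_combination /enc_fun /piece.
set ps := pieces _ _; congr enc_list.
rewrite -{1}(mkseq_nth (0, 1)%R ps) /mkseq -enum_iota -!map_comp.
exact: eq_map.
Qed.

End Output.

Lemma combination_computable : exists (P : prog) (c r : nat),
  forall (n m k : nat) (G : digraph 'I_n 'I_m) (C : commodities 'I_n rat k) (X : 'I_m -> 'I_k -> rat),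
    series_parallel G -> multiflow_instance G C -> multiflow G C X ->
    exists (N : nat) (lam : 'I_N -> rat) (Y : 'I_N -> 'I_m -> 'I_k -> rat) (t : nat),
      [/\ unsplittable_combination G C X lam Y,
          runs P (enc_input G C X) t (enc_combination lam Y)
        & t <= c * dsize (enc_input G C X) ^ r].
Proof.
have [P [c [r run]]] := pt_output; exists P, c, r => n m k G C X sp inst flowX.
have [T eT [w pT comb]] := algorithm_correct sp inst flowX (card_ord m).
pose x := Instance G C X.
have [t rt le] := run (existT _ x T) (conj (And3 sp inst flowX) eT).
rewrite output_combination in rt.
by do 3!eexists; exists t; split; [exact: comb | exact: rt | exact: le].
Qed.

Local Close Scope nat_scope.

Theorem theorem5 :
  (forall (R : realType) (V E : finType) (G : digraph V E) (k : nat)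
          (C : commodities V R k) (X : E -> 'I_k -> R),
     series_parallel G -> multiflow_instance G C -> multiflow G C X ->
     exists (N : nat) (lam : 'I_N -> R) (Y : 'I_N -> E -> 'I_k -> R),
       unsplittable_combination G C X lam Y)
  /\
  (exists (P : prog) (c r : nat),
     forall (n m k : nat) (G : digraph 'I_n 'I_m)
            (C : commodities 'I_n rat k) (X : 'I_m -> 'I_k -> rat),
       series_parallel G -> multiflow_instance G C -> multiflow G C X ->
       exists (N : nat) (lam : 'I_N -> rat) (Y : 'I_N -> 'I_m -> 'I_k -> rat)
              (t : nat),
         [/\ unsplittable_combination G C X lam Y,
             runs P (enc_input G C X) t (enc_combination lam Y)
           & (t <= c * dsize (enc_input G C X) ^ r)%N]).
Proof.
split; last exact: combination_computable.
move=> R V E G k C X; exact: combination_exists.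
Qed.
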